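(* Let $n\ge 1$ and let $H^*[z]=\sum_{i\ge0}H^*_iz^i$ be the equivariant $H^*$-series of the permutahedron $\Pi_n$ under the action of $S_n$. Then the following three statements hold. (1) If $H^*[z]$ is effective, then $H^*[1]$ is the character of a permutation representation of $S_n$. (2) For every $\sigma\in S_n$, the quantity $$H^*[1](\sigma)=\frac{\dim(\Pi_n^\sigma)!\cdot\mathrm{vol}(\Pi_n^\sigma)\cdot\det(I-\rho(\sigma))_{(M^\sigma)^\perp}}{\mathrm{ind}(\Pi_n^\sigma)}$$ is a non-negative integer. (3) If $H^*[z]$ is a polynomial and the $i$-th coefficient of the $h^*$-polynomial of $\Pi_n$ is positive, then the trivial representation of $S_n$ occurs with non-zero multiplicity in the virtual character $H^*_i$.
   Context: $S_n$ acts on $\mathbb{R}^n$ and $\mathbb{Z}^n$ by permuting coordinates. The permutahedron $\Pi_n$ is the convex hull of all permutations of $(1,2,\dots,n)$; $\Pi_n^\sigma$ is the polytope of points of $\Pi_n$ fixed by $\sigma$. Let $M$ be the sublattice of $\mathbb{Z}^n$ obtained by translating the affine span of $\Pi_n$ to the origin (i.e. $M=\{x\in\mathbb{Z}^n:\sum_ix_i=0\}$), with induced representation $\rho:S_n\to GL(M)$. For $t\ge0$ let $\chi_{t\Pi_n}$ be the permutation character of $S_n$ acting on $t\Pi_n\cap\mathbb{Z}^n$, so $\chi_{t\Pi_n}(g)=|t\Pi_n^g\cap\mathbb{Z}^n|$ (with value $1$ at $t=0$). Let $R(S_n)$ be the ring of virtual characters (integer combinations of irreducible complex characters). The equivariant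 $H^*$-series $H^*[z]=\sum_{i\ge0}H^*_iz^i\in R(S_n)[[z]]$ is defined by $$\sum_{t\ge0}\chi_{t\Pi_n}(g)z^t=\frac{H^*[z](g)}{(1-z)\det(I-\rho(g)z)}\qquad\text{for all } g\in S_n.$$ For each $g$, $H^*[z](g)$ is the power series expansion of a rational function of $z$ without pole at $z=1$, and $H^*[1](g)$ denotes the value of this rational function at $z=1$; when $H^*[z]$ is a polynomial, $H^*[1]=\sum_iH^*_i$. $H^*[z]$ is effective if each $H^*_i$ is the character of a (possibly zero) representation (if it is effective, it is a polynomial). $H^*[z]$ is a polynomial if $H^*_i=0$ for all but finitely many $i$. The $h^*$-polynomial of $\Pi_n$ is $h^*[z]=H^*[z](e)$ where $e$ is the identity, equivalently $h^*[z]=(1-z)^{n}\sum_{t\ge0}|t\Pi_n\cap\mathbb{Z}^n|z^t$. For a polytope $P\subset\mathbb{R}^n$, $\mathrm{ind}(P)$ is the smallest positive integer $k$ such that the affine span of $kP$ contains a point of $\mathbb{Z}^n$. $M^\sigma$ is the sublattice of $M$ fixed by $\sigma$, and $\det(I-\rho(\sigma))_{(M^\sigma)^\perp}$ is the determinant of $I-\rho(\sigma)$ restricted to the orthogonal complement of $M^\sigma\otimes\mathbb{R}$ in $M\otimes\mathbb{R}$ (equal to $1$ if this complement is zero). Volumes are normalized so that a primitive lattice parallelotope (one whose edge vectors form a basis of the lattice of integer points in their linear span) has volume $1$; a point has volume $1$. *)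

(* Defs.v *)
From HB Require Import structures.
From mathcomp Require Import all_boot all_order all_algebra all_fingroup.
From mathcomp Require Import all_field all_character.
From mathcomp Require Import finmap all_classical all_reals all_analysis.

Set Implicit Arguments.
Unset Strict Implicit.
Unset Printing Implicit Defensive.

Import Order.TTheory GRing.Theory Num.Theory.

Local Open Scope classical_set_scope.
Local Open Scope ring_scope.

Definition affine_span (R : realType) n (P : set 'rV[R]_n) : set 'rV[R]_n :=
  [set x | exists k (p : 'I_k -> 'rV[R]_n) (w : 'I_k -> R),
     [/\ forall i, P (p i), \sum_i w i = 1 & x = \sum_i w i *: p i]].

Definition affine_map (R : realType) d n (p : 'rV[R]_n) (B : 'M[R]_(d, n))
  (c : 'rV[R]_d) : 'rV[R]_n := p + c *m B.

(* The value is unique for a nonempty P; the default 0 is only used for the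
   empty set. *)
Definition affine_dim (R : realType) n (P : set 'rV[R]_n) : nat :=
  xget 0%N [set d | exists (p : 'rV[R]_n) (B : 'M[R]_(d, n)),
    row_free B /\ affine_span P = range (affine_map p B)].

Definition dilate (R : realType) n (t : nat) (P : set 'rV[R]_n) :
  set 'rV[R]_n := [set t%:R *: x | x in P].

Definition lattice_points (R : realType) n (P : set 'rV[R]_n) :
  set 'rV[int]_n := [set z | P (map_mx intr z)].

(* Least positive k such that aff(kP) contains an integer point; the default 0
   is only used when there is no such k (never for a rational polytope). *)
Definition lattice_index (R : realType) n (P : set 'rV[R]_n) : nat :=
  let meets k := lattice_points (affine_span (dilate k P)) !=set0 in
  xget 0%N [set k | [/\ (0 < k)%N, meets k &
    forall j, (0 < j)%N -> meets j -> (k <= j)%N]].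

(* d-dimensional Lebesgue measure, as an iterated product of the
   one-dimensional one (the value on A of the d-fold product measure, with the
   Dirac mass on the one-point space R^0). *)
Fixpoint lebesgue_rV (R : realType) d : set 'rV[R]_d -> \bar R :=
  match d with
  | 0 => fun A => (\1_A (0 : 'rV[R]_0))%:E
  | d'.+1 => fun A =>
      (\int[@lebesgue_measure R]_x
         lebesgue_rV [set v : 'rV[R]_d' | A (row_mx x%:M v : 'rV_(1 + d'))])%E
  end.

(* (p, B) is an affine coordinate system of aff(P) whose direction vectors (the
   rows of B) form a basis of the lattice of integer points of the direction
   space of aff(P). *)
Definition lattice_frame (R : realType) n (P : set 'rV[R]_n) d
    (p : 'rV[R]_n) (B : 'M[int]_(d, n)) : Prop :=
  let BR : 'M[R]_(d, n) := map_mx intr B in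
  [/\ row_free BR,
      affine_span P = range (affine_map p BR) &
      forall z : 'rV[int]_n, (map_mx intr z <= BR)%MS ->
        exists c : 'rV[int]_d, z = c *m B].

(* Lattice-normalized volume: Lebesgue measure in the coordinates of a lattice
   frame. Two frames differ by a unimodular change of coordinates and a
   translation, so the value does not depend on the frame. *)
Definition normalized_volume (R : realType) n (P : set 'rV[R]_n) : \bar R :=
  xget 0%E [set v | exists d (p : 'rV[R]_n) (B : 'M[int]_(d, n)),
    lattice_frame P p B /\
    v = lebesgue_rV (P \o affine_map p (map_mx intr B))].

(* S_n acts on row vectors by x |-> x *m perm_mx s, which sends the basis
   vector e_i to e_(s i). This is a right action, in accordance with the
   left-to-right product of permutations of the library. *)

Definition perm_vertex (R : realType) n (s : 'S_n) : 'rV[R]_n :=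
  \row_i (s i).+1%:R.

Definition permutahedron (R : realType) n : set 'rV[R]_n :=
  [set x | exists w : 'S_n -> R,
     [/\ forall s, 0 <= w s, \sum_s w s = 1 &
         x = \sum_s w s *: perm_vertex R s]].

Arguments permutahedron : clear implicits.

Definition fixed_permutahedron (R : realType) n (g : 'S_n) : set 'rV[R]_n :=
  [set x | permutahedron R n x /\ x *m perm_mx g = x].
Arguments fixed_permutahedron R {n} g.

(* Its row space is M (x) F: the vectors with coordinate sum 0. *)
Definition Mspace (F : fieldType) n : 'M[F]_n := kermx (const_mx 1 : 'cV[F]_n).
Arguments Mspace : clear implicits.

(* Matrix of rho(g) in a basis of M (x) F. *)
Definition rho (F : fieldType) n (g : 'S_n) : 'M[F]_(\rank (Mspace F n)) :=
  restrictmx (Mspace F n) (perm_mx g).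

(* The row space of fixedM is M^g (x) F, that of fixedM_perp its orthogonal
   complement in M (x) F. *)
Definition fixedM (F : fieldType) n (g : 'S_n) : 'M[F]_n :=
  (Mspace F n :&: eigenspace (perm_mx g) 1)%MS.

Definition fixedM_perp (F : fieldType) n (g : 'S_n) : 'M[F]_n :=
  (Mspace F n :&: kermx (fixedM F g)^T)%MS.

Definition det_perp (F : fieldType) n (g : 'S_n) : F :=
  \det (restrictmx (fixedM_perp F g) (1%:M - perm_mx g)).

(* The permutation character of S_n on the lattice points of t Pi_n. *)
Definition ehrhart_char (R : realType) n (t : nat) (g : 'S_n) : nat :=
  #|` fset_set [set z | lattice_points (dilate t (permutahedron R n)) z /\
                        z *m perm_mx g = z]|.

(* (1 - z) det(I - rho(g) z) *)
Definition Hstar_denom n (g : 'S_n) : {poly algC} :=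
  (1 - 'X) * \det (1%:M - 'X *: map_mx polyC (rho algC g)).

(* The coefficient of z^i in
   (1 - z) det(I - rho(g) z) * \sum_t chi_t(g) z^t. *)
Definition Hstar_coef (R : realType) n (i : nat) (g : 'S_n) : algC :=
  \sum_(j < i.+1) (Hstar_denom g)`_j * (ehrhart_char R (i - j) g)%:R.

Lemma card_fset_set_bij (T : choiceType) (f f' : T -> T) (A B : set T) :
  cancel f f' -> f @` A = B -> f' @` B = A ->
  #|` fset_set A| = #|` fset_set B|.
Proof.
move=> fK fA f'B; have [finA|infA] := pselect (finite_set A); last first.
  have infB : ~ finite_set B.
    by move=> finB; apply: infA; rewrite -f'B; apply: finite_image.
  rewrite /fset_set; case: pselect => // ?; case: pselect => //.
rewrite -fA fset_set_image // card_imfset //=; exact: can_inj fK.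
Qed.

Lemma permutahedron_perm (R : realType) n (h : 'S_n) (x : 'rV[R]_n) :
  permutahedron R n x -> permutahedron R n (x *m perm_mx h).
Proof.
case=> w [w0 w1 ->]; exists (fun s => w (h * s)%g); split => //.
  by rewrite -w1 [RHS](reindex_inj (mulgI h)).
rewrite mulmx_suml (reindex_inj (mulgI h)) /=; apply: eq_bigr => s _.
rewrite -scalemxAl; congr (_ *: _); apply/rowP => i.
rewrite -[h in perm_mx h]invgK -col_permE !mxE permM; congr (_.+1%:R).
by rewrite permKV.
Qed.

Lemma ehrhart_charJ (R : realType) n t (g h : 'S_n) :
  ehrhart_char R t (g ^ h) = ehrhart_char R t g.
Proof.
pose S g := [set z | lattice_points (dilate t (permutahedron R n)) z /\
                        z *m perm_mx g = z].
have SJ (k k' : 'S_n) z : S k z -> S (k ^ k')%g (z *m perm_mx k').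
  case=> -[x Px xz] zk; split.
    exists (x *m perm_mx k'); first exact: permutahedron_perm.
    by rewrite scalemxAl xz map_mxM map_perm_mx.
  rewrite conjgE !perm_mxM !mulmxA -(mulmxA z) -perm_mxM mulgV perm_mx1 mulmx1.
  by rewrite zk.
have K (k : 'S_n) : cancel (fun z : 'rV[int]_n => z *m perm_mx k)
                           (fun z => z *m perm_mx k^-1).
  by move=> z; rewrite -mulmxA -perm_mxM mulgV perm_mx1 mulmx1.
have K' (k : 'S_n) : cancel (fun z : 'rV[int]_n => z *m perm_mx k^-1)
                           (fun z => z *m perm_mx k).
  by move=> z; rewrite -mulmxA -perm_mxM mulVg perm_mx1 mulmx1.
have SJV z : S (g ^ h)%g z -> S g (z *m perm_mx h^-1).
  by move=> /SJ-/(_ h^-1%g); rewrite conjgK.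
symmetry; apply: (card_fset_set_bij (K h)); apply/seteqP; split => z /=.
- by case=> y Sy <-; apply: SJ.
- by move=> Sz; exists (z *m perm_mx h^-1); [apply: SJV | rewrite K'].
- by case=> y Sy <-; apply: SJV.
- by move=> Sz; exists (z *m perm_mx h); [apply: SJ | rewrite K].
Qed.

Lemma Mspace_stable (F : fieldType) n (g : 'S_n) :
  stablemx (Mspace F n) (perm_mx g).
Proof.
apply/sub_kermxP; rewrite -mulmxA.
have -> : perm_mx g *m (const_mx 1 : 'cV[F]_n) = const_mx 1.
  by rewrite -row_permE; apply/matrixP => i j; rewrite !mxE.
exact: mulmx_ker.
Qed.

Lemma rhoM (F : fieldType) n (g h : 'S_n) :
  rho F (g * h)%g = rho F g *m rho F h.
Proof.
by rewrite /rho perm_mxM conjmxM ?row_base_free // inE stablemx_row_base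
           Mspace_stable.
Qed.

Lemma rho1 (F : fieldType) n : rho F (1%g : 'S_n) = 1%:M.
Proof. by rewrite /rho perm_mx1 conjmx_scalar ?row_base_free. Qed.

Lemma Hstar_denomJ n (g h : 'S_n) : Hstar_denom (g ^ h) = Hstar_denom g.
Proof.
rewrite /Hstar_denom; congr (_ * _).
pose f (M : 'M[algC]_(\rank (Mspace algC n))) := map_mx polyC M.
have fM (a b : 'S_n) :
  f (rho algC (a * b)%g) = f (rho algC a) *m f (rho algC b).
  by rewrite /f rhoM map_mxM.
have f1 : f (rho algC (h^-1 * h)%g) = 1%:M.
  by rewrite /f mulVg rho1 map_scalar_mx.
rewrite -/(f (rho algC (g ^ h)%g)) -/(f (rho algC g)).
have -> : 1%:M - 'X *: f (rho algC (g ^ h)%g) =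
  f (rho algC h^-1%g) *m (1%:M - 'X *: f (rho algC g)) *m f (rho algC h).
  rewrite mulmxBr mulmxBl mulmx1 -fM f1 conjgE !fM.
  by rewrite -scalemxAr -scalemxAl mulmxA.
rewrite !det_mulmx mulrC mulrA -det_mulmx -fM mulgV -(mulVg h) f1 det1.
by rewrite mul1r.
Qed.

Lemma Hstar_class_fun (R : realType) n i :
  is_class_fun <<[set: 'S_n]%G>>%g [ffun g : 'S_n => Hstar_coef R i g].
Proof.
apply: intro_class_fun => [g h _ _|g].
  by apply: eq_bigr => j _; rewrite Hstar_denomJ ehrhart_charJ.
by rewrite mem_gen ?finset.in_setT.
Qed.

Definition Hstar (R : realType) n (i : nat) : 'CF([set: 'S_n]%G) :=
  Cfun 0 (Hstar_class_fun R n i).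

(* H*[1](g) = v: the power series \sum_i H*_i(g) z^i is the expansion of a
   rational function p / q without pole at 1, whose value at 1 is v. Such a v
   is unique. *)
Definition Hstar_at1 (R : realType) n (g : 'S_n) (v : algC) : Prop :=
  exists p q : {poly algC},
    [/\ q.[1] != 0,
        forall i, p`_i = \sum_(j < i.+1) q`_j * Hstar R n (i - j) g &
        v = p.[1] / q.[1]].

Definition Hstar_effective (R : realType) n : Prop :=
  forall i, Hstar R n i \is a character.

Definition Hstar_polynomial (R : realType) n : Prop :=
  exists N, forall i, (N <= i)%N -> Hstar R n i = 0.

(* Coefficients of h*[z] = H*[z](e). *)
Definition hstar (R : realType) n (i : nat) : algC := Hstar R n i 1%g.

Definition is_perm_character n (phi : 'CF([set: 'S_n]%G)) : Prop :=
  exists (X : finType) (to : {action 'S_n &-> X}),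
    forall g, phi g = #|('Fix_to[g])%g|%:R.

(* Main.v *)
Require Import Defs.
From mathcomp Require Import all_boot all_order all_algebra all_fingroup.
From mathcomp Require Import all_field all_character.
From mathcomp Require Import finmap all_classical all_reals all_analysis.
From mathcomp Require Import measurable_realfun.
From mathcomp Require Import zify ring lra.

(** The points of the permutahedron are the score vectors of fractional tournaments
([score_permutahedron], [permutahedron_score]). Averaging over the cycles of a
permutation g, the fixed polytope becomes the set of scores of tournaments
between the cycles, and this is a zonotope with integral generators and a
half-integral base point ([fixed_permutahedron_zono]); the base point is
integral when all cycles are odd.

The lattice points of a translated zonotope are counted by removing one
generator v at a time: after a unimodular change of coordinates v is c times a
basis vector, and it adds exactly c points on each line that meets the rest of the
zonotope over a lattice point of the projection ([zpoints_deletion_contraction]). So the count for the t-th dilate is a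
polynomial in t whose top coefficient L does not depend on the translation
([poly_growth_exists]). Comparing the zonotope with unions of small cubes, L is
also its volume ([zono_volume]). For the fixed polytope of g, of dimension d, the
count is A(t) + (-1)^t B(t) because twice the base point is integral, and the
coefficient of degree d of A is the volume divided by the index, which is 1 or 2
([ehrhart_altpoly]).

The denominator of the equivariant series is the product of the 1 - X^l over the
cycle lengths l ([det_rho]). It is (1 - X)^(d+1) times a polynomial whose value
at 1 is the product of the lengths, and this product is also the determinant of
I - rho(g) on the orthogonal complement of the fixed space ([det_perpE]). This
gives the formula for the value at 1. It is an integer, for if the index is 2
then the base point is not integral, and some cycle has even length
([Hstar_at1_volume]).

The other two statements turn out to concern n <= 3 only. An effective series is
a polynomial ([effective_polynomial]). For n >= 4 it is not one: at a
transposition the denominator allows only a constant B, whereas the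
translation by the base point loses a number of lattice points that grows at
least linearly with t ([zpoints_linear_gap], [not_polynomial]). For n <= 3 the
series is computed explicitly ([small_Hstar]). Its coefficients have nonnegative
values, so those with a positive value at the identity contain the trivial
character, and for n = 3 their sum is the permutation character of the set made of
three points, two signs and one fixed point ([card_S3_fix]). *)

Set Implicit Arguments.
Unset Strict Implicit.
Unset Printing Implicit Defensive.

Import Order.TTheory GRing.Theory Num.Theory.
Local Open Scope ring_scope.

(** * Power series with quasi-polynomial coefficients *)

Section Convolution.
Variable F : numFieldType.
Implicit Types (p q A B : {poly F}) (u v : nat -> F).

(** The coefficient of X^i in the product of the polynomial p and the formal power
series whose coefficients are the values of u. *)
Definition convol p u i : F := \sum_(j < i.+1) p`_j * u (i - j)%N.

(** A quasi-polynomial of period 2: A + B on even integers, A - B on odd ones. *)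
Definition altpoly A B (t : nat) : F := A.[t%:R] + (-1) ^+ t * B.[t%:R].

Lemma convol_coef n p u i : (i < n)%N -> convol p u i = (p * \poly_(k < n) u k)`_i.
Proof.
move=> ltin; rewrite coefM; apply: eq_bigr => j _.
by rewrite coef_poly ifT //; apply: leq_ltn_trans ltin; rewrite leq_subr.
Qed.

Lemma convolM p q u i : convol (p * q) u i = convol p (convol q u) i.
Proof.
rewrite (@convol_coef i.+1) // -mulrA coefM; apply: eq_bigr => j _.
by rewrite -convol_coef // ltnS leq_subr.
Qed.

Lemma eq_convol p u v : u =1 v -> convol p u =1 convol p v.
Proof. by move=> uv i; apply: eq_bigr => j _; rewrite uv. Qed.

Lemma convolD p u v i : convol p (fun t => u t + v t) i = convol p u i + convol p v i.
Proof. by rewrite -big_split; apply: eq_bigr => j _; rewrite mulrDr. Qed.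

Lemma convol1 u : convol 1 u =1 u.
Proof.
by move=> i; rewrite (@convol_coef i.+1) // mul1r coef_poly ltnSn.
Qed.

Lemma convol_delta p a : convol p (fun i => a *+ (i == 0%N)) =1 fun i => p`_i * a.
Proof.
move=> i; rewrite /convol big_ord_recr /= subnn big1 ?add0r // => j _.
by rewrite subn_eq0 leqNgt ltn_ord mulr0.
Qed.

Lemma convol_1subX u i :
  convol (1 - 'X) u i = u i - (if i is k.+1 then u k else 0).
Proof.
rewrite (@convol_coef i.+1) // mulrBl mul1r coefB coefXM coef_poly ltnSn.
by case: i => // i; rewrite coef_poly ltnW.
Qed.

Lemma convol_1addX u i :
  convol (1 + 'X) u i = u i + (if i is k.+1 then u k else 0).
Proof.
rewrite (@convol_coef i.+1) // mulrDl mul1r coefD coefXM coef_poly ltnSn.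
by case: i => // i; rewrite coef_poly ltnW.
Qed.

(** The substitution of - X for X. *)
Lemma convol_alt k u i :
  convol ((1 + 'X) ^+ k) (fun t => (-1) ^+ t * u t) i
    = (-1) ^+ i * convol ((1 - 'X) ^+ k) u i.
Proof.
elim: k u i => [|k IH] u i; first by rewrite !expr0 !convol1.
rewrite !exprSr !convolM -IH; apply: eq_convol => {}i.
rewrite convol_1subX convol_1addX; case: i => [|i]; first by rewrite subr0 addr0.
by rewrite exprS; ring.
Qed.

(** The effect of the factor 1 - X on a series: it takes the coefficients A(t) to
their backward difference. On the alternating part (-1)^t B(t) the same factor
acts through psum instead. *)
Definition pdiff A := A - (A \Po ('X - 1)).
Definition psum A := A + (A \Po ('X - 1)).

Lemma horner_pred A (i : nat) : (A \Po ('X - 1)).[i.+1%:R] = A.[i%:R].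
Proof. by rewrite horner_comp !hornerE -natr1 addrK. Qed.

Lemma pdiffE A (i : nat) : (pdiff A).[i.+1%:R] = A.[i.+1%:R] - A.[i%:R].
Proof. by rewrite /pdiff hornerD hornerN horner_pred. Qed.

Lemma psumE A (i : nat) : (psum A).[i.+1%:R] = A.[i.+1%:R] + A.[i%:R].
Proof. by rewrite /psum hornerD horner_pred. Qed.

Lemma pdiff_Xn k :
  (size (pdiff ('X^(k.+1) : {poly F})) <= k.+1)%N /\ (pdiff ('X^(k.+1)))`_k = k.+1%:R.
Proof.
rewrite /pdiff rmorphXn /= comp_polyX subrXX opprB addrC subrK mul1r.
have E (i : 'I_k.+1) : size ('X^(k.+1.-1 - i) * ('X - 1 : {poly F}) ^+ i) = k.+1
   /\ ('X^(k.+1.-1 - i) * ('X - 1 : {poly F}) ^+ i)`_k = 1.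
  have mon : 'X^(k.+1.-1 - i) * ('X - 1 : {poly F}) ^+ i \is monic.
    by rewrite rpredM ?rpredX ?monicX ?monicXsubC.
  have s : size ('X^(k.+1.-1 - i) * ('X - 1 : {poly F}) ^+ i) = k.+1.
    rewrite size_mul ?monic_neq0 ?rpredX ?monicX ?monicXsubC //.
    rewrite size_polyXn size_exp_XsubC /=.
    by have := ltn_ord i; lia.
  by split=> //; move/monicP: mon; rewrite lead_coefE s.
split.
  by apply: (leq_trans (size_sum _ _ _)); apply/bigmax_leqP => i _; rewrite (E i).1.
by rewrite coef_sum (eq_bigr (fun=> 1)) ?sumr_const ?card_ord // => i _; case: (E i).
Qed.

(** Differencing lowers the degree by one and multiplies the leading coefficient by
the degree; this is where the factorial in the value at 1 comes from. *)
Lemma pdiff_size A d : (size A <= d.+2)%N ->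
  (size (pdiff A) <= d.+1)%N /\ (pdiff A)`_d = d.+1%:R * A`_d.+1.
Proof.
move=> sA.
have pZ (c : F) (B : {poly F}) : pdiff (c *: B) = c *: pdiff B.
  by rewrite /pdiff linearZ scalerBr.
have pD (B C : {poly F}) : pdiff (B + C) = pdiff B + pdiff C.
  by rewrite /pdiff raddfD /=; ring.
have -> : A = \sum_(i < d.+2) A`_i *: 'X^i.
  rewrite -poly_def; apply/polyP => i; rewrite coef_poly; case: ltnP => // le.
  by rewrite nth_default // (leq_trans sA).
have -> : pdiff (\sum_(i < d.+2) A`_i *: 'X^i) = \sum_(i < d.+2) A`_i *: pdiff ('X^i).
  have := @big_morph _ _ pdiff 0 +%R 0 +%R pD => -> //; last by rewrite /pdiff comp_poly0 subr0.
  by apply: eq_bigr => i _; rewrite pZ.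
have sz i : (size (pdiff ('X^i : {poly F})) <= i)%N.
  case: i => [|i]; first by rewrite /pdiff expr0 comp_polyC subrr size_poly0.
  by case: (pdiff_Xn i).
split.
  apply: (leq_trans (size_sum _ _ _)); apply/bigmax_leqP => i _.
  apply: leq_trans (size_scale_leq _ _) _; apply: leq_trans (sz i) _.
  by rewrite -ltnS.
rewrite -poly_def coef_poly ltnSn coef_sum big_ord_recr /= big1 => [|i _].
  by rewrite add0r coefZ; case: (pdiff_Xn d) => _ ->; rewrite mulrC.
rewrite coefZ [X in _ * X]nth_default ?mulr0 //.
by apply: leq_trans (sz _) _; rewrite -ltnS.
Qed.

(** The series of a polynomial of degree d has denominator (1 - X)^(d+1). By
induction on d: one factor 1 - X replaces A by its difference, up to the term
t = 0, where the series lacks A(-1); that correction is a multiple of a power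
of 1 - X and does not contribute at X = 1. *)
Lemma series_poly d A : (size A <= d.+1)%N -> exists N : {poly F},
  [/\ (size N <= d.+1)%N, N.[1] = d`!%:R * A`_d &
      forall i, convol ((1 - 'X) ^+ d.+1) (fun t => A.[t%:R]) i = N`_i].
Proof.
elim: d A => [|d IH] A sA.
  exists A; rewrite (size1_polyC sA) fact0 mul1r !hornerC coefC; split=> [||i] //.
    exact: size_polyC_leq1.
  rewrite expr1 convol_1subX !coefC; case: i => [|i]; rewrite ?hornerC ?subr0 //.
  by rewrite subrr.
have [sD cD] := pdiff_size sA.
have [N [sN vN HN]] := IH _ sD.
have s1X k : (size ((1 - 'X : {poly F}) ^+ k) <= k.+1)%N.
  have -> : 1 - 'X = - ('X - 1) :> {poly F} by ring.
  rewrite exprNn -signr_odd; case: odd;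
  by rewrite ?expr1 ?expr0 ?mulN1r ?mul1r ?size_polyN size_exp_XsubC.
pose a := A.[-1]; exists (N + a%:P * (1 - 'X) ^+ d.+1); split.
- apply: leq_trans (size_polyD _ _) _; rewrite geq_max (leq_trans sN) //=.
  by rewrite mul_polyC (leq_trans (size_scale_leq _ _)).
- rewrite hornerD hornerM horner_exp !hornerE subrr expr0n /= mulr0 addr0 vN cD.
  by rewrite factS natrM; ring.
move=> i; rewrite exprSr convolM.
have E : convol (1 - 'X) (fun t => A.[t%:R]) =1
   fun t => (pdiff A).[t%:R] + a *+ (t == 0%N).
  case=> [|t]; rewrite convol_1subX.
    by rewrite /pdiff hornerD hornerN horner_comp !hornerE mulr1n /a ?sub0r subrK ?subr0.
  by rewrite pdiffE mulr0n addr0.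
rewrite (eq_convol _ E) convolD HN convol_delta coefD; congr (_ + _).
by rewrite mul_polyC coefZ mulrC.
Qed.

(** The alternating part has its poles at X = -1, so it needs the extra factor
(1 + X)^(d+1); what is left has (1 - X)^(d+1) as a factor and vanishes at X = 1. *)
Lemma series_altpoly d A B (D : {poly F}) :
  (size A <= d.+1)%N -> (size B <= d.+1)%N ->
  exists2 P : {poly F},
    forall i, P`_i = convol ((1 + 'X) ^+ d.+1) (convol ((1 - 'X) ^+ d.+1 * D) (altpoly A B)) i &
    P.[1] = 2%:R ^+ d.+1 * (D.[1] * (d`!%:R * A`_d)).
Proof.
move=> sA sB; have [N [_ vN HN]] := series_poly sA.
have [N' [_ _ HN']] := series_poly sB.
pose N'' := \poly_(i < size N') ((-1) ^+ i * N'`_i).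
have N''E i : N''`_i = (-1) ^+ i * N'`_i.
  by rewrite coef_poly; case: ltnP => // le; rewrite nth_default ?mulr0.
exists (D * ((1 + 'X) ^+ d.+1 * N + (1 - 'X) ^+ d.+1 * N'')); last first.
  rewrite !(hornerD, hornerM, horner_exp, hornerN, hornerX, hornerC) subrr expr0n /=.
  by rewrite mul0r addr0 vN; ring.
have cP (p q : {poly F}) (i : nat) : (p * q)`_i = convol p (fun k => q`_k) i.
  by rewrite coefM.
move=> i; rewrite -convolM.
set X1 := (1 + 'X) ^+ _; set X2 := (1 - 'X) ^+ _.
have -> : X1 * (X2 * D) = D * (X1 * X2) by ring.
rewrite convolM cP; apply: eq_convol => {}i; rewrite coefD !cP /altpoly.
rewrite convolD; congr (_ + _).
  by rewrite convolM; apply: eq_convol => {}i.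
rewrite mulrC convolM; apply: eq_convol => {}i.
by rewrite convol_alt HN'.
Qed.

Lemma poly_eq0_large A (c N : nat) :
  (forall i, (N <= i)%N -> A.[(i.*2 + c)%:R] = 0) -> A = 0.
Proof.
move=> A0; apply: (@roots_geq_poly_eq0 _ A [seq (i.*2 + c)%:R | i <- iota N (size A)]).
- by apply/allP => x /mapP[i]; rewrite mem_iota => /andP[Ni _] ->; rewrite /root A0.
- rewrite map_inj_uniq ?iota_uniq // => i j /eqP; rewrite eqr_nat; lia.
- by rewrite size_map size_iota.
Qed.

Lemma altpoly_eq0 A B (N : nat) :
  (forall i, (N <= i)%N -> altpoly A B i = 0) -> A = 0 /\ B = 0.
Proof.
move=> H.
have E0 : A + B = 0.
  apply: (@poly_eq0_large _ 0 N) => i Ni; have := H (i.*2 + 0)%N.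
  rewrite /altpoly addn0 -signr_odd odd_double expr0 mul1r hornerD => -> //; lia.
have E1 : A - B = 0.
  apply: (@poly_eq0_large _ 1 N) => i Ni; have := H (i.*2 + 1)%N.
  rewrite /altpoly -signr_odd addn1 /= odd_double expr1 mulN1r hornerD hornerN => -> //; lia.
have A0 : A = 0.
  apply/eqP; have: A *+ 2 = 0 by rewrite mulr2n -[RHS](addr0 0) -{1}E0 -{1}E1; ring.
  by move/eqP; rewrite -scaler_nat scaler_eq0 pnatr_eq0.
by split=> //; move: E0; rewrite A0 add0r.
Qed.

(** The leading coefficient of psum A is twice that of A. *)
Lemma psum_eq0 A : psum A = 0 -> A = 0.
Proof.
move=> H; apply/eqP; apply: contraT => A0.
suff : lead_coef A *+ 2 = 0.
  by move/eqP; rewrite mulrn_eq0 /= lead_coef_eq0 (negPf A0).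
have sc : size (A \Po ('X - 1)) = size A.
  by rewrite size_comp_poly2 // size_XsubC.
rewrite mulr2n -{2}[lead_coef A]mulr1 -(expr1n _ (size A).-1) -(lead_coefXsubC (1 : F)).
rewrite -lead_coef_comp ?size_XsubC // !lead_coefE sc -coefD.
by rewrite -/(psum A) H coef0.
Qed.

(** A series whose only pole is at X = 1 has no alternating part: each factor 1 - X
acts on B by psum, which is injective. *)
Lemma convol_altpoly_eq0 k u A B N : (forall i, (N <= i)%N -> u i = altpoly A B i) ->
  (forall i, (N <= i)%N -> convol ((1 - 'X) ^+ k) u i = 0) -> B = 0.
Proof.
elim: k u A B N => [|k IH] u A B N uE H.
  apply: (proj2 (@altpoly_eq0 A B N _)) => i Ni.
  by rewrite -uE // -(H i Ni) expr0 convol1.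
apply: psum_eq0.
apply: (IH (convol (1 - 'X) u) (pdiff A) (psum B) N.+1) => [[//|i] Ni|i Ni].
  rewrite convol_1subX !uE // 1?ltnW //.
  rewrite /altpoly pdiffE psumE exprS; ring.
by rewrite -convolM -exprSr H // ltnW.
Qed.

(** A simple pole at X = -1 only leaves room for a constant alternating part: the
factor 1 + X differences B, and what remains has no pole at X = -1. *)
Lemma alternating_part_const k A B N :
  (forall i, (N <= i)%N -> convol ((1 - 'X) ^+ k * (1 + 'X)) (altpoly A B) i = 0) ->
  forall i, B.[i.+1%:R] = B.[i%:R].
Proof.
move=> H i; suff D0 : pdiff B = 0.
  by apply/eqP; rewrite -subr_eq0 -pdiffE D0 horner0.
apply: (@convol_altpoly_eq0 k (convol (1 + 'X) (altpoly A B)) (psum A) (pdiff B) N.+1).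
  case=> // j _; rewrite convol_1addX /altpoly pdiffE psumE exprS; ring.
by move=> j Nj; rewrite -convolM H // ltnW.
Qed.

End Convolution.

(** * Lattice points of zonotopes *)

Section HasCard.
Local Open Scope classical_set_scope.
Variables T T' : eqType.
Implicit Types A B : set T.

Definition has_card (T : eqType) (A : set T) (N : nat) :=
  exists s : seq T, [/\ uniq s, size s = N & forall x, A x <-> x \in s].

Lemma has_card_le A B N M : A `<=` B -> has_card A N -> has_card B M -> (N <= M)%N.
Proof.
move=> AB [s [us <- sA]] [s' [us' <- sB]].
by apply: uniq_leq_size => // x /sA/AB/sB.
Qed.

Lemma has_card_inj A N M : has_card A N -> has_card A M -> N = M.
Proof.
by move=> hN hM; apply/eqP; rewrite eqn_leq !(@has_card_le A A).
Qed.

Lemma has_card_bij A (B : set T') N (f : T -> T') (g : T' -> T) :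
  cancel f g -> cancel g f -> (forall x, A x <-> B (f x)) ->
  has_card A N -> has_card B N.
Proof.
move=> fK gK AB [s [us <- sA]]; exists (map f s); split.
- by rewrite map_inj_uniq //; apply: can_inj fK.
- by rewrite size_map.
move=> y; rewrite -(gK y) mem_map; last exact: can_inj fK.
by rewrite -sA AB.
Qed.

Lemma eq_has_card A B N : (forall x, A x <-> B x) -> has_card A N -> has_card B N.
Proof. by move=> AB [s [us <- sA]]; exists s; split=> // x; rewrite -AB. Qed.

Lemma has_card_fset (K : choiceType) (A : set K) N :
  has_card A N -> #|` fset_set A| = N.
Proof.
case=> s [us <- sA]; have -> : A = [set` s].
  by apply/seteqP; split=> x /=; rewrite sA.
have -> : fset_set [set` s] = [fset x in s]%fset.
  apply/fsetP => x; rewrite in_fset_set; last exact: finite_seq.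
  by rewrite mem_setE inE.
by rewrite card_fseq undup_id.
Qed.

Lemma has_card0 A : (forall x, ~ A x) -> has_card A 0.
Proof. by move=> A0; exists [::]; split=> // x; split=> // /A0. Qed.

Lemma has_card1 A a : (forall x, A x <-> x = a) -> has_card A 1.
Proof.
by move=> Aa; exists [:: a]; split=> // x; rewrite Aa inE; split=> [->|/eqP].
Qed.

End HasCard.

Section Zonotope.
Local Open Scope classical_set_scope.
Variable R : realType.

Local Notation "A %:RM" := (map_mx (intr : int -> R) A) (at level 2, format "A %:RM").

Definition zono k d (x : 'rV[R]_d) (A : 'M[int]_(k, d)) : set 'rV[R]_d :=
  [set y | exists2 l : 'rV[R]_k, (forall i, 0 <= l 0 i <= 1) & y = x + l *m A%:RM].

Definition zpoints k d (x : 'rV[R]_d) (A : 'M[int]_(k, d)) : set 'rV[int]_d :=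
  lattice_points (zono x A).

Definition is_integral d (x : 'rV[R]_d) := exists z : 'rV[int]_d, x = z%:RM.

Lemma zono_col k d x (v : 'rV[int]_d) (A : 'M[int]_(k, d)) y :
  zono x (col_mx v A) y <-> exists2 s, 0 <= s <= 1 & zono x A (y - s *: v%:RM).
Proof.
split.
  case=> l l01 ->; rewrite map_col_mx -[l in l *m _]hsubmxK mul_row_col.
  exists (l 0 (lshift k 0)); first exact: l01.
  exists (rsubmx l) => [i|]; first by rewrite mxE.
  rewrite [lsubmx l]mx11_scalar mul_scalar_mx mxE addrA addrAC.
  by rewrite -[_ + _ - _]addrA [l 0 _ *: _ + _]addrC !addrA subrK.
case=> s s01 [l l01 yE]; exists (row_mx s%:M l) => [i|].
  by rewrite mxE; case: splitP => j _; rewrite ?ord1 ?mxE ?eqxx ?mulr1n.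
by rewrite map_col_mx mul_row_col mul_scalar_mx addrCA -yE addrC subrK.
Qed.

Lemma zono_mul k d e x (A : 'M[int]_(k, d)) (U : 'M[int]_(d, e)) y :
  zono x A y -> zono (x *m U%:RM) (A *m U) (y *m U%:RM).
Proof.
by case=> l l01 ->; exists l => //; rewrite mulmxDl map_mxM mulmxA.
Qed.

Lemma zono_shift k d x (A : 'M[int]_(k, d)) y a :
  zono x A y -> zono (x + a) A (y + a).
Proof. by case=> l l01 ->; exists l => //; rewrite addrAC. Qed.

Lemma zono_convex k d x (A : 'M[int]_(k, d)) y z s : 0 <= s <= 1 ->
  zono x A y -> zono x A z -> zono x A (s *: y + (1 - s) *: z).
Proof.
move=> /andP[s0 s1] [l l01 ->] [m m01 ->]; exists (s *: l + (1 - s) *: m).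
  move=> i; rewrite !mxE; have /andP[? ?] := l01 i; have /andP[? ?] := m01 i.
  have ? : 0 <= 1 - s by lra.
  by apply/andP; split; nra.
rewrite mulmxDl -!scalemxAl !scalerDr addrACA -scalerDl.
by rewrite [s + _]addrC subrK scale1r.
Qed.

Lemma zono_row_perm k d x (A : 'M[int]_(k, d)) (s : 'S_k) y :
  zono x (row_perm s A) y <-> zono x A y.
Proof.
split=> -[l l01 ->].
  exists (l *m perm_mx s); first by move=> i; rewrite -[s]invgK -col_permE mxE.
  by rewrite row_permE map_mxM map_perm_mx mulmxA.
exists (l *m perm_mx s^-1); first by move=> i; rewrite -col_permE mxE.
rewrite row_permE map_mxM map_perm_mx mulmxA -(mulmxA l) -perm_mxM mulVg perm_mx1.
by rewrite mulmx1.
Qed.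

Lemma intr_rV_inj d : injective (fun z : 'rV[int]_d => z%:RM).
Proof.
move=> z z' /rowP zz'; apply/rowP => i; have := zz' i; rewrite !mxE.
exact: intr_inj.
Qed.

(** Unimodular maps preserve the lattice, so a generator can be brought into the
direction of the first axis without changing the count. *)
Lemma zpoints_unimodular k d x (A : 'M[int]_(k, d)) (U : 'M[int]_d) N : U \in unitmx ->
  has_card (zpoints x A) N -> has_card (zpoints (x *m U%:RM) (A *m U)) N.
Proof.
move=> uU; have uUR : U%:RM *m (invmx U)%:RM = 1%:M.
  by rewrite -map_mxM mulmxV // map_scalar_mx.
apply: (@has_card_bij _ _ _ _ _ (mulmx^~ U) (mulmx^~ (invmx U))).
- exact: mulmxK.
- exact: mulmxKV.
move=> z; rewrite /zpoints /lattice_points /= map_mxM; split; first exact: zono_mul.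
move=> /(@zono_mul _ _ _ _ _ (invmx U)); rewrite -!mulmxA uUR !mulmx1.
by rewrite mulmxV // mulmx1.
Qed.

Lemma zpoints_unimodularV k d x (A : 'M[int]_(k, d)) (U : 'M[int]_d) N : U \in unitmx ->
  has_card (zpoints (x *m U%:RM) (A *m U)) N -> has_card (zpoints x A) N.
Proof.
move=> uU /(@zpoints_unimodular _ _ _ _ (invmx U)); rewrite unitmx_inv => /(_ uU).
rewrite -!mulmxA mulmxV // mulmx1 -map_mxM mulmxV // map_scalar_mx /=.
by rewrite mulmx1.
Qed.

Lemma zpoints_shift k d x (A : 'M[int]_(k, d)) (z : 'rV_d) N :
  has_card (zpoints x A) N -> has_card (zpoints (x + z%:RM) A) N.
Proof.
apply: (@has_card_bij _ _ _ _ _ (fun y => y + z) (fun y => y - z)).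
- exact: addrK.
- exact: subrK.
move=> y; rewrite /zpoints /lattice_points /= map_mxD; split; first exact: zono_shift.
by move=> /(@zono_shift _ _ _ _ _ (- z%:RM)); rewrite !addrK.
Qed.

Lemma zono_bound k d x (A : 'M[int]_(k, d)) (i : 'I_d) :
  exists b : R, forall y, zono x A y -> y 0 i <= b.
Proof.
exists (x 0 i + \sum_j `|A%:RM j i|) => y [l l01 ->].
rewrite !mxE lerD2l; apply: ler_sum => j _; have /andP[l0 l1] := l01 j.
apply: le_trans (ler_norm _) _; rewrite normrM ger0_norm //.
by rewrite ler_piMl.
Qed.

Lemma int_threshold (P : int -> Prop) a b :
  (forall k l, k <= l -> P k -> P l) -> ~ P a -> P b ->
  exists k0, forall k, P k <-> k0 <= k.
Proof.
move=> Pmono Pa Pb; have ltab : a < b.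
  by rewrite ltNge; apply/negP => /Pmono/(_ Pb).
have exn : exists n : nat, `[< P (a + n%:Z) >].
  exists `|b - a|%N; apply/asboolP; suff -> : a + `|b - a|%N%:Z = b by []; lia.
have [n /asboolP Pn nmin] := ex_minnP exn.
exists (a + n%:Z) => k; split=> [Pk|]; last by move=> /Pmono; apply.
rewrite leNgt; apply/negP => ltk.
have lek : a <= k by rewrite leNgt; apply/negP => /ltW/Pmono/(_ Pk).
have := nmin `|k - a|%N.
have -> : a + `|k - a|%N%:Z = k by lia.
by move=> /(_ (asboolT Pk)); lia.
Qed.

(** On each line parallel to the first axis the zonotope of A cuts out an interval,
possibly without integers. Adding the segment [0, c] along that axis extends
the interval by c on the right, which brings in exactly c new integers. The
lines in question are those over the lattice points of the projection. *)
Lemma zpoints_deletion_contraction k d x (A : 'M[int]_(k, 1 + d)) (c N1 N2 : nat) :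
  has_card (zpoints x A) N1 -> has_card (zpoints (rsubmx x) (rsubmx A)) N2 ->
  has_card (zpoints x (col_mx (row_mx c%:Z%:M 0) A)) (N1 + c * N2).
Proof.
move=> [s1 [us1 <- H1]] [s2 [us2 <- H2]].
pose I (q : 'rV[R]_d) (y : R) := zono x A (row_mx y%:M q).
(* right q k: the point of height k lies beyond the fibre over q. As this is a
   property of integers that holds from some threshold k0 on, the end points of
   the fibre are never needed. *)
pose right q (k : int) := forall y, I q%:RM y -> y < k%:~R.
have Iconv q y z w : I q y -> I q z -> y <= w <= z -> I q w.
  move=> Iy Iz /andP[yw wz]; have [->//|nyz] := eqVneq w z.
  have yz : 0 < z - y by rewrite subr_gt0 lt_neqAle (le_trans yw) // andbT;
    apply: contraNneq nyz => yz; apply/eqP/le_anti; rewrite wz -yz yw.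
  pose s := (z - w) / (z - y).
  have s01 : 0 <= s <= 1.
    rewrite /s divr_ge0 ?subr_ge0 ?(ltW yz) //= ?ler_pdivrMr ?mul1r ?lerD2l ?lerN2 //.
    by rewrite -subr_ge0 ltW.
  have := zono_convex s01 Iy Iz; rewrite !scale_row_mx add_row_mx !scale_scalar_mx.
  rewrite -raddfD -scalerDl subrKC scale1r /I; suff -> : s * y + (1 - s) * z = w by [].
  by rewrite /s; field; rewrite gt_eqF.
have ex (q : 'rV[int]_d) : exists k0 : int, q \in s2 -> forall k, right q k <-> k0 <= k.
  have [qs2|_] := boolP (q \in s2); last by exists 0.
  have [y0 Iy0] : exists y, I q%:RM y.
    move/H2: qs2 => [l l01 ql]; exists ((x + l *m A%:RM) 0 (lshift _ 0)).
    exists l => //; rewrite ql -[RHS]hsubmxK; congr row_mx.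
      by rewrite [RHS]mx11_scalar !mxE.
    by rewrite linearD /= map_rsubmx mulmx_rsub.
  have [b yb] := zono_bound x A (lshift d 0).
  case: (@int_threshold (right q) (Num.floor y0) (Num.floor b + 1)) => [|||k0].
  - by move=> k' l kl rk y /rk /lt_le_trans; apply; rewrite ler_int.
  - by move/(_ _ Iy0); rewrite ltNge floor_le.
  - move=> y /yb; rewrite row_mxEl mxE eqxx mulr1n => /le_lt_trans; apply.
    exact: floorD1_gt.
  by move=> Hk0; exists k0.
have [k0 Hk0] := choice ex.
pose f q (i : nat) : 'rV[int]_(1 + d) := row_mx (k0 q + i%:Z)%:M q.
have finj q q' i i' : f q i = f q' i' -> (q, i) = (q', i').
  move=> /eq_row_mx[/matrixP/(_ 0 0)]; rewrite !mxE !eqxx !mulr1n => ki qq'.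
  by move: ki; rewrite qq' => /addrI [->].
have main (q : 'rV[int]_d) (k' : int) :
  zpoints x (col_mx (row_mx c%:Z%:M 0) A) (row_mx k'%:M q) <->
    I q%:RM k'%:~R \/ (right q k' /\ ~ right q (k' - c%:Z)).
  have castE (s : R) : (row_mx k'%:M q)%:RM - s *: (row_mx c%:Z%:M 0)%:RM
     = row_mx (k'%:~R - s * c%:R)%:M q%:RM.
    rewrite !map_row_mx !map_scalar_mx /= scale_row_mx opp_row_mx add_row_mx.
    by rewrite map_mx0 scaler0 oppr0 addr0 scale_scalar_mx -raddfB.
  rewrite /zpoints /lattice_points /= zono_col; split.
    case=> s s01; rewrite castE => Is.
    have [?|nI] := pselect (I q%:RM k'%:~R); [by left|right].
    have sc : (k'%:~R : R) - c%:R <= k'%:~R - s * c%:R <= k'%:~R.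
      have c0 : (0 : R) <= c%:R by []. move/andP: s01 => [? ?].
      by apply/andP; split; nra.
    split=> [y Iy|/(_ _ Is)]; last first.
      by case/andP: sc => sc _; rewrite rmorphB /= => /(le_lt_trans sc); rewrite ltxx.
    rewrite ltNge; apply/negP => ky; apply: nI; apply: Iconv Is Iy _.
    by rewrite ky; case/andP: sc => _ ->.
  case=> [Ik|[rk]].
    by exists 0; rewrite ?lexx ?ler01 // castE mul0r subr0.
  move/existsNP => [y /not_implyP[Iy /negP]]; rewrite -leNgt rmorphB /= => cy.
  have yk := rk _ Iy; have c0 : (0 : R) < c%:R by lra.
  exists ((k'%:~R - y) / c%:R).
    rewrite divr_ge0 ?subr_ge0 ?(ltW yk) ?(ltW c0) //=.
    by rewrite ler_pdivrMr // mul1r; move: cy; rewrite pmulrn; lra.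
  by rewrite castE divfK ?gt_eqF // subKr.
(* The new points over q are those of heights k0 q, ..., k0 q + c - 1. *)
exists (s1 ++ [seq f q i | q <- s2, i <- iota 0 c]); split.
- rewrite cat_uniq us1 /=; apply/andP; split; last first.
    apply: allpairs_uniq => //; first exact: iota_uniq.
    by move=> [q i] [q' i'] _ _ /= /finj.
  apply/hasPn => _ /allpairsP[[q i] /= [qs2 _ ->]]; apply/negP => /H1.
  rewrite /zpoints /lattice_points /f /= map_row_mx map_scalar_mx => Iq.
  have : right q (k0 q + i%:Z) by apply/(Hk0 q qs2); rewrite lerDl.
  by move/(_ _ Iq); rewrite ltxx.
- by rewrite size_cat size_allpairs size_iota mulnC.
move=> z; have {1}-> : z = row_mx (z 0 (lshift d 0))%:M (rsubmx z).
  by rewrite -[LHS]hsubmxK [lsubmx z]mx11_scalar mxE.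
set k' := z 0 _; set q := rsubmx z; rewrite main mem_cat.
have zE : z = row_mx k'%:M q by rewrite -[LHS]hsubmxK [lsubmx z]mx11_scalar mxE.
have I1 : I q%:RM k'%:~R <-> z \in s1.
  by rewrite -H1 zE /zpoints /lattice_points /= map_row_mx map_scalar_mx.
have I2 : (exists y, I q%:RM y) -> q \in s2.
  move=> [y [l l01 ql]]; apply/H2; exists l => //.
  have := congr1 rsubmx ql; rewrite row_mxKr => ->.
  by rewrite linearD /= map_rsubmx mulmx_rsub.
split.
- case=> [/I1 -> //|[rk /existsNP[y /not_implyP[Iy /negP ky]]]].
  have qs2 : q \in s2 by apply: I2; exists y.
  apply/orP; right; apply/allpairsP; exists (q, `|k' - k0 q|%N) => /=.
  have lek : k0 q <= k' by apply/(Hk0 q qs2).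
  have ltk : k' < k0 q + c%:Z.
    rewrite ltNge; apply/negP; rewrite -lerBrDr => /(Hk0 q qs2)/(_ _ Iy).
    by rewrite (negPf ky).
  split=> //; first by rewrite mem_iota; lia.
  rewrite [LHS]zE /f; congr (row_mx _%:M _); lia.
- case/orP => [/I1|/allpairsP[[q' i] /= [qs2 ii zE']]]; first by left.
  right; move: zE' ; rewrite [LHS]zE => /eq_row_mx[/matrixP/(_ 0 0)].
  rewrite !mxE !eqxx !mulr1n => kk qq; rewrite -qq in qs2 kk.
  move: ii; rewrite mem_iota => ii.
  split; first by apply/(Hk0 q qs2); lia.
  by move=> /(Hk0 q qs2); lia.
Qed.

End Zonotope.

Section Growth.
Local Open Scope classical_set_scope.
Variable R : realType.

Local Notation "A %:RM" := (map_mx (intr : int -> R) A) (at level 2, format "A %:RM").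

(** The Smith normal form of a single row. *)
Lemma unimodular_straighten d (v : 'rV[int]_(1 + d)) :
  exists U (c : nat), U \in unitmx /\ v *m U = row_mx c%:Z%:M 0.
Proof.
have [L uL [G uG [D _ vE]]] := int_Smith_normal_form v.
have [c vG] : exists c : int, v *m invmx G = row_mx c%:M 0.
  exists (L 0 0 * D`_0); rewrite vE mulmxK // [L]mx11_scalar mul_scalar_mx.
  apply/rowP => j; rewrite !mxE.
  by case: splitP => l lE; rewrite !mxE lE ?ord1 //= mulr0.
have [c0|c0] := leP 0 c.
  by exists (invmx G), `|c|%N; rewrite unitmx_inv uG vG gez0_abs.
exists (- invmx G), `|c|%N; split.
  by rewrite -scaleN1r unitmxZ ?unitmx_inv // rpredN.
by rewrite mulmxN vG opp_row_mx oppr0 -scalemx1 -scaleNr scalemx1 ltz0_abs.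
Qed.

Lemma zpoints_add_row k d (x : 'rV[R]_(1 + d)) v (A : 'M[int]_(k, 1 + d)) U c t N1 N2 :
  U \in unitmx -> v *m U = row_mx c%:Z%:M 0 ->
  has_card (zpoints x A) N1 ->
  has_card (zpoints (rsubmx (x *m U%:RM)) (rsubmx (A *m U))) N2 ->
  has_card (zpoints x (col_mx (t%:Z *: v) A)) (N1 + t * c * N2)%N.
Proof.
move=> uU vU h1 h2; apply: (zpoints_unimodularV uU).
rewrite mul_col_mx -scalemxAl vU scale_row_mx scaler0 scale_scalar_mx.
by rewrite -PoszM; apply: zpoints_deletion_contraction => //; apply: zpoints_unimodular.
Qed.

Lemma zpoints_dim0 k (x : 'rV[R]_0) (A : 'M[int]_(k, 0)) : has_card (zpoints x A) 1.
Proof.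
apply: (@has_card1 _ _ 0) => z; split=> _; first by rewrite [z]thinmx0.
exists 0 => [i|]; first by rewrite mxE lexx ler01.
by rewrite [LHS]thinmx0 [RHS]thinmx0.
Qed.

Lemma zpoints_no_row d (x : 'rV[R]_d) (A : 'M[int]_(0, d)) z : zpoints x A z <-> x = z%:RM.
Proof.
split; first by case=> l _ ->; rewrite [l]thinmx0 mul0mx addr0.
by move=> ->; exists 0 => [[]//|]; rewrite mul0mx addr0.
Qed.

Lemma card_zpoints_no_row d (x : 'rV[R]_d) (A : 'M[int]_(0, d)) :
  has_card (zpoints x A) `[< is_integral x >].
Proof.
case: asboolP => [[z xz]|nx].
  by apply: (@has_card1 _ _ z) => y; rewrite zpoints_no_row xz; split=> [/intr_rV_inj|->].
by apply: has_card0 => z /zpoints_no_row xz; apply: nx; exists z.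
Qed.

(** The number of lattice points of x + Z_t, for the zonotope Z_t generated by the
rows of M t, is a polynomial in t with coefficient L in degree d, for every real
translation x. The bound C on the coefficients is uniform in x because the
volume estimates apply this to translations that move with t. *)
Definition poly_growth k d (M : nat -> 'M[int]_(k, d)) (L : nat) :=
  exists C : nat, forall x : 'rV[R]_d, exists a : nat -> nat,
    [/\ a d = L, forall j, (a j <= C)%N &
        forall t, has_card (zpoints x (M t)) (\sum_(j < d.+1) a j * t ^ j)%N].

Lemma eq_poly_growth k d (M M' : nat -> 'M[int]_(k, d)) L :
  (forall t, M t = M' t) -> poly_growth M L -> poly_growth M' L.
Proof.
move=> MM' [C HC]; exists C => x; case: (HC x) => a [aL aC H].
by exists a; split=> // t; rewrite -MM'.
Qed.

Lemma poly_growth_dim0 k (M : nat -> 'M[int]_(k, 0)) : poly_growth M 1.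
Proof.
exists 1%N => x; exists (fun=> 1%N); split=> // t.
by rewrite big_ord1 expn0 muln1; apply: zpoints_dim0.
Qed.

Lemma poly_growth_no_row d (M : nat -> 'M[int]_(0, d)) : exists L, poly_growth M L.
Proof.
case: d M => [|d] M; first by exists 1%N; apply: poly_growth_dim0.
exists 0%N, 1%N => x; exists (fun j => if j == 0%N then `[< is_integral x >] : nat else 0%N).
split=> // [j|t]; first by case: j => //=; case: asboolP.
rewrite big_ord_recl /= expn0 muln1 big1 ?addn0 //.
exact: card_zpoints_no_row.
Qed.

(** Deletion and contraction for the whole family. For b = true the new generator v
is dilated with the others and the contraction contributes t * c * a'(t), which
reaches the top degree; for b = false it is fixed and only lower terms
appear. *)
Lemma poly_growth_add_row b k d (M : nat -> 'M[int]_(k, 1 + d)) v U c L L' :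
  U \in unitmx -> v *m U = row_mx c%:Z%:M 0 ->
  poly_growth M L -> poly_growth (fun t => rsubmx (M t *m U)) L' ->
  poly_growth (fun t => col_mx ((if b then t else 1%N)%:Z *: v) (M t))
         (L + if b then c * L' else 0).
Proof.
move=> uU vU [C HC] [C' HC']; exists (C + c * C')%N => x.
have [a [aL aC Ha]] := HC x; have [a' [aL' aC' Ha']] := HC' (rsubmx (x *m U%:RM)).
exists (fun j => (a j + c * (if b then (if j is j'.+1 then a' j' else 0)
                       else if (j <= d)%N then a' j else 0))%N).
split=> [|j|t].
- rewrite aL; congr (_ + _)%N; case: b => /=; first by rewrite aL'.
  by rewrite add1n ltnn muln0.
- apply: leq_add => //; rewrite leq_mul2l; apply/orP; right.
  by case: b; [case: j | case: ifP].
have := zpoints_add_row (if b then t else 1%N) uU vU (Ha t) (Ha' t).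
congr (has_card _ _); rewrite [RHS](eq_bigr (fun j : 'I_(1 + d).+1 => (a j * t ^ j +
   c * ((if b then (if (j : nat) is j'.+1 then a' j' else 0)
                       else if (j <= d)%N then a' j else 0) * t ^ j)))%N); last first.
  by move=> i _; rewrite mulnDl mulnA.
rewrite big_split -big_distrr /=; congr (_ + _)%N; case: b.
  rewrite -mulnA mulnCA; congr (_ * _)%N.
  rewrite [RHS]big_ord_recl /= mul0n add0n big_distrr /=.
  by apply: eq_bigr => i _; rewrite expnS mulnCA.
rewrite mul1n; congr (_ * _)%N; rewrite [RHS]big_ord_recr /= ltnn mul0n addn0.
by apply: eq_bigr => i _; rewrite -ltnS ltn_ord.
Qed.

Lemma poly_growth_exists k d (A : 'M[int]_(k, d)) : exists L, poly_growth (fun t => t%:Z *: A) L.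
Proof.
elim: k d A => [|k IH] d A; first exact: poly_growth_no_row.
case: d A => [|d] A; first by exists 1%N; apply: poly_growth_dim0.
move: A; rewrite -[k.+1]/(1 + k)%N -[d.+1]/(1 + d)%N => A.
have [U [c [uU vU]]] := unimodular_straighten (usubmx A).
have [L HL] := IH _ (dsubmx A); have [L' HL'] := IH _ (rsubmx (dsubmx A *m U)).
exists (L + c * L')%N; have := @poly_growth_add_row true _ _ _ _ _ _ _ L' uU vU HL.
have HL'' : poly_growth (fun t : nat => rsubmx ((t%:Z *: dsubmx A) *m U)) L'.
  by apply: eq_poly_growth HL' => t; rewrite -scalemxAl linearZ.
move=> /(_ HL''); apply: eq_poly_growth => t.
by rewrite -scale_col_mx vsubmxK.
Qed.

(** Each fixed generator contributes a multiple of the count of a projection, which has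
lower degree. *)
Lemma poly_growth_undilated_rows e k d (E : 'M[int]_(e, d)) (A : 'M[int]_(k, d)) L :
  poly_growth (fun t => t%:Z *: A) L -> poly_growth (fun t => col_mx E (t%:Z *: A)) L.
Proof.
elim: e k d E A L => [|e IH] k d E A L HL.
  apply: eq_poly_growth HL => t; rewrite [E]flatmx0; apply/row_matrixP => i.
  apply/rowP => j; rewrite !mxE; case: splitP => [[]//|l il].
  by rewrite !mxE; congr (_ * A _ _); apply: val_inj.
case: d E A HL => [|d] E A HL.
  have -> : L = 1%N.
    case: HL => C /(_ 0) [a [aL _ /(_ 0%N)]]; rewrite big_ord1 expn0 muln1 aL.
    by move/has_card_inj; apply; apply: zpoints_dim0.
  exact: poly_growth_dim0.
move: E A HL; rewrite -[e.+1]/(1 + e)%N -[d.+1]/(1 + d)%N => E A HL.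
have [U [c [uU vU]]] := unimodular_straighten (usubmx E).
have [L' HL'] := poly_growth_exists (rsubmx (A *m U)).
have := @poly_growth_add_row false _ _ _ _ _ _ _ L' uU vU (IH _ _ (dsubmx E) _ _ HL).
have HL'' : poly_growth (fun t : nat => rsubmx (col_mx (dsubmx E) (t%:Z *: A) *m U)) L'.
  apply: eq_poly_growth (IH _ _ (rsubmx (dsubmx E *m U)) _ _ HL') => t.
  apply/matrixP => i j; rewrite mul_col_mx -scalemxAl !mxE; case: splitP => l _;
  by rewrite !mxE.
move=> /(_ HL''); rewrite addn0; apply: eq_poly_growth => t.
rewrite scale1r col_mxA -[in RHS](vsubmxK E); exact: castmx_id.
Qed.

Lemma zpoints_finite k d (x : 'rV[R]_d) (A : 'M[int]_(k, d)) : exists N, has_card (zpoints x A) N.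
Proof.
have [L [C /(_ x) [a [_ _ /(_ 1%N)]]]] := poly_growth_exists A.
by rewrite scale1r => H; eexists; apply: H.
Qed.

(** Among the translates of a zonotope with integral generators, the integral ones
have the most lattice points, and strictly the most: this is clear without
generators, and deletion and contraction preserve it. *)
Lemma zpoints_le_untranslated k d (x : 'rV[R]_d) (A : 'M[int]_(k, d)) N N0 :
  has_card (zpoints x A) N -> has_card (zpoints (0 : 'rV[R]__) A) N0 ->
  (N + ~~ `[< is_integral x >] <= N0)%N.
Proof.
elim: k d x A N N0 => [|k IH] d x A N N0 h h0.
  have int0 : is_integral (0 : 'rV[R]_d) by exists 0; rewrite map_mx0.
  rewrite (has_card_inj h (card_zpoints_no_row _ _)) (has_card_inj h0 (card_zpoints_no_row _ _)).
  by rewrite (asboolT int0); case: asboolP.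
case: d x A h h0 => [|d] x A h h0.
  have intx : is_integral x by exists 0; apply/rowP => -[].
  rewrite (has_card_inj h (zpoints_dim0 _ _)) (has_card_inj h0 (zpoints_dim0 _ _)).
  by rewrite (asboolT intx).
move: x A h h0; rewrite -[k.+1]/(1 + k)%N -[d.+1]/(1 + d)%N => x A.
rewrite -[A]vsubmxK -[usubmx A]scale1r => h h0.
have [U [c [uU vU]]] := unimodular_straighten (usubmx A).
set A' := dsubmx A in h h0 *.
have [N1 h1] := zpoints_finite x A'.
have [N2 h2] := zpoints_finite (rsubmx (x *m U%:RM)) (rsubmx (A' *m U)).
have [M1 k1] := zpoints_finite (0 : 'rV[R]__) A'.
have [M2 k2] := zpoints_finite (0 : 'rV[R]__) (rsubmx (A' *m U)).
have -> := has_card_inj h (zpoints_add_row 1 uU vU h1 h2).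
have k2' : has_card (zpoints (rsubmx ((0 : 'rV[R]_(1 + d)) *m U%:RM)) (rsubmx (A' *m U))) M2.
  by rewrite mul0mx linear0.
have -> := has_card_inj h0 (zpoints_add_row 1 uU vU k1 k2').
rewrite addnAC leq_add ?leq_mul //; first exact: IH h1 k1.
by apply: leq_trans (IH _ _ _ _ _ h2 k2); rewrite leq_addr.
Qed.

(** The generator row r contributes t * c times the number of lattice points of the
projection along it. The hypothesis says that the projection of x is not
integral, so the projected zonotope has fewer points than for x = 0, and this
loss is repeated at least t times. *)
Lemma zpoints_linear_gap k d (x : 'rV[R]_d) (A : 'M[int]_(k, d)) (r : 'I_k) t N N0 :
  row r A != 0 -> (forall (z : 'rV_d) (s : R), x <> z%:RM + s *: (row r A)%:RM) ->
  has_card (zpoints x (t%:Z *: A)) N -> has_card (zpoints (0 : 'rV[R]__) (t%:Z *: A)) N0 ->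
  (N + t <= N0)%N.
Proof.
case: k A r => [|k] A r; first by case: r.
case: d x A => [|d] x A v0; first by rewrite [row r A]thinmx0 eqxx in v0.
move=> nx h h0.
pose B : 'M[int]_(1 + k, 1 + d) := row_perm (tperm ord0 r) A.
have B0 : usubmx B = row r A.
  apply/rowP => j; rewrite !mxE; congr (A _ j).
  by apply: etrans (tpermL ord0 r); congr (tperm _ _ _); apply: val_inj.
have BE (y : 'rV[R]_d.+1) M : has_card (zpoints y (t%:Z *: A)) M -> has_card (zpoints y (t%:Z *: B)) M.
  apply: eq_has_card => z; rewrite /B /zpoints /lattice_points /=.
  have -> : t%:Z *: row_perm (tperm ord0 r) A = row_perm (tperm ord0 r) (t%:Z *: A).
    by apply/matrixP => i j; rewrite !mxE.
  by rewrite zono_row_perm.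
move: (BE _ _ h) (BE _ _ h0); rewrite -[B]vsubmxK scale_col_mx {h h0}.
rewrite B0; set v := row r A in v0 nx *; set A' := t%:Z *: dsubmx B => h h0.
have [U [c [uU vU]]] := unimodular_straighten (v : 'rV_(1 + d)).
have c0 : (0 < c)%N.
  rewrite lt0n; apply: contraNneq v0 => c0; move: vU.
  rewrite c0 [_%:M]raddf0 row_mx0 => vU.
  by apply/eqP; rewrite -(mulmxK uU (v : 'rV_(1 + d))) vU mul0mx.
have [N1 h1] := zpoints_finite x A'.
have [N2 h2] := zpoints_finite (rsubmx ((x : 'rV_(1+d)) *m U%:RM)) (rsubmx (A' *m U)).
have [M1 k1] := zpoints_finite (0 : 'rV[R]__) A'.
have [M2 k2] := zpoints_finite (0 : 'rV[R]__) (rsubmx (A' *m U)).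
have -> := has_card_inj h (zpoints_add_row t uU vU h1 h2).
have k2' : has_card (zpoints (rsubmx ((0 : 'rV[R]_(1 + d)) *m U%:RM)) (rsubmx (A' *m U))) M2.
  by rewrite mul0mx linear0.
have -> := has_card_inj h0 (zpoints_add_row t uU vU k1 k2').
have nint : ~ is_integral (rsubmx ((x : 'rV_(1+d)) *m U%:RM)).
  move=> [q qE]; pose y := ((x : 'rV_(1+d)) *m U%:RM) 0 (lshift d 0).
  apply: (nx ((row_mx 0 q : 'rV_(1 + d)) *m invmx U) (y / c%:R)).
  have xU : (x : 'rV_(1+d)) *m U%:RM = (row_mx 0 q)%:RM + (y / c%:R) *: (v *m U)%:RM.
    rewrite vU !map_row_mx map_mx0 map_scalar_mx scale_row_mx add_row_mx.
    rewrite map_mx0 scaler0 addr0 -qE add0r scale_scalar_mx /= -pmulrn.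
    rewrite divfK ?pnatr_eq0 -?lt0n //.
    by rewrite -[LHS]hsubmxK; congr row_mx; rewrite [LHS]mx11_scalar mxE.
  have VU : U%:RM *m (invmx U)%:RM = 1%:M by rewrite -map_mxM mulmxV // map_scalar_mx.
  move/(congr1 (mulmx^~ (invmx U)%:RM)): xU.
  rewrite /= mulmxDl -scalemxAl -!map_mxM -!mulmxA mulmxV // mulmx1 => <-.
  by rewrite -map_mxM mulmxV // map_scalar_mx mulmx1.
have := zpoints_le_untranslated h1 k1; have := zpoints_le_untranslated h2 k2; rewrite (asboolF nint) /=.
rewrite addn1 => N2M2 N1M1; rewrite -addnA leq_add //.
  by apply: leq_trans N1M1; apply: leq_addr.
by apply: leq_trans (leq_mul (leqnn _) N2M2); rewrite mulnS addnC leq_add2r leq_pmulr.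
Qed.

End Growth.

(** * Volumes of zonotopes *)

Section Volume.
Local Open Scope classical_set_scope.
Variable R : realType.

Local Notation "A %:RM" := (map_mx (intr : int -> R) A) (at level 2, format "A %:RM").

(** The integral of a nonnegative function is a supremum over the simple functions
below it, hence it is monotone even for nonmeasurable functions, and the volumes of
the sections of a zonotope can be compared as they are. *)
Lemma le_integral_ge0 (f g : R -> \bar R) :
  (forall x, (0 <= f x)%E) -> (forall x, (f x <= g x)%E) ->
  (\int[@lebesgue_measure R]_x f x <= \int[@lebesgue_measure R]_x g x)%E.
Proof.
move=> f0 fg; have g0 x : (0 <= g x)%E by apply: le_trans (fg x).
rewrite !ge0_integralTE //; apply: le_ereal_sup => _ [h /= hf <-].
by exists h => //= x; apply: le_trans (fg x).
Qed.

Lemma lebesgue_rV_ge0 d (A : set 'rV[R]_d) : (0 <= lebesgue_rV A)%E.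
Proof.
elim: d A => [|d IH] A /=; first by rewrite lee_fin.
by apply: integral_ge0 => x _; apply: IH.
Qed.

Lemma lebesgue_rV_mono d (A B : set 'rV[R]_d) :
  A `<=` B -> (lebesgue_rV A <= lebesgue_rV B)%E.
Proof.
elim: d A B => [|d IH] A B AB /=.
  by rewrite lee_fin !indicE ler_nat; case: (boolP (_ \in A)) => //;
     rewrite inE => /AB/mem_set ->.
apply: le_integral_ge0 => x; first exact: lebesgue_rV_ge0.
by apply: IH => v /= /AB.
Qed.

(** The integral corner of the half-open cube of side 1/t that contains v, after
dilation by t. *)
Definition cell d (t : nat) (v : 'rV[R]_d) : 'rV[int]_d :=
  \row_i Num.floor (t%:R * v 0 i).

(** A union of cubes of side 1/t has the expected volume; by induction on d, the
sections of such a union are again unions of cubes. *)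
Lemma lebesgue_rV_cells d t (s : seq 'rV[int]_d) : (0 < t)%N -> uniq s ->
  lebesgue_rV [set v : 'rV[R]_d | cell t v \in s] = ((size s)%:R / t%:R ^+ d)%:E.
Proof.
move=> t0; have t0R : 0 < t%:R :> R by rewrite ltr0n.
elim: d s => [|d IH] s us.
  have all0 (z : 'rV[int]_0) : z = 0 by apply: thinmx0.
  rewrite /= expr0 divr1 indicE; congr (_%:R)%:E.
  have -> : ((0 : 'rV[R]_0) \in [set v | cell t v \in s]) = (0 \in s).
    by apply/idP/idP; rewrite inE /= (all0 (cell _ _)).
  case: s us => [|z [|z' s]] //=; last by rewrite (all0 z) (all0 z') inE eqxx.
  by move=> _; rewrite (all0 z) inE eqxx.
pose k (z : 'rV[int]_d.+1) := z 0 0.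
have lsh0 : lshift d (0 : 'I_1) = 0 :> 'I_d.+1 by apply: val_inj.
have row0 (a : R) (v : 'rV[R]_d) : (row_mx a%:M v : 'rV_(1 + d)) 0 (0 : 'I_d.+1) = a.
  by rewrite -lsh0 row_mxEl mxE eqxx mulr1n.
pose lo z : R := (k z)%:~R / t%:R; pose hi z : R := (k z + 1)%:~R / t%:R.
pose itv z : set R := `[lo z, hi z[%classic.
have lebE z : lebesgue_measure (itv z) = (t%:R^-1)%:E.
  have := lebesgue_measure_itv `[lo z, hi z[%R; rewrite /itv => ->.
  rewrite /= lte_fin /lo /hi ltr_pM2r ?invr_gt0 // ltr_int ltrDl ltr01 -EFinB.
  by rewrite -mulrBl rmorphD /= addrAC subrr add0r mul1r.
have itvE z x : (x \in itv z) = (k z == Num.floor (t%:R * x)).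
  have kE : (k z == Num.floor (t%:R * x)) =
      (lo z <= x < hi z).
    by rewrite /lo /hi eq_sym floor_eq ler_pdivrMr // ltr_pdivlMr // [x * _]mulrC.
  rewrite kE; apply/idP/idP => [/set_mem|h]; last apply/mem_set; rewrite /itv /=;
  by rewrite in_itv.
transitivity (\int[@lebesgue_measure R]_x
   (\sum_(z <- s) ((t%:R ^+ d)^-1%:E * (\1_(itv z) x)%:E)))%E.
  apply: eq_integral => x _.
  (* The corners of the cubes that meet the hyperplane of first coordinate x. *)
  pose sx := [seq (rsubmx (z : 'rV[int]_(1 + d))) | z <- s & k z == Num.floor (t%:R * x)].
  have usx : uniq sx.
    rewrite map_inj_in_uniq ?filter_uniq // => z z'.
    rewrite !mem_filter => /andP[/eqP kz _] /andP[/eqP kz' _] zz'.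
    rewrite -[z](@hsubmxK _ 1 1 d) -[z'](@hsubmxK _ 1 1 d) zz'; congr row_mx.
    apply/rowP => i; rewrite !mxE !ord1 lsh0.
    by rewrite -/(k z) -/(k z') kz kz'.
  rewrite (_ : [set v | _] = [set v | cell t v \in sx]); last first.
    apply/seteqP; split=> v /=.
      move=> h; apply/mapP; exists (cell t (row_mx x%:M v : 'rV_(1 + d))).
        by rewrite mem_filter h andbT /k mxE row0.
      by apply/rowP => i; rewrite mxE [RHS]mxE [RHS]mxE (@row_mxEr _ 1 1 d).
    case/mapP => z; rewrite mem_filter => /andP[/eqP kz zs] vz.
    rewrite (_ : cell _ _ = z) //; apply/rowP => i.
    rewrite mxE -[i]/(i : 'I_(1 + d)); case: (split_ordP (i : 'I_(1 + d))) => j ->.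
      rewrite row_mxEl ord1 mxE eqxx mulr1n -kz /k; congr (z _ _); exact: val_inj.
    by rewrite row_mxEr; move/rowP/(_ j): vz; rewrite !mxE.
  rewrite -/(@lebesgue_rV R d) IH // size_map size_filter -sum1_count big_mkcond natr_sum mulr_suml.
  rewrite -sumEFin; apply: eq_bigr => z _; rewrite -EFinM indicE itvE.
  by case: eqP => _; rewrite ?mul1r ?mulr1 ?mul0r ?mulr0.
have mz z : measurable_fun [set: R] (fun x : R => ((t%:R ^- d)%:E * (\1_(itv z) x)%:E)%E : \bar R).
  apply: measurable_funeM; apply/measurable_EFinP.
  by apply: measurable_indic; apply: measurable_itv.
have z0 z (x : R) : (0 <= (t%:R ^- d)%:E * (\1_(itv z) x)%:E)%E.
  by rewrite -EFinM lee_fin mulr_ge0 // invr_ge0 exprn_ge0 // ltW.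
rewrite ge0_integral_sum //.
transitivity (\sum_(z <- s) ((t%:R ^+ d.+1)^-1%:E : \bar R))%E.
  apply: eq_bigr => z _; rewrite ge0_integralZl_EFin //.
  - rewrite integral_indic //; last exact: measurable_itv.
    rewrite setIT; transitivity ((t%:R ^- d)%:E * (t%:R^-1)%:E : \bar R)%E.
      by congr (_ * _)%E; exact: lebE.
    by rewrite -EFinM exprSr invfM.
  - by apply/measurable_EFinP; apply: measurable_indic; apply: measurable_itv.
rewrite sumEFin; congr (_%:E).
by rewrite big_const_seq count_predT iter_addr_0 -[LHS]mulr_natl.
Qed.

Lemma le_of_le_inv (r b c : R) : (forall t : nat, (0 < t)%N -> r <= b + c / t%:R) -> r <= b.
Proof.
move=> H; rewrite leNgt; apply/negP => br.
have rb : 0 < r - b by rewrite subr_gt0.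
have [c0|c0] := leP c 0.
  have := H 1%N isT; rewrite divr1 => h; move: rb; lra.
pose t := (Num.truncn (c / (r - b))).+1.
have := H t isT; have t0 : (0 : R) < t%:R by rewrite ltr0n.
have : c / (r - b) < t%:R by apply: truncnS_gt.
rewrite ltr_pdivrMr // -lerBlDl ler_pdivlMr // mulrC => h1 h2.
by move: (lt_le_trans h1 h2); rewrite ltxx.
Qed.

Lemma sum_le_top (a : nat -> nat) C d t : (0 < t)%N -> (forall j, (a j <= C)%N) ->
  ((\sum_(j < d.+1) a j * t ^ j) * t <= a d * t ^ d * t + d * C * t ^ d)%N.
Proof.
move=> t0 aC; rewrite big_ord_recr /= mulnDl addnC leq_add2l.
rewrite big_distrl -[X in (X * C)%N](card_ord d) -mulnA -sum_nat_const /=.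
apply: leq_sum => j _; rewrite -mulnA -expnSr leq_mul // leq_pexp2l //.
Qed.

(** The cubes of side 1/t that meet the zonotope have their corners in the t-th
dilate enlarged by a unit cube, that is, by d fixed generators; there are
L t^d + O(t^(d-1)) of them. *)
Lemma zono_volume_le k d (c : 'rV[R]_d) (A : 'M[int]_(k, d)) L :
  poly_growth R (fun t => t%:Z *: A) L -> (lebesgue_rV (zono c A) <= L%:R%:E)%E.
Proof.
move=> gA; have [C HC] := poly_growth_undilated_rows (1%:M : 'M[int]_(d, d)) gA.
suff H t : (0 < t)%N -> (lebesgue_rV (zono c A) <= (L%:R + (d * C)%:R / t%:R)%:E)%E.
  move: H (lebesgue_rV_ge0 (zono c A)); case: (lebesgue_rV _) => [r||] // H _.
    rewrite lee_fin; apply: (@le_of_le_inv _ _ (d * C)%:R) => t t0.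
    by have := H t t0; rewrite lee_fin.
  by have := H 1%N isT.
move=> t0; have t0R : 0 < t%:R :> R by rewrite ltr0n.
have [a [aL aC Ha]] := HC (t%:R *: c - const_mx 1).
have [s [us sN sP]] := Ha t.
have sub : zono c A `<=` [set v | cell t v \in s].
  move=> v [l l01 vE] /=; apply/sP.
  exists (row_mx (const_mx 1 - (t%:R *: v - (cell t v)%:RM)) l).
    move=> i; rewrite mxE; case: splitP => j _ //; rewrite !mxE.
    have := floor_itv (t%:R * v 0 j); rewrite intrD1 => /andP[h1 h2].
    by apply/andP; split; lra.
  rewrite map_col_mx mul_row_col map_scalar_mx mulmx1 vE.
  have -> : (t%:Z *: A)%:RM = t%:R *: A%:RM.
    by apply/matrixP => i j; rewrite !mxE intrM.
  rewrite -scalemxAr !scalerDr; apply/rowP => i; rewrite !mxE; ring.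
apply: le_trans (lebesgue_rV_mono sub) _; rewrite lebesgue_rV_cells // lee_fin sN.
rewrite ler_pdivrMr ?exprn_gt0 // -(ler_pM2r t0R) -natrM.
apply: le_trans (_ : (L * t ^ d * t + d * C * t ^ d)%:R <= _).
  by rewrite ler_nat -aL; apply: sum_le_top.
rewrite natrD !natrM !natrX le_eqVlt; apply/orP; left; apply/eqP; field.
by rewrite gt_eqF.
Qed.

(** Since the generators span, the N-th dilate contains a unit cube for some N. With
t = N s, a cube whose corner lies in the dilate by N (s - 1), suitably centred,
is therefore contained in the dilate by t. There are at least
L (N (s - 1))^d such corners, so the volume is at least L (1 - 1/s)^d, which is
at least L (1 - d/s). *)
Lemma zono_volume_ge k d (c : 'rV[R]_d) (A : 'M[int]_(k, d)) L : row_full (A%:RM) ->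
  poly_growth R (fun t => t%:Z *: A) L -> (L%:R%:E <= lebesgue_rV (zono c A))%E.
Proof.
move=> fA [C HC].
have /submxP[B BA] : ((1%:M : 'M[R]_d) <= A%:RM)%MS by rewrite sub1mx.
(* The coordinates on the generators of a point of the unit cube are at most S
   in absolute value, so that the cube fits into the dilate by 2 S centred at w. *)
pose S := (Num.truncn (\sum_i \sum_j `|B i j|)).+1.
have SB (u : 'rV[R]_d) : (forall i, 0 <= u 0 i <= 1) -> forall j, `|(u *m B) 0 j| <= S%:R.
  move=> u01 j; apply: (@le_trans _ _ (\sum_i \sum_j `|B i j|)); last first.
    by apply/ltW/truncnS_gt.
  rewrite mxE; apply: (le_trans (ler_norm_sum _ _ _)); apply: ler_sum => i _.
  rewrite normrM (bigD1 j) //=; have /andP[u0 u1] := u01 i.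
  rewrite (ger0_norm u0); apply: (@le_trans _ _ `|B i j|); first by rewrite ler_piMl.
  by rewrite lerDl sumr_ge0.
pose N := (2 * S)%N; pose w : 'rV[R]_d := (const_mx S%:R : 'rV_k) *m A%:RM.
have S0 : 0 < S%:R :> R by rewrite ltr0n.
have N0 : 0 < N%:R :> R by rewrite ltr0n.
suff H s : (0 < s)%N -> (((L%:R : R) * (1 - d%:R / s%:R))%:E <= lebesgue_rV (zono c A))%E.
  move: H (lebesgue_rV_ge0 (zono c A)); case: (lebesgue_rV _) => [r||] // H _; last first.
    exact: leey.
  rewrite lee_fin; apply: (@le_of_le_inv _ _ (L%:R * d%:R)) => t t0.
  by have := H t t0; rewrite lee_fin; lra.
move=> s0; have s0R : 0 < s%:R :> R by rewrite ltr0n.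
pose t := (N * s)%N; have t0 : (0 < t)%N by rewrite muln_gt0 s0.
have t0R : 0 < t%:R :> R by rewrite ltr0n.
have [a [aL aC Ha]] := HC (t%:R *: c + w).
have [z [uz zN zP]] := Ha (N * s.-1)%N.
have tE : t%:R = N%:R + (N * s.-1)%N%:R :> R by rewrite -natrD /t -mulnS prednK.
have scE (m : nat) : (m%:Z *: A)%:RM = m%:R *: A%:RM.
  by apply/matrixP => i j; rewrite !mxE intrM.
have sub : [set v | cell t v \in z] `<=` zono c A.
  move=> v /= /zP[l l01 vE].
  have [u uE] : exists u : 'rV[R]_d, u = t%:R *: v - (cell t v)%:RM by eexists.
  have u01 i : 0 <= u 0 i <= 1.
    rewrite uE !mxE; have := floor_itv (t%:R * v 0 i); rewrite intrD1 => /andP[h1 h2].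
    by apply/andP; split; lra.
  exists (t%:R^-1 *: (u *m B + const_mx S%:R + (N * s.-1)%N%:R *: l)).
    move=> j; have := SB u u01 j; rewrite ler_norml => /andP[b1 b2].
    have /andP[l0 l1] := l01 j; rewrite mxE [X in _ * X]mxE [X in X + _]mxE.
    rewrite [const_mx _ _ _]mxE [(_ *: l) _ _]mxE mulrC.
    rewrite ler_pdivlMr // ler_pdivrMr // mul0r mul1r tE.
    have NE : N%:R = 2 * S%:R :> R by rewrite /N natrM.
    have M0 : 0 <= (N * s.-1)%N%:R :> R by [].
    move: b1 b2; set b := (u *m B) 0 j => b1 b2.
    by apply/andP; split; nra.
  rewrite -scalemxAl !mulmxDl -mulmxA -BA mulmx1 -/w.
  have -> : u = t%:R *: v - (t%:R *: c + w + l *m ((N * s.-1)%N%:Z *: A)%:RM).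
    by rewrite uE vE.
  rewrite scE -scalemxAl -scalemxAr.
  apply: (@scalerI _ _ t%:R); first by rewrite gt_eqF.
  rewrite scalerDr scalerA mulfV ?gt_eqF // scale1r; apply/rowP => i.
  by rewrite !mxE; ring.
apply: le_trans (lebesgue_rV_mono sub); rewrite lebesgue_rV_cells // lee_fin zN.
rewrite ler_pdivlMr ?exprn_gt0 //.
apply: (@le_trans _ _ (L * (N * s.-1) ^ d)%:R); last first.
  by rewrite ler_nat big_ord_recr /= aL leq_addl.
rewrite natrM -mulrA ler_wpM2l // natrX.
have -> : (N * s.-1)%N%:R = N%:R * s.-1%:R :> R by rewrite natrM.
have -> : t%:R = N%:R * s%:R :> R by rewrite /t natrM.
rewrite !exprMn mulrCA; apply: ler_wpM2l; first by rewrite exprn_ge0 // ltW.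
have -> : s.-1%:R = s%:R - 1 :> R by rewrite -subn1 natrB.
have {1}-> : 1 - d%:R / s%:R = 1 + d%:R * (- s%:R^-1) :> R by rewrite mulrN.
have -> : s%:R - 1 = (1 - s%:R^-1) * s%:R :> R by rewrite mulrBl mul1r mulVf ?gt_eqF.
rewrite exprMn; apply: ler_wpM2r; first by rewrite exprn_ge0 // ltW.
have si : 0 <= (s%:R^-1 : R) <= 1.
  by rewrite invr_ge0 ltW //= invf_le1 // ler1n.
case/andP: si => si0 si1; set q := s%:R^-1 in si0 si1 *.
elim: (d) => [|e IH]; first by rewrite mul0r addr0 expr0.
rewrite exprS -natr1; have : 0 <= 1 - q by lra.
have : 0 <= (e%:R : R) by [].
set E := (1 - q) ^+ e in IH *; nra.
Qed.

Lemma zono_volume k d (c : 'rV[R]_d) (A : 'M[int]_(k, d)) L : row_full (A%:RM) ->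
  poly_growth R (fun t => t%:Z *: A) L -> lebesgue_rV (zono c A) = L%:R%:E.
Proof.
move=> fA gA; apply/eqP; rewrite eq_le.
by rewrite zono_volume_le // zono_volume_ge.
Qed.

End Volume.

(** * The permutahedron as the set of scores of fractional tournaments *)

Section Tournaments.
Local Open Scope classical_set_scope.
Variables (R : realType) (n : nat).

(** A fractional tournament: p i j is the share of i in the game between i and j. In
particular p i i = 1/2. *)
Definition fractional (T : Type) (p : T -> T -> R) :=
  forall i j, 0 <= p i j /\ p i j + p j i = 1.

(** The diagonal entry 1/2 of a fractional tournament makes the score of i equal to
1 plus its total share in the games against the others. *)
Definition score (p : 'I_n -> 'I_n -> R) : 'rV[R]_n := \row_i (2^-1 + \sum_j p i j).

Lemma permutahedron_convex (x y : 'rV[R]_n) s : 0 <= s <= 1 ->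
  permutahedron R n x -> permutahedron R n y ->
  permutahedron R n (s *: x + (1 - s) *: y).
Proof.
move=> /andP[s0 s1] [w [w0 w1 ->]] [v [v0 v1 ->]].
exists (fun u => s * w u + (1 - s) * v u); split.
- by move=> u; rewrite addr_ge0 // mulr_ge0 // subr_ge0.
- by rewrite big_split -!mulr_sumr w1 v1 /= !mulr1 addrC subrK.
rewrite !scaler_sumr -big_split; apply: eq_bigr => u _ /=.
by rewrite !scalerA -scalerDl.
Qed.

Lemma permutahedron_vertex (s : 'S_n) : permutahedron R n (perm_vertex R s).
Proof.
exists (fun u => (u == s)%:R); split=> [u||]; first by rewrite ler0n.
  by rewrite (bigD1 s) //= eqxx big1 ?addr0 // => u /negPf ->.
by rewrite (bigD1 s) //= eqxx scale1r big1 ?addr0 // => u /negPf ->; rewrite scale0r.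
Qed.

(** Either all scores differ, and then they are 1, ..., n in some order, a vertex. Or
i and j have the same score and i beats j. Reversing that game gives a
tournament with a larger sum of squared scores, whose score vector lies in the
permutahedron by induction; the original score vector is the midpoint of it and
of its image under the transposition of i and j. *)
Lemma tournament_permutahedron (T : 'I_n -> 'I_n -> bool) :
  (forall i, T i i = false) -> (forall i j, i != j -> T j i = ~~ T i j) ->
  permutahedron R n (\row_i (1 + \sum_j T i j)%:R).
Proof.
pose deg (U : 'I_n -> 'I_n -> bool) i := (\sum_j U i j)%N.
pose pot U := (\sum_i deg U i ^ 2)%N.
have [m] := ubnP (n * n ^ 2 - pot T); elim: m T => // m IH T Tm Tii Tij.
have degn (U : 'I_n -> 'I_n -> bool) i : (deg U i <= n)%N.
  rewrite -[X in (_ <= X)%N](card_ord n) -sum1_card; apply: leq_sum => j _.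
  by case: (U i j).
have potn U : (pot U <= n * n ^ 2)%N.
  rewrite -[X in (_ <= X * _)%N](card_ord n) -sum_nat_const; apply: leq_sum => j _.
  by rewrite leq_exp2r.
have deglt i : (deg T i < n)%N.
  rewrite /deg (bigD1 i) //= Tii add0n.
  apply: (@leq_ltn_trans (\sum_(j < n | j != i) 1)%N).
    by apply: leq_sum => j _; case: (T i j).
  by rewrite sum1_card cardC1 card_ord prednK // (leq_ltn_trans _ (ltn_ord i)).
have [/injectiveP inj|/injectivePn[i [j nij dij]]] :=
  boolP (injectiveb (fun i => Ordinal (deglt i))).
  rewrite (_ : \row__ _ = perm_vertex R (perm inj)); first exact: permutahedron_vertex.
  by apply/rowP => i; rewrite !mxE permE.
move/(congr1 val): dij => /= dij.
wlog Tijt : i j nij dij / T i j.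
  move=> W; have [h|/negPf h] := boolP (T i j); first exact: (W i j).
  by apply: (W j i); rewrite 1?eq_sym // Tij // h.
pose sw (a b : 'I_n) := ((a == i) && (b == j)) || ((a == j) && (b == i)).
pose T' a b := T a b (+) sw a b.
have T'ii a : T' a a = false.
  by rewrite /T' Tii /sw; case: (eqVneq a i) => [->|_]; rewrite ?(negPf nij) ?andbF.
have T'ij a b : a != b -> T' b a = ~~ T' a b.
  move=> ab; rewrite /T' (Tij a b) // -addNb; congr (_ (+) _).
  by rewrite /sw orbC andbC [X in _ || X]andbC.
have degi : (deg T' i).+1 = deg T i.
  rewrite /deg [RHS](bigD1 j) //= [in LHS](bigD1 j) //= /T' Tijt /sw !eqxx add0n add1n.
  congr _.+1; apply: eq_bigr => b bj.
  by rewrite (negPf bj) (negPf nij) /= addbF.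
have degj : deg T' j = (deg T j).+1.
  rewrite /deg [in RHS](bigD1 i) //= [in LHS](bigD1 i) //= /T' (Tij i j) // Tijt /sw !eqxx orbT add0n add1n.
  congr _.+1; apply: eq_bigr => b bi.
  by rewrite eq_sym (negPf nij) (negPf bi) /= addbF.
have dego a : a != i -> a != j -> deg T' a = deg T a.
  by move=> ai aj; apply: eq_bigr => b _; rewrite /T' /sw (negPf ai) (negPf aj) addbF.
have potE : pot T' = (pot T + 2)%N.
  have nji : j != i by rewrite eq_sym.
  rewrite /pot [RHS](_ : _ = deg T i ^ 2 + (deg T j ^ 2 +
     \sum_(a < n | (a != i) && (a != j)) deg T a ^ 2) + 2)%N; last first.
    by rewrite (bigD1 i) //= (bigD1 j).
  rewrite (bigD1 i) //= (bigD1 j) //= (eq_bigr (fun a => deg T a ^ 2)%N); last first.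
    by move=> a /andP[? ?]; rewrite dego.
  rewrite degj -dij -degi -!mulnn; set d := deg T' i; set S := (\sum_(_ < n | _) _)%N.
  by clear; lia.
have := IH T' _ T'ii T'ij; have pn := potn T'.
have -> : (n * n ^ 2 - pot T' < m)%N by lia.
move=> /(_ isT) Px.
have := permutahedron_convex (s := 2^-1) _ Px (permutahedron_perm (tperm i j) Px).
have -> : 0 <= (2^-1 : R) <= 1 by apply/andP; split; lra.
move=> /(_ isT); congr permutahedron; rewrite -[tperm i j]invgK -col_permE.
apply/rowP => a; rewrite !mxE tpermV.
rewrite -/(deg T a) -/(deg T' a) -/(deg T' _).
case: tpermP => [->|->|/eqP ai /eqP aj].
- by rewrite degj -dij -degi !natrD -!natr1; field.
- by rewrite degj -dij -degi !natrD -!natr1; field.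
- by rewrite dego //; field.
Qed.

(** A fractional game between i and j is a convex combination of a win and a loss;
resolving the games one by one reduces to genuine tournaments. The list ps
holds the games that may still be fractional. *)
Lemma score_permutahedron (p : 'I_n -> 'I_n -> R) :
  fractional p -> permutahedron R n (score p).
Proof.
move=> fp; pose ps := enum (predT : pred ('I_n * 'I_n)).
have : forall i j, i != j -> (i, j) \notin ps -> (j, i) \notin ps ->
   p i j = 0 \/ p i j = 1 by move=> i j _; rewrite mem_enum.
elim: ps p fp => [|[i j] ps IH] p fp pb.
  pose T i j := (i != j) && (p i j == 1).
  have pT i j : i != j -> p i j = (T i j)%:R.
    move=> nij; rewrite /T nij /=; have [->|->] := pb i j nij isT isT; last by rewrite eqxx.
    by rewrite eq_sym oner_eq0.
  have pii i : p i i = 2^-1 by have [_] := fp i i; lra.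
  rewrite (_ : score p = \row_i (1 + \sum_j T i j)%:R); last first.
    apply/rowP => i; rewrite !mxE natrD natr_sum (bigD1 i) //= [in RHS](bigD1 i) //=.
    rewrite pii /T eqxx /= add0r addrA (eq_bigr (fun j => (T i j)%:R)); last first.
      by move=> j nji; rewrite pT // eq_sym.
    by congr (_ + _); lra.
  apply: tournament_permutahedron => [i|i j nij]; first by rewrite /T eqxx.
  have [_] := fp i j; rewrite !pT // 1?eq_sym //.
  by case: (T i j); case: (T j i) => //=; lra.
have [eij|nij] := eqVneq i j.
  apply: IH => // a b nab h1 h2; apply: pb => //; rewrite inE negb_or ?h1 ?h2 andbT -eij.
    by apply: contraNneq nab => -[-> ->].
  by apply: contraNneq nab => -[-> ->].
pose P a b := (a == i) && (b == j).
pose upd (c : R) a b := if P a b then c else if P b a then 1 - c else p a b.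
have fupd c : 0 <= c <= 1 -> fractional (upd c).
  move=> /andP[c0 c1] a b; rewrite /upd.
  have : ~~ (P a b && P b a).
    apply/negP => /andP[/andP[/eqP -> _] /andP[_ ij]].
    by rewrite ij in nij.
  by case: (P a b); case: (P b a) => // _; try exact: fp; split; lra.
have bupd c : c = 0 \/ c = 1 -> forall a b, a != b -> (a, b) \notin ps -> (b, a) \notin ps ->
    upd c a b = 0 \/ upd c a b = 1.
  move=> c01 a b nab h1 h2; rewrite /upd; case: ifP => // c1; case: ifP => c2.
    by case: c01 => ->; [right|left]; lra.
  apply: pb => //; rewrite inE negb_or ?h1 ?h2 andbT xpair_eqE -/(P _ _) ?c1 ?c2 //.
have [p0 p1] := fp i j; have [p0' _] := fp j i.
have p01 : 0 <= p i j <= 1 by apply/andP; split; lra.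
have := permutahedron_convex p01 (IH _ (fupd 1 _) (bupd 1 _)) (IH _ (fupd 0 _) (bupd 0 _)).
rewrite !lexx !ler01 => /(_ isT (or_intror erefl) isT (or_introl erefl)).
congr permutahedron; apply/rowP => a; rewrite !mxE !mulrDr !mulr_sumr.
rewrite addrACA -mulrDl (_ : p i j + (1 - p i j) = 1); last by lra.
rewrite mul1r -big_split /=; congr (_ + _); apply: eq_bigr => b _.
rewrite /upd /P; case: ifP => [/andP[/eqP -> /eqP ->]|_]; first by lra.
case: ifP => [/andP[/eqP -> /eqP ->]|_]; last by lra.
by lra.
Qed.

(** The vertex of s is the score vector of the tournament in which the larger value
of s wins; mix these tournaments with the weights of x. *)
Lemma permutahedron_score (x : 'rV[R]_n) : permutahedron R n x ->
  exists2 p, fractional p & x = score p.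
Proof.
case=> w [w0 w1 ->].
pose q (s : 'S_n) i j : R := (s j < s i)%N%:R + (i == j)%:R / 2.
have fq s : fractional (q s).
  move=> i j; rewrite /q; split; first by rewrite addr_ge0 ?divr_ge0.
  have [->|nij] := eqVneq i j; first by rewrite ltnn ?eqxx /=; lra.
  rewrite ?[j == i]eq_sym ?(negPf nij) /= mul0r !addr0.
  have : s i != s j :> nat by apply: contraNneq nij => /val_inj/perm_inj ->.
  by case: ltngtP => // _ _; rewrite ?addr0 ?add0r.
exists (fun i j => \sum_s w s * q s i j).
  move=> i j; split; first by apply: sumr_ge0 => s _; rewrite mulr_ge0 //; case: (fq s i j).
  rewrite -big_split -[RHS]w1; apply: eq_bigr => s _ /=.
  by rewrite -mulrDr (fq s i j).2 mulr1.
apply/rowP => i; rewrite summxE mxE exchange_big /=.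
have -> : 2^-1 = \sum_s w s * 2^-1 by rewrite -mulr_suml w1 mul1r.
rewrite -big_split; apply: eq_bigr => s _ /=.
rewrite !mxE -mulr_sumr -mulrDr; congr (_ * _).
rewrite big_split /= -mulr_suml -natr_sum [X in _ + (_ + X / _)](bigD1 i) //= eqxx.
rewrite [X in true%:R + X]big1 ?addr0 => [|j ji]; last by rewrite eq_sym (negPf ji).
have -> : (\sum_(j < n) (s j < s i))%N = s i.
  rewrite (reindex_inj (@perm_inj _ s^-1)) /=.
  rewrite (eq_bigr (fun j : 'I_n => if (j < s i)%N then 1%N else 0%N)); last first.
    by move=> j _; rewrite permKV; case: ltnP.
  rewrite -big_mkcond /= sum1_card -[RHS](card_ord (s i)).
  have winj : injective (widen_ord (ltnW (ltn_ord (s i)))).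
    by move=> a b /(congr1 val) /= ab; apply: val_inj.
  rewrite -(fintype.card_image winj).
  apply: eq_card => j; apply/idP/fintype.imageP => [ji|[k _ ->]]; last exact: (ltn_ord k).
  by exists (Ordinal (ji : (j < s i)%N)) => //; apply: val_inj.
by rewrite -natr1 /=; lra.
Qed.

End Tournaments.

(** * Fixed polytopes as zonotopes *)

Section Cycles.
Local Open Scope classical_set_scope.
Variables (R : realType) (n : nat) (g : 'S_n).

Local Notation "A %:RM" := (map_mx (intr : int -> R) A) (at level 2, format "A %:RM").
Local Notation cyc := (porbit g).
Local Notation C := (porbits g).

Lemma cyc_mem i : cyc i \in C.
Proof. exact: imset_f. Qed.

Lemma mem_cycle (a : {set 'I_n}) i : a \in C -> (i \in a) = (a == cyc i).
Proof. by case/imsetP => k _ ->; rewrite eq_sym eq_porbit_mem. Qed.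

Lemma cyc_gt0 (a : {set 'I_n}) : a \in C -> (0 < #|a|)%N.
Proof. by case/imsetP => k _ ->; apply/card_gt0P; exists k; apply: porbit_id. Qed.

Lemma sum_cycles (V : zmodType) (F : 'I_n -> V) :
  \sum_i F i = \sum_(a in C) \sum_(i in a) F i.
Proof.
rewrite (partition_big cyc (fun a => a \in C)) => [|i _]; last exact: cyc_mem.
apply: eq_bigr => a aC; apply: eq_bigl => i.
by rewrite mem_cycle // eq_sym.
Qed.

Lemma sum_cyc_const (F : {set 'I_n} -> R) :
  \sum_i F (cyc i) = \sum_(a in C) F a * #|a|%:R.
Proof.
rewrite sum_cycles; apply: eq_bigr => a aC.
rewrite (eq_bigr (fun=> F a)) => [|i]; last by rewrite mem_cycle // => /eqP <-.
by rewrite sumr_const mulr_natr.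
Qed.

Lemma perm_fixP (F : nzRingType) (x : 'rV[F]_n) :
  x *m perm_mx g = x <-> forall i, x 0 (g i) = x 0 i.
Proof.
rewrite -[g in perm_mx g]invgK -col_permE; split=> [xg i|xg].
  by rewrite -{1}xg mxE permK.
by apply/rowP => i; rewrite mxE -{2}[i](permKV g) xg.
Qed.

Lemma perm_fix_cyc (F : nzRingType) (x : 'rV[F]_n) i j : x *m perm_mx g = x ->
  j \in cyc i -> x 0 j = x 0 i.
Proof.
move=> /perm_fixP xg /porbitP[k ->]; elim: k => [|k IH]; first by rewrite expg0 perm1.
by rewrite expgSr permM xg.
Qed.

Lemma cyc_perm i : cyc (g i) = cyc i.
Proof. by have := porbit_perm g 1 i; rewrite expg1. Qed.

(** Averaging a tournament over all pairs of points of two given cycles keeps an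
invariant score vector. *)
Lemma fixed_score (x : 'rV[R]_n) : fixed_permutahedron R g x <->
  exists2 l : {set 'I_n} -> {set 'I_n} -> R, fractional l &
    x = score (fun i j => l (cyc i) (cyc j)).
Proof.
split=> [[/permutahedron_score[p fp xp] xg]|[l fl ->]]; last first.
  split; first by apply: score_permutahedron => i j; apply: fl.
  by apply/perm_fixP => i; rewrite !mxE cyc_perm.
pose l (a b : {set 'I_n}) : R := if (a \in C) && (b \in C) then
   (#|a|%:R * #|b|%:R)^-1 * \sum_(i in a) \sum_(j in b) p i j else 2^-1.
have C0 (a : {set 'I_n}) : a \in C -> #|a|%:R != 0 :> R.
  by move=> aC; rewrite pnatr_eq0 -lt0n cyc_gt0.
exists l.
  move=> a b; rewrite /l [(b \in C) && _]andbC; case: ifP => [/andP[aC bC]|_]; last by split; lra.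
  split.
    rewrite mulr_ge0 ?invr_ge0 ?mulr_ge0 // sumr_ge0 // => i _; apply: sumr_ge0 => j _.
    by case: (fp i j).
  rewrite [X in _ * _ + _ * X]exchange_big [#|b|%:R * _]mulrC /= -mulrDr -big_split /=.
  rewrite (eq_bigr (fun=> #|b|%:R)) => [|i _].
    by rewrite sumr_const -[X in _ * X]mulr_natl mulVf // mulf_neq0 ?C0.
  rewrite -big_split (eq_bigr (fun=> 1)) ?sumr_const // => j _ /=.
  by case: (fp i j).
apply/rowP => i; rewrite mxE (sum_cyc_const (l (cyc i))).
rewrite (eq_bigr (fun b : {set 'I_n} => #|cyc i|%:R^-1 * \sum_(k in cyc i) \sum_(j in b) p k j)).
  rewrite -mulr_sumr exchange_big /=.
  rewrite (eq_bigr (fun=> x 0 i - 2^-1)) => [|k ki].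
    rewrite sumr_const -[X in _ * X]mulr_natl mulrA mulVf ?C0 ?cyc_mem // mul1r.
    by rewrite addrC subrK.
  rewrite -sum_cycles -(perm_fix_cyc xg ki) xp mxE; lra.
move=> b bC; rewrite /l cyc_mem bC /= mulrAC invfM divfK ?C0 //.
Qed.

(** An arbitrary total order on the cycles. *)
Definition cycle_lt (a b : {set 'I_n}) := (enum_rank a < enum_rank b)%N.

Definition cycle_indicator (a : {set 'I_n}) : 'rV[int]_n := \row_i (i \in a)%:R.

(** The change of the score vector when all games between a and b are turned from a
loss to a win of a. *)
Definition cycle_vector (a b : {set 'I_n}) : 'rV[int]_n :=
  #|b|%:Z *: cycle_indicator a - #|a|%:Z *: cycle_indicator b.

(** Indexing the generators by all pairs of subsets, with value 0 unless the pair
consists of two cycles in increasing order, avoids a dependent index type. *)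
Definition cycle_gen (p : {set 'I_n} * {set 'I_n}) : 'rV[int]_n :=
  if [&& p.1 \in C, p.2 \in C & cycle_lt p.1 p.2] then cycle_vector p.1 p.2 else 0.

Definition cycle_gens : 'M[int]_(#|{: {set 'I_n} * {set 'I_n}}|, n) :=
  \matrix_(r, i) cycle_gen (enum_val r) 0 i.

(** The score vector of the tournament in which the larger of two cycles always wins
and points of the same cycle draw. *)
Definition zono_base : 'rV[R]_n :=
  score (fun i j => if cyc i == cyc j then 2^-1 else (cycle_lt (cyc j) (cyc i))%:R).

Lemma cycle_lt_total a b : a != b -> cycle_lt a b = ~~ cycle_lt b a.
Proof.
rewrite /cycle_lt => nab; have : enum_rank a != enum_rank b :> nat.
  by apply: contraNneq nab => /val_inj/enum_rank_inj ->.
by case: ltngtP.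
Qed.

Lemma cycle_ltnn a : cycle_lt a a = false.
Proof. exact: ltnn. Qed.

(** For cycles a < b, the share l a b of a in its games with b moves the score vector
by l a b times the vector of the pair, starting from the tournament that b
wins. *)
Lemma score_zono_base (l : {set 'I_n} -> {set 'I_n} -> R) : fractional l ->
  score (fun i j => l (cyc i) (cyc j)) = zono_base + \sum_p l p.1 p.2 *: (cycle_gen p)%:RM.
Proof.
move=> fl; apply/rowP => i; rewrite !mxE summxE -addrA; congr (_ + _).
set a0 := cyc i; have a0C : a0 \in C by apply: cyc_mem.
rewrite (sum_cyc_const (l a0)).
rewrite (sum_cyc_const (fun b => if a0 == b then 2^-1 else (cycle_lt b a0)%:R)).
have -> : \sum_p (l p.1 p.2 *: (cycle_gen p)%:RM) 0 i =
   \sum_(a in C) \sum_(b in C) (cycle_lt a b)%:R * l a b * #|b|%:R * (a == a0)%:R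
   - \sum_(b in C) \sum_(a in C) (cycle_lt a b)%:R * l a b * #|a|%:R * (b == a0)%:R.
  rewrite [X in _ - X]exchange_big /= -sumrB [RHS]big_mkcond /=.
  rewrite -(pair_bigA _ (fun a b => (l a b *: (cycle_gen (a, b))%:RM) 0 i)) /=.
  apply: eq_bigr => a _; case: ifP => aC; last first.
    by rewrite big1 // => b _; rewrite /cycle_gen /= aC /= map_mx0 scaler0 mxE.
  rewrite -sumrB [RHS]big_mkcond; apply: eq_bigr => b _ /=.
  rewrite /cycle_gen /= aC /=; case bC: (b \in C) => /=; last by rewrite map_mx0 scaler0 mxE.
  case: (cycle_lt a b); last by rewrite map_mx0 scaler0 mxE /= !mul0r subr0.
  rewrite !mxE (mem_cycle i aC) (mem_cycle i bC) -/a0 rmorphB !rmorphM /= !mulr_natr.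
  by case: (a == a0); case: (b == a0); rewrite /=; ring.
have collapse (F : {set 'I_n} -> R) : \sum_(a in C) F a * (a == a0)%:R = F a0.
  rewrite (bigD1 a0) //= eqxx mulr1 big1 ?addr0 // => a /andP[_ /negPf ->].
  by rewrite mulr0.
have -> : \sum_(a in C) \sum_(b in C) (cycle_lt a b)%:R * l a b * #|b|%:R * (a == a0)%:R =
    \sum_(b in C) (cycle_lt a0 b)%:R * l a0 b * #|b|%:R.
  rewrite -[RHS](collapse (fun c => \sum_(b in C) (cycle_lt c b)%:R * l c b * #|b|%:R)).
  by apply: eq_bigr => a _; rewrite mulr_suml.
have -> : \sum_(b in C) \sum_(a in C) (cycle_lt a b)%:R * l a b * #|a|%:R * (b == a0)%:R =
    \sum_(a in C) (cycle_lt a a0)%:R * l a a0 * #|a|%:R.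
  rewrite -[RHS](collapse (fun c => \sum_(a in C) (cycle_lt a c)%:R * l a c * #|a|%:R)).
  by apply: eq_bigr => a _; rewrite mulr_suml.
rewrite -sumrB -big_split; apply: eq_bigr => b bC /=.
have [_ lab] := fl a0 b; have [_ laa] := fl a0 a0.
case: (eqVneq a0 b) => [<-|nab]; first by rewrite cycle_ltnn /= !mul0r subr0 addr0; congr (_ * _); lra.
by rewrite (cycle_lt_total nab); case: (cycle_lt b a0) => /=; nra.
Qed.

Lemma zono_cycle_gens (x y : 'rV[R]_n) : zono x cycle_gens y <->
  exists2 l : {set 'I_n} * {set 'I_n} -> R, (forall p, 0 <= l p <= 1) &
    y = x + \sum_p l p *: (cycle_gen p)%:RM.
Proof.
have E (l : {set 'I_n} * {set 'I_n} -> R) :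
   (\row_r l (enum_val r)) *m cycle_gens%:RM = \sum_p l p *: (cycle_gen p)%:RM.
  apply/rowP => i; rewrite !mxE summxE (reindex_onto enum_rank enum_val) /=; last first.
    by move=> r _; rewrite enum_valK.
  rewrite (eq_bigl xpredT) => [|p]; last by rewrite enum_rankK eqxx.
  by apply: eq_bigr => p _; rewrite !mxE enum_rankK.
split=> -[l l01 ->].
  exists (fun p => l 0 (enum_rank p)) => //; rewrite -E; congr (_ + _ *m _).
  by apply/rowP => r; rewrite mxE enum_valK.
by exists (\row_r l (enum_val r)); rewrite ?E // => r; rewrite mxE.
Qed.

(** The shares l a b for a < b are independent parameters in [0, 1]. *)
Lemma fixed_permutahedron_zono : fixed_permutahedron R g = zono zono_base cycle_gens.
Proof.
apply/seteqP; split=> x.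
  case/fixed_score => l fl ->; rewrite zono_cycle_gens (score_zono_base fl).
  exists (fun p => l p.1 p.2) => // p; have [l0 l1] := fl p.1 p.2.
  by have [l0' _] := fl p.2 p.1; apply/andP; split; lra.
case/zono_cycle_gens => l l01 ->; apply/fixed_score.
pose m a b : R := if a == b then 2^-1 else if cycle_lt a b then l (a, b) else 1 - l (b, a).
have fm : fractional m.
  move=> a b; rewrite /m [b == a]eq_sym; case: eqVneq => [_|nab]; first by split; lra.
  rewrite (cycle_lt_total nab); have /andP[? ?] := l01 (a, b); have /andP[? ?] := l01 (b, a).
  by case: (cycle_lt b a) => /=; split; lra.
exists m => //; rewrite (score_zono_base fm); congr (_ + _); apply: eq_bigr => -[a b] _ /=.
rewrite /cycle_gen /=; case: ifP => [/and3P[_ _ ab]|]; last by rewrite map_mx0 !scaler0.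
by rewrite /m ab; case: eqP => // eab; rewrite eab cycle_ltnn in ab.
Qed.

(** The draws inside the cycle of i account for the first term, the only source of
denominators: an even cycle makes its coordinates half-integral. *)
Lemma zono_baseE i : zono_base 0 i =
  (#|cyc i|.+1)%:R / 2 + (\sum_(b in C | cycle_lt b (cyc i)) #|b|)%N%:R.
Proof.
rewrite mxE (sum_cyc_const (fun b => if cyc i == b then 2^-1 else (cycle_lt b (cyc i))%:R)).
rewrite (bigD1 (cyc i)) ?cyc_mem //= eqxx addrA; congr (_ + _); first by rewrite -natr1; lra.
rewrite natr_sum [LHS]big_mkcond [RHS]big_mkcond; apply: eq_bigr => b _ /=.
case: (b \in C) => //=; rewrite [cyc i == b]eq_sym; case: eqVneq => [->|_] /=.
  by rewrite cycle_ltnn.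
by case: (cycle_lt b _); rewrite ?mul1r ?mul0r.
Qed.

Lemma double_zono_base_integral : is_integral (2%:R *: zono_base).
Proof.
exists (\row_i (#|cyc i|.+1 + 2 * \sum_(b in C | cycle_lt b (cyc i)) #|b|)%N%:Z).
by apply/rowP => i; rewrite mxE zono_baseE !mxE -pmulrn natrD natrM; field.
Qed.

Lemma zono_base_integral : (forall a, a \in C -> odd #|a|) -> is_integral zono_base.
Proof.
move=> oddC; exists (\row_i ((#|cyc i|.+1)./2 + \sum_(b in C | cycle_lt b (cyc i)) #|b|)%N%:Z).
apply/rowP => i; rewrite zono_baseE !mxE -pmulrn natrD; congr (_ + _).
rewrite -[in LHS](odd_double_half #|cyc i|.+1) /= oddC ?cyc_mem //= add0n.
by rewrite -muln2 natrM mulfK // pnatr_eq0.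
Qed.

Lemma zono_base_not_int i (k : int) : ~~ odd #|cyc i| -> zono_base 0 i <> k%:~R.
Proof.
rewrite zono_baseE => ev /(congr1 ( *%R 2)).
rewrite mulrDr mulrCA mulfV ?pnatr_eq0 // mulr1 -natrM -natrD pmulrn -[2]/(2%:~R) -intrM.
by move/intr_inj; lia.
Qed.

Lemma dilate_zono t k d (x : 'rV[R]_d) (A : 'M[int]_(k, d)) :
  dilate t (zono x A) = zono (t%:R *: x) (t%:Z *: A).
Proof.
have scE : (t%:Z *: A)%:RM = t%:R *: A%:RM.
  by apply/matrixP => i j; rewrite !mxE intrM.
apply/seteqP; split=> y.
  by case=> _ [l l01 ->] <-; exists l => //; rewrite scE -scalemxAr scalerDr.
case=> l l01 ->; exists (x + l *m A%:RM); first by exists l.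
by rewrite scE -scalemxAr scalerDr.
Qed.

(** The fixed lattice points of the t-th dilate are the lattice points of the t-th
dilate of the fixed polytope. *)
Lemma ehrhart_zpoints t N : has_card (zpoints (t%:R *: zono_base) (t%:Z *: cycle_gens)) N ->
  ehrhart_char R t g = N.
Proof.
move=> h; apply: has_card_fset; apply: eq_has_card h => z.
rewrite /zpoints /lattice_points -dilate_zono -fixed_permutahedron_zono /=; split.
  case=> x [Px xg] xz; split; first by exists x.
  apply: (@intr_rV_inj R); rewrite map_mxM map_perm_mx -xz -scalemxAl.
  by rewrite xg.
(* For t = 0 the point x need not be fixed, and is replaced by one that is. *)
case=> -[x Px xz] zg; have [t0|t0] := posnP t.
  have [y Fy] : exists y, fixed_permutahedron R g y.
    rewrite fixed_permutahedron_zono; exists zono_base; exists 0; first by move=> i; rewrite mxE lexx ler01.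
    by rewrite mul0mx addr0.
  by exists y => //; rewrite -xz t0 !scale0r.
exists x => //; split=> //; apply: (@scalerI _ _ t%:R); first by rewrite pnatr_eq0 -lt0n.
by rewrite scalemxAl xz -(map_perm_mx (intr : int -> R)) -map_mxM zg.
Qed.

End Cycles.

(** * Determinants attached to a permutation *)

Section CyclePoly.
Variables (F : numFieldType) (n : nat) (g : 'S_n).

(** The matrix 1 - X P, for the permutation matrix P, with the rows outside S replaced
by those of the identity. *)
Definition cycle_mx (S : pred 'I_n) : 'M[{poly F}]_n :=
  \matrix_(i, j) ((i == j)%:R - (S i)%:R * 'X * (g i == j)%:R).

(** The matrix 1 - X P is a product of one factor per cycle. *)
Lemma cycle_mxU (S T : pred 'I_n) :
  (forall i, S i -> S (g i)) -> (forall i, S i -> ~~ T i) ->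
  cycle_mx [pred i | S i || T i] = cycle_mx S *m cycle_mx T.
Proof.
move=> Sg ST; apply/matrixP => i j; rewrite [RHS]mxE.
under eq_bigr do rewrite [cycle_mx S _ _]mxE mulrBl.
rewrite sumrB (bigD1 i) //= eqxx mul1r big1 ?addr0; last first.
  by move=> k ki; rewrite eq_sym (negPf ki) mul0r.
rewrite (bigD1 (g i)) //= eqxx mulr1 big1 ?addr0; last first.
  by move=> k ki; rewrite eq_sym (negPf ki) mulr0 mul0r.
rewrite !mxE /=; have [Si|nSi] := boolP (S i); last by rewrite /= !mul0r subr0.
rewrite (negPf (ST _ Si)) (negPf (ST _ (Sg _ Si))) /= !mul0r !subr0 !mul1r.
by [].
Qed.

(** The indicator of an invariant set is in the kernel at X = 1. *)
Lemma cycle_mx_root (a : pred 'I_n) i0 : a i0 -> (forall i, a (g i) = a i) ->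
  (\det (cycle_mx a)).[1] = 0.
Proof.
move=> ai0 ag; rewrite -[LHS]/(horner_eval 1 _) -det_map_mx -det_tr; apply/eqP/det0P.
exists (\row_i (a i)%:R).
  by apply/negP => /eqP/rowP/(_ i0); rewrite !mxE ai0; apply/eqP/oner_neq0.
apply/rowP => j; rewrite [LHS]mxE [RHS]mxE.
rewrite (eq_bigr (fun i => (a i)%:R * (i == j)%:R - (a i)%:R * ((a j)%:R * (g j == i)%:R))); last first.
  move=> i _; have E : horner_eval 1 (cycle_mx a j i) = (i == j)%:R - (a j)%:R * (g j == i)%:R.
    rewrite mxE /horner_eval eq_sym; case: (a j); case: (g j == i); case: (i == j);
    by rewrite /= !hornerE.
  by rewrite -mulrBr -E mxE [X in _ * X]mxE [X in _ * X]mxE.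
rewrite sumrB (bigD1 j) //= eqxx mulr1 big1 ?addr0; last first.
  by move=> k /negPf ->; rewrite mulr0.
rewrite (bigD1 (g j)) //= eqxx mulr1 big1 ?addr0; last first.
  by move=> k; rewrite eq_sym => /negPf ->; rewrite !mulr0.
by rewrite ag; case: (a j); rewrite ?mulr1 ?mulr0 subrr.
Qed.

(** In the Leibniz formula only the identity and the cycle itself contribute, so the
determinant is 1 + X^l or 1 - X^l; the sign is found at X = 1, where the
determinant vanishes. *)
Lemma det_cycle_mx (a : {set 'I_n}) : a \in porbits g ->
  \det (cycle_mx (mem a)) = 1 - 'X^#|a|.
Proof.
case/imsetP => i0 _ aE; pose A := cycle_mx (mem a).
have ag i : (g i \in a) = (i \in a).
  by rewrite aE -!eq_porbit_mem; have := porbit_perm g 1 i; rewrite expg1 => ->.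
have ai0 : i0 \in a by rewrite aE porbit_id.
have [a1|a1] := leqP #|a| 1.
  have E i : i \in a -> i = i0.
    move=> ia; apply: (card_le1_eqP (A := mem a)) => //.
  have -> : cycle_mx (mem a) = diag_mx (\row_i (if i == i0 then 1 - 'X else 1)).
    apply/matrixP => i j; rewrite !mxE /=.
    have [->|nii] := eqVneq i i0.
      rewrite ai0 mul1r (E (g i0)) ?ag //; case: (i0 == j); by rewrite ?mulr1 ?mulr0 ?subr0.
    have -> : (i \in a) = false by apply: contraNF nii => /E ->.
    by rewrite !mul0r subr0.
  rewrite det_diag (bigD1 i0) //= mxE eqxx big1 ?mulr1; last first.
    by move=> i /negPf h; rewrite mxE h.
  suff -> : #|a| = 1%N by rewrite expr1.
  by apply/eqP; rewrite eqn_leq a1; apply/card_gt0P; exists i0.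
have gi i : i \in a -> g i != i.
  move=> ia; apply/negP => /eqP gii; move: a1; rewrite ltnNge => /negP; apply.
  rewrite (_ : a = [set i]) ?cards1 //; apply/setP => k; rewrite inE.
  have -> : a = porbit g i by move: ia; rewrite aE -eq_porbit_mem => /eqP ->.
  apply/idP/eqP => [/porbitP[m ->]|->]; last exact: porbit_id.
  by elim: m => [|m IH]; rewrite ?expg0 ?perm1 // expgSr permM IH.
pose f i := if i \in a then g i else i.
have finj : injective f.
  move=> i j; rewrite /f; case: ifP => ia; case: ifP => ja; first exact: perm_inj.
  - by move=> gij; rewrite -gij ag ia in ja.
  - by move=> gij; rewrite gij ag ja in ia.
  - by [].
pose ga := perm finj.
have ga1 : ga != 1%g.
  apply/eqP => /permP/(_ i0); rewrite permE perm1 /f ai0 => /eqP; apply/negP; exact: gi.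
have detE : \det A = 1 + (-1) ^+ ga * (-1) ^+ #|a| * 'X^#|a|.
  rewrite /determinant (bigD1 1%g) //= (bigD1 ga) //= [X in _ + (_ + X)]big1; last first.
    move=> s /andP[s1 sga]; apply/eqP; rewrite mulf_eq0; apply/orP; right.
    apply: contraT => /prodf_neq0 H.
    have so i : i \notin a -> s i = i.
      move=> ia; have := H i isT; rewrite mxE /= (negPf ia) !mul0r subr0.
      by case: (eqVneq i (s i)) => [<- //|_]; rewrite /= eqxx.
    have si i : i \in a -> s i = i \/ s i = g i.
      move=> ia; have := H i isT; rewrite mxE /=; case: (eqVneq i (s i)); first by left.
      by move=> _; case: (eqVneq (g i) (s i)); [right|rewrite /= mulr0 subr0 eqxx].
    have [/existsP[i1 /andP[i1a /eqP si1]]|] := boolP [exists i, (i \in a) && (s i == i)].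
      case/eqP: s1; apply/permP => k; rewrite perm1.
      have [ka|/so //] := boolP (k \in a).
      have : k \in porbit g^-1 i1.
        by rewrite porbitV; move: i1a ka; rewrite aE -!eq_porbit_mem => /eqP -> ->.
      case/porbitP => m ->; elim: m => [|m IH]; first by rewrite expg0 perm1.
      rewrite expgSr permM; set u := ((g^-1 ^+ m)%g i1) in IH *.
      have [va|/so //] := boolP (g^-1%g u \in a).
      case: (si _ va) => // sv; move: sv; rewrite permKV -{2}IH => /perm_inj v.
      by move: (gi _ va); rewrite permKV v eqxx.
    rewrite negb_exists => /forallP nfix; case/eqP: sga; apply/permP => k; rewrite permE /f.
    case: ifP => ka; last by apply: so; rewrite ka.
    by case: (si _ ka) => // sk; move: (nfix k); rewrite ka sk eqxx.
  rewrite addr0; congr (_ + _).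
    rewrite odd_perm1 expr0 mul1r big1 // => i _; rewrite mxE perm1 eqxx /=.
    by have [/gi/negPf ->|_] := boolP (i \in a); rewrite ?mulr0 ?mul0r subr0.
  rewrite -mulrA; congr (_ * _); rewrite -exprMn.
  rewrite (bigID (mem a)) /= [X in _ * X]big1 ?mulr1; last first.
    by move=> i ia; rewrite mxE permE /f /= (negPf ia) eqxx /= !mul0r subr0.
  rewrite (eq_bigr (fun=> -1 * 'X)) ?prodr_const // => i ia.
  by rewrite mxE permE /f /= ia eqxx eq_sym (negPf (gi _ ia)) mul1r mulr1 sub0r mulN1r.
have := @cycle_mx_root (mem a) i0 ai0 ag; rewrite -/A detE -exprD.
rewrite -signr_odd; case: odd.
  by rewrite expr1 mulN1r.
by rewrite expr0 mul1r !hornerE expr1n => /eqP; rewrite -mulr2n pnatr_eq0.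
Qed.

Lemma det_perm_poly :
  \det (1%:M - 'X *: map_mx polyC (perm_mx g : 'M[F]_n)) = \prod_(a in porbits g) (1 - 'X^#|a|).
Proof.
have -> : 1%:M - 'X *: map_mx polyC (perm_mx g : 'M[F]_n) =
    cycle_mx [pred i | has (fun a : {set 'I_n} => i \in a) (enum (porbits g))].
  apply/matrixP => i j; rewrite !mxE /=.
  have -> : has (fun a : {set 'I_n} => i \in a) (enum (porbits g)).
    apply/hasP; exists (porbit g i); last exact: porbit_id.
    by rewrite mem_enum; apply: imset_f.
  by rewrite mul1r; congr (_ - _ * _); case: eqP.
rewrite -[RHS]big_enum /=.
have : {subset enum (porbits g) <= porbits g} by move=> a; rewrite mem_enum.
have : uniq (enum (porbits g)) by apply: enum_uniq.
elim: (enum (porbits g)) => [_ _|a s IH /= /andP[as_ us] sub].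
  rewrite big_nil -[RHS](@det1 _ n); congr (\det _); apply/matrixP => i j.
  by rewrite !mxE /= !mul0r subr0.
have aC : a \in porbits g by apply: sub; rewrite inE eqxx.
rewrite big_cons -(det_cycle_mx aC) -IH // => [|b bs]; last by apply: sub; rewrite inE bs orbT.
rewrite -det_mulmx -cycle_mxU //=.
  move=> i; case/imsetP: aC => k _ ->; rewrite -!eq_porbit_mem => /eqP <-.
  by have := porbit_perm g 1 i; rewrite expg1 => ->.
move=> i ia; apply/hasPn => b bs; apply: contraNN as_ => ib.
have bC : b \in porbits g by apply: sub; rewrite inE bs orbT.
suff -> : a = b by [].
case/imsetP: aC ia => k _ ->; case/imsetP: bC ib => l _ ->.
by rewrite -!eq_porbit_mem => /eqP -> /eqP ->.
Qed.

(** The cofactor D takes the product of the cycle lengths as its value at 1, since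
1 - X^l is 1 - X times a sum of l powers of X. *)
Lemma cycle_poly_factor : exists2 D : {poly F},
  \prod_(a in porbits g) (1 - 'X^#|a|) = (1 - 'X) ^+ #|porbits g| * D &
  D.[1] = (\prod_(a in porbits g) #|a|)%N%:R.
Proof.
exists (\prod_(a in porbits g) \sum_(i < #|a|) 'X^i).
  rewrite -prodr_const -big_split; apply: eq_bigr => a _ /=.
  by rewrite -[LHS]opprB subrX1 -mulNr opprB.
rewrite horner_prod natr_prod; apply: eq_bigr => a _.
rewrite horner_sum (eq_bigr (fun=> 1)) ?sumr_const ?card_ord // => i _.
by rewrite hornerXn expr1n.
Qed.

End CyclePoly.

Section DirectSum.
Variable F : fieldType.

Lemma det_similar k n (e : k = n) (S : 'M[F]_(k, n)) (f : 'M[F]_n) (D : 'M[F]_k) :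
  row_free S -> S *m f = D *m S ->
  \det (1%:M - 'X *: map_mx polyC f) = \det (1%:M - 'X *: map_mx polyC D).
Proof.
case: n / e S f => S f; rewrite row_free_unit => uS Sf.
have dS : \det (map_mx polyC S) != 0.
  by rewrite det_map_mx polyC_eq0 -unitfE -unitmxE.
apply: (mulfI dS); rewrite -det_mulmx mulrC -det_mulmx; congr (\det _).
rewrite mulmxBr mulmxBl mulmx1 mul1mx -scalemxAr -scalemxAl; congr (_ - _ *: _).
by rewrite -!map_mxM Sf.
Qed.

(** In a basis adapted to the decomposition the matrix is block diagonal. *)
Lemma det_stable_sum n (f U W : 'M[F]_n) : stablemx U f -> stablemx W f ->
  (U :&: W = 0)%MS -> (\rank U + \rank W = n)%N ->
  \det (1%:M - 'X *: map_mx polyC f) =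
  \det (1%:M - 'X *: map_mx polyC (restrictmx U f)) *
  \det (1%:M - 'X *: map_mx polyC (restrictmx W f)).
Proof.
move=> Uf Wf UW rUW.
have st V : stablemx V f -> row_base V *m f = restrictmx V f *m row_base V.
  by move=> Vf; rewrite /conjmx mulmxKpV // stablemx_row_base.
pose S := col_mx (row_base U) (row_base W).
rewrite (@det_similar _ _ rUW S f (block_mx (restrictmx U f) 0 0 (restrictmx W f))).
- rewrite map_block_mx !map_mx0 scale_block_mx !scaler0 scalar_mx_block.
  by rewrite opp_block_mx oppr0 add_block_mx !addr0 subr0 det_ublock.
- rewrite /row_free -addsmxE.
  have := mxrank_sum_cap (row_base U) (row_base W).
  rewrite !eq_row_base (_ : (row_base U :&: row_base W)%MS = 0); last first.
    by apply/eqP; rewrite -submx0 (cap_eqmx (eq_row_base _) (eq_row_base _)) UW submx0.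
  by rewrite mxrank0 addn0 => ->.
- by rewrite mul_col_mx mul_block_col !mul0mx addr0 add0r !st.
Qed.

Lemma det_on_fixed n (f U : 'M[F]_n) : (U <= eigenspace f 1)%MS ->
  \det (1%:M - 'X *: map_mx polyC (restrictmx U f)) = (1 - 'X) ^+ \rank U.
Proof.
move=> Uf; rewrite (@conjmx_eigenvalue _ _ _ 1) ?row_base_free ?eq_row_base //.
by rewrite map_scalar_mx /= scale_scalar_mx mulr1 -raddfB det_scalar.
Qed.

Lemma horner_det_sub1 n (f V : 'M[F]_n) :
  (\det (1%:M - 'X *: map_mx polyC (restrictmx V f))).[1] = \det (restrictmx V (1%:M - f)).
Proof.
rewrite -[LHS]/(horner_eval 1 _) -det_map_mx; congr (\det _).
rewrite /conjmx mulmxBr mulmxBl mulmx1 mulmxVp ?row_base_free //.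
set M := (X in map_mx polyC X); rewrite -/M; move: M => M; apply/matrixP => i j.
rewrite !mxE rmorphB rmorphM rmorph_nat /= /horner_eval hornerX hornerC mul1r.
by [].
Qed.

End DirectSum.

Section FixedSpace.
Variables (F : numFieldType) (n : nat) (g : 'S_n).

Definition ones : 'rV[F]_n := const_mx 1.

Lemma mul_ones (v : 'rV[F]_n) : v *m ones^T = (\sum_i v 0 i)%:M.
Proof.
apply/rowP => j; rewrite ord1 !mxE; apply: eq_bigr => i _.
by rewrite !mxE mulr1.
Qed.

Lemma MspaceP m (A : 'M[F]_(m, n)) : (A <= Mspace F n)%MS = (A *m ones^T == 0).
Proof. by rewrite /Mspace sub_kermx /ones trmx_const. Qed.

Lemma ones_fixed : (ones <= eigenspace (perm_mx g) 1)%MS.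
Proof.
apply/eigenspaceP; rewrite scale1r -[g]invgK -col_permE.
by apply/rowP => i; rewrite !mxE.
Qed.

Hypothesis n_gt0 : (0 < n)%N.

Lemma rank_ones : \rank ones = 1%N.
Proof.
rewrite rank_rV; case: eqP => // /rowP/(_ (Ordinal n_gt0)); rewrite !mxE.
by move/eqP; rewrite oner_eq0.
Qed.

Lemma ones_cap_Mspace m (A : 'M[F]_(m, n)) : (A <= Mspace F n)%MS -> (ones :&: A = 0)%MS.
Proof.
move=> AM; apply/eqP; rewrite -submx0; apply/rV_subP => v; rewrite sub_capmx => /andP[].
case/sub_rVP => c -> /submx_trans/(_ AM); rewrite MspaceP mul_ones.
rewrite (eq_bigr (fun=> c)) => [|i _]; last by rewrite !mxE mulr1.
rewrite sumr_const card_ord => /eqP/matrixP/(_ 0 0); rewrite !mxE mulr1n => /eqP.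
rewrite mulrn_eq0 => /orP[/eqP n0|/eqP ->]; first by exfalso; move: n_gt0; rewrite n0.
by rewrite scale0r sub0mx.
Qed.

Definition fix_basis : 'M[F]_(#|porbits g|, n) :=
  \matrix_(k < #|porbits g|, i < n) (i \in (enum_val k : {set 'I_n}))%:R.

Lemma fix_basis_free : row_free fix_basis.
Proof.
pose D : 'M[F]_(n, #|porbits g|) := \matrix_(i < n, k < #|porbits g|)
    ((i \in (enum_val k : {set 'I_n}))%:R / #|(enum_val k : {set 'I_n})|%:R).
apply/row_freeP; exists D; apply/matrixP => k l; rewrite !mxE.
have porbE (r : 'I_#|porbits g|) i : (i \in (enum_val r : {set 'I_n})) = (enum_val r == porbit g i).
  by case/imsetP: (enum_valP r) => j _ ->; rewrite eq_sym eq_porbit_mem.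
have pos (r : 'I_#|porbits g|) : #|(enum_val r : {set 'I_n})|%:R != 0 :> F.
  rewrite pnatr_eq0 -lt0n; case/imsetP: (enum_valP r) => j _ ->; apply/card_gt0P.
  by exists j; apply: porbit_id.
have [->|nkl] := eqVneq k l.
  rewrite (eq_bigr (fun i => if i \in (enum_val l : {set 'I_n})
    then #|(enum_val l : {set 'I_n})|%:R^-1 else 0)); last first.
    by move=> i _; rewrite !mxE; case: ifP; rewrite ?mul1r ?mul0r.
  by rewrite -big_mkcond sumr_const -[LHS]mulr_natl mulfV.
rewrite big1 // => i _; rewrite !mxE !porbE; case: eqP => [<-|_]; last by rewrite mul0r.
by rewrite (inj_eq enum_val_inj) eq_sym (negPf nkl) !mul0r mulr0.
Qed.

Lemma fix_basisE : (fix_basis :=: eigenspace (perm_mx g) 1)%MS.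
Proof.
apply/eqmxP/andP; split.
  apply/row_subP => k; apply/eigenspaceP; rewrite scale1r -[g in perm_mx g]invgK -col_permE.
  apply/rowP => i; rewrite !mxE; congr (_%:R); congr nat_of_bool.
  case/imsetP: (enum_valP k) => j _ ->; rewrite -!eq_porbit_mem.
  have := porbit_perm g 1 (g^-1%g i); rewrite expg1 permKV => ->.
  by [].
apply/rV_subP => v /eigenspaceP; rewrite scale1r => vg.
have vgi i : v 0 (g i) = v 0 i.
  by rewrite -{1}vg -[g in perm_mx g]invgK -col_permE mxE permK.
have vc i j : j \in porbit g i -> v 0 j = v 0 i.
  case/porbitP => k ->; elim: k => [|k IH]; first by rewrite expg0 perm1.
  by rewrite expgSr permM vgi.
have kP i : porbit g i \in porbits g by apply: imset_f.
have [rep repP] : exists rep : 'I_#|porbits g| -> 'I_n, forall k, rep k \in (enum_val k : {set 'I_n}).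
  have ex (k : 'I_#|porbits g|) : exists i, i \in (enum_val k : {set 'I_n}).
    by case/imsetP: (enum_valP k) => j _ ->; exists j; apply: porbit_id.
  by exists (fun k => xchoose (ex k)) => k; apply: xchooseP.
apply/submxP; exists (\row_k v 0 (rep k)); apply/rowP => i; rewrite mxE.
rewrite (bigD1 (enum_rank_in (kP i) (porbit g i))) //= !mxE enum_rankK_in //.
rewrite porbit_id mulr1 big1 ?addr0; last first.
  move=> k nk; rewrite !mxE; case: (boolP (i \in _)) => ik; last by rewrite mulr0.
  case/eqP: nk; apply: enum_val_inj; rewrite enum_rankK_in //.
  case/imsetP: (enum_valP k) ik => j _ ->; by rewrite -eq_porbit_mem => /eqP ->.
apply: esym; apply: vc.
by have := repP (enum_rank_in (kP i) (porbit g i)); rewrite enum_rankK_in.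
Qed.

Lemma rank_fix : \rank (eigenspace (perm_mx g : 'M[F]_n) 1) = #|porbits g|.
Proof. by rewrite -fix_basisE; apply/eqP/fix_basis_free. Qed.

(** An invariant vector is the sum of its mean and of an invariant vector of
coordinate sum 0. *)
Lemma fix_split : (ones + fixedM F g :=: eigenspace (perm_mx g) 1)%MS.
Proof.
apply/eqmxP/andP; split; first by rewrite addsmx_sub ones_fixed capmxSr.
apply/rV_subP => v vfix; pose c := (\sum_i v 0 i) / n%:R.
have -> : v = c *: ones + (v - c *: ones) by rewrite addrC subrK.
apply: addmx_sub_adds; first exact: scalemx_sub.
rewrite sub_capmx MspaceP; apply/andP; split; last first.
  by apply: addmx_sub => //; rewrite -scaleNr; apply: scalemx_sub; apply: ones_fixed.
rewrite mul_ones; apply/eqP; rewrite (_ : \sum_i _ = 0) ?raddf0 //.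
rewrite (eq_bigr (fun i => v 0 i - c)) => [|i _]; last by rewrite !mxE mulr1.
by rewrite sumrB sumr_const card_ord -mulr_natr divfK ?subrr // pnatr_eq0 -lt0n.
Qed.

Lemma rank_fixedM : #|porbits g| = (\rank (fixedM F g)).+1.
Proof.
rewrite -rank_fix -fix_split; have := mxrank_sum_cap ones (fixedM F g).
by rewrite (ones_cap_Mspace (capmxSl _ _)) mxrank0 addn0 rank_ones add1n.
Qed.

(** The whole space is the sum of M and of the line of constant vectors, on which the
permutation acts trivially. *)
Lemma det_rho :
  (1 - 'X) * \det (1%:M - 'X *: map_mx polyC (rho F g)) = \prod_(a in porbits g) (1 - 'X^#|a|).
Proof.
rewrite -det_perm_poly (@det_stable_sum _ _ _ <<ones>>%MS (Mspace F n)).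
- by rewrite det_on_fixed ?genmxE ?ones_fixed // rank_ones expr1.
- rewrite (eqmx_stable _ (genmxE _)).
  by have /eigenspaceP -> := ones_fixed; rewrite scale1r.
- exact: Mspace_stable.
- apply/eqP; rewrite -submx0 (cap_eqmx (genmxE _) (eqmx_refl _)).
  by rewrite (ones_cap_Mspace (submx_refl _)) submx0.
rewrite genmxE rank_ones mxrank_ker -mxrank_tr trmx_const -/ones rank_ones.
by rewrite add1n subn1 prednK.
Qed.

End FixedSpace.

Section Perp.
Variables (R : realFieldType) (n : nat) (g : 'S_n).
Hypothesis n_gt0 : (0 < n)%N.

Local Notation Fix := (eigenspace (perm_mx g : 'M[R]_n) 1).

(** The orthogonal complement of the fixed space inside M is also that of the full
fixed space, because the constant vectors are orthogonal to M. *)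
Lemma fixedM_perpE : (fixedM_perp R g :=: kermx Fix^T)%MS.
Proof.
apply/eqmxP/andP; split.
  rewrite sub_kermx -trmx_eq0 trmx_mul trmxK; apply/eqP.
  have : (Fix <= ones R n + fixedM R g)%MS by rewrite fix_split.
  case/sub_addsmxP => -[X Y] /= ->; rewrite mulmxDl -!mulmxA.
  have : (fixedM_perp R g <= Mspace R n)%MS by apply: capmxSl.
  rewrite MspaceP => /eqP h1.
  have : (fixedM_perp R g <= kermx (fixedM R g)^T)%MS by apply: capmxSr.
  move/sub_kermxP => h2.
  rewrite -[ones R n]trmxK -trmx_mul h1 trmx0 mulmx0 add0r.
  by rewrite -[fixedM R g]trmxK -trmx_mul h2 trmx0 mulmx0.
have kz m (A : 'M[R]_(m, n)) (B : 'M[R]_n) : (A <= B)%MS -> kermx B^T *m A^T = 0.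
  by case/submxP => X ->; rewrite trmx_mul mulmxA mulmx_ker mul0mx.
rewrite sub_capmx MspaceP; apply/andP; split; first by apply/eqP/kz/ones_fixed.
by apply/sub_kermxP/kz/capmxSr.
Qed.

Lemma fix_cap_perp : (Fix :&: fixedM_perp R g = 0)%MS.
Proof.
apply/eqP; rewrite -submx0; apply/rV_subP => v; rewrite sub_capmx => /andP[].
rewrite fixedM_perpE => /submxP[X vX] /sub_kermxP vk.
have : v *m v^T = 0 by rewrite {2}vX trmx_mul mulmxA vk mul0mx.
move/rowP/(_ 0); rewrite !mxE => /eqP.
rewrite psumr_eq0 => [/allP H|i _]; last by rewrite mxE -expr2 sqr_ge0.
rewrite submx0; apply/eqP/rowP => i; have := H i (mem_index_enum i).
by rewrite mxE -expr2 sqrf_eq0 mxE => /eqP.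
Qed.

Lemma perp_stable : stablemx (fixedM_perp R g) (perm_mx g).
Proof.
have PP : perm_mx g *m (perm_mx g)^T = 1%:M :> 'M[R]_n.
  by rewrite tr_perm_mx -perm_mxM mulgV perm_mx1.
rewrite (eqmx_stable _ fixedM_perpE) sub_kermx.
have /eigenspaceP := submx_refl Fix; rewrite scale1r.
move: Fix => B BP; apply/eqP.
rewrite -{2}BP trmx_mul -mulmxA (mulmxA (perm_mx g)) PP mul1mx; exact: mulmx_ker.
Qed.

(** The characteristic determinant of the permutation splits along its fixed space
and the orthogonal complement; the fixed space accounts for the power of 1 - X, and
the remaining cofactor is evaluated at X = 1. *)
Lemma det_perpE : det_perp R g = (\prod_(a in porbits g) #|a|)%N%:R.
Proof.
have [D DE D1] := cycle_poly_factor R g.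
rewrite -D1 /det_perp -horner_det_sub1; congr (_.[1]).
have X1 : (1 - 'X : {poly R}) ^+ #|porbits g| != 0.
  by rewrite expf_neq0 // -opprB oppr_eq0 polyXsubC_eq0.
apply: (mulfI X1); rewrite -DE -det_perm_poly -(@rank_fix R).
rewrite (@det_stable_sum _ _ _ Fix (fixedM_perp R g)).
- by rewrite (det_on_fixed (submx_refl Fix)).
- by apply: comm_mx_stable_eigenspace.
- exact: perp_stable.
- exact: fix_cap_perp.
- by rewrite fixedM_perpE mxrank_ker mxrank_tr subnKC // rank_leq_row.
Qed.

End Perp.

(** * Lattice frames and the Ehrhart quasi-polynomial *)

Section Frames.
Local Open Scope classical_set_scope.
Variable R : realType.
Local Notation "A %:RM" := (map_mx (intr : int -> R) A) (at level 2, format "A %:RM").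

Lemma affine_mapP d n (p : 'rV[R]_n) (B : 'M[R]_(d, n)) y :
  range (affine_map p B) y <-> (y - p <= B)%MS.
Proof.
split; first by case=> c _ <-; rewrite /affine_map addrC addKr submxMl.
by case/submxP => c cE; exists c => //; rewrite /affine_map -cE addrC subrK.
Qed.

Lemma affine_span_zono k n (x : 'rV[R]_n) (A : 'M[int]_(k, n)) y :
  affine_span (zono x A) y <-> (y - x <= A%:RM)%MS.
Proof.
split.
  case=> m [p [w [pP w1 ->]]].
  have -> : \sum_i w i *: p i - x = \sum_i w i *: (p i - x).
    rewrite [RHS](eq_bigr (fun i => w i *: p i - w i *: x)) => [|i _]; last by rewrite scalerBr.
    by rewrite sumrB -scaler_suml w1 scale1r.
  apply: summx_sub => i _; apply: scalemx_sub; have [l _ ->] := pP i.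
  by rewrite addrC addKr submxMl.
case/submxP => u uE.
pose p (i : 'I_k.+1) := if unlift ord0 i is Some j then x + row j (A%:RM) else x.
pose w (i : 'I_k.+1) := if unlift ord0 i is Some j then u 0 j else 1 - \sum_j u 0 j.
exists k.+1, p, w; split.
- move=> i; rewrite /p; case: unliftP => [j _|_].
    exists (delta_mx 0 j); last by rewrite rowE.
    by move=> l; rewrite mxE eqxx /=; case: (l == j); rewrite /= ?lexx ?ler01.
  by exists 0; [move=> l; rewrite mxE lexx ler01 | rewrite mul0mx addr0].
- rewrite big_ord_recl /w unlift_none [X in _ + X](eq_bigr (fun j => u 0 j)) ?subrK // => j _.
  by rewrite liftK.
rewrite big_ord_recl /w /p unlift_none.
rewrite [X in _ = _ + X](eq_bigr (fun j => u 0 j *: x + u 0 j *: row j (A%:RM))); last first.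
  by move=> j _; rewrite liftK scalerDr.
rewrite big_split /= -scaler_suml addrA -scalerDl subrK scale1r.
by rewrite -mulmx_sum_row -uE addrC subrK.
Qed.

Lemma frame_direction k d n (x p : 'rV[R]_n) (A : 'M[int]_(k, n)) (B : 'M[R]_(d, n)) :
  affine_span (zono x A) = range (affine_map p B) ->
  (A%:RM :=: B)%MS /\ (x - p <= B)%MS.
Proof.
move=> E; have EP y : (y - x <= A%:RM)%MS <-> (y - p <= B)%MS.
  by rewrite -affine_span_zono -affine_mapP E.
have xp : (x - p <= B)%MS by apply/EP; rewrite subrr sub0mx.
split=> //; apply/eqmxP/andP; split; apply/rV_subP => v vs.
  have : (v + x - p <= B)%MS by apply/EP; rewrite addrK.
  by rewrite -addrA; move=> h; rewrite -[v](addrK (x - p)) addmx_sub // -scaleN1r scalemx_sub.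
have : (v + x - x <= A%:RM)%MS by apply/EP; rewrite -addrA addmx_sub.
by rewrite addrK.
Qed.

Lemma affine_dim_zono k n (x : 'rV[R]_n) (A : 'M[int]_(k, n)) :
  affine_dim (zono x A) = \rank (A%:RM).
Proof.
rewrite /affine_dim; set S := [set d | _].
have : S (xget 0%N S).
  apply: xgetPex; exists (\rank (A%:RM)), x, (row_base (A%:RM)).
  split; first exact: row_base_free.
  apply/seteqP; split=> y.
    by move/affine_span_zono => h; apply/affine_mapP; rewrite eq_row_base.
  by move/affine_mapP; rewrite eq_row_base => h; apply/affine_span_zono.
case=> p [B [fB /frame_direction[AB _]]].
by rewrite AB; apply/esym/eqP.
Qed.

(** The rows of the Smith transformation G that belong to nonzero invariant factors.
A right inverse over the integers expresses that they form a basis of all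
integer points of their span. *)
Lemma saturated_basis k n (A : 'M[int]_(k, n)) : exists d (B : 'M[int]_(d, n)) (D : 'M[int]_(n, d)),
  B *m D = 1%:M /\ (A%:RM :=: B%:RM)%MS.
Proof.
have [L uL [G uG [dd _ AE]]] := int_Smith_normal_form A.
pose I := [set i : 'I_n | (i < k)%N && (dd`_i != 0)]%SET.
pose ev (r : 'I_#|I|) : 'I_n := enum_val r.
pose B := rowsub ev G; pose D := colsub ev (invmx G).
have unitR m (M : 'M[int]_m) : M \in unitmx -> M%:RM \in unitmx.
  move=> uM; have /mulmx1_unit[] // : M%:RM *m (invmx M)%:RM = 1%:M.
  by rewrite -map_mxM mulmxV // map_scalar_mx.
exists #|I|, B, D; split.
  rewrite mul_rowsub_mx /D mulmx_colsub mulmxV //; apply/matrixP => i j.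
  by rewrite !mxE (inj_eq enum_val_inj).
set M := \matrix_(i, j) _ in AE.
have rowM i j : (row i M *m G) 0 j = if insub (val i) is Some i' then dd`_i * G i' j else 0.
  rewrite mxE; case: insubP => [i' _ ii'|].
    rewrite (bigD1 i') //= !mxE ii' eqxx mulr1n big1 ?addr0 // => l li.
    rewrite !mxE (_ : (i == l :> nat) = false) ?mulr0n ?mul0r //.
    by rewrite -ii'; apply/negbTE; rewrite eq_sym.
  rewrite -leqNgt => ni; rewrite big1 // => l _; rewrite !mxE.
  rewrite (_ : (i == l :> nat) = false) ?mulr0n ?mul0r //.
  by apply/negbTE; rewrite neq_ltn orbC (leq_trans (ltn_ord l)).
have AMG : (A%:RM :=: (M *m G)%:RM)%MS.
  rewrite AE -mulmxA map_mxM; apply: eqmxMfull.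
  by rewrite row_full_unit unitR.
apply: (eqmx_trans AMG); apply/eqmxP/andP; split; apply/row_subP => r.
  rewrite -map_row row_mul.
  case ii: (insub (val r) : option 'I_n) => [i'|]; last first.
    rewrite (_ : row r M *m G = 0) ?map_mx0 ?sub0mx //.
    by apply/rowP => j; rewrite rowM ii mxE.
  have ri' : val i' = val r by move: ii; case: insubP => // u _ uE [<-].
  have E : row r M *m G = dd`_r *: row i' G.
    by apply/rowP => j; rewrite rowM ii !mxE.
  rewrite E; have [->|d0] := eqVneq (dd`_r) 0; first by rewrite scale0r map_mx0 sub0mx.
  have iI : i' \in I by rewrite inE ri' ltn_ord.
  rewrite map_mxZ; apply: scalemx_sub.
  have -> : row i' G = row (enum_rank_in iI i') B.
    by apply/rowP => j; rewrite !mxE /ev enum_rankK_in.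
  by rewrite map_row row_sub.
have := enum_valP r; rewrite inE => /andP[rk d0].
have -> : row r (B%:RM) = (dd`_(ev r))%:~R^-1 *: row (Ordinal rk) ((M *m G)%:RM).
  apply/rowP => j; rewrite [LHS]mxE [LHS]mxE [B r j]mxE [RHS]mxE [X in _ * X]mxE [X in _ * X]mxE.
  have -> : (M *m G) (Ordinal rk) j = dd`_(ev r) * G (ev r) j.
    have := rowM (Ordinal rk) j; rewrite -row_mul mxE => ->.
    by rewrite insubT //= => h; congr (_ * G _ _); apply: val_inj.
  by rewrite intrM mulKf // intr_eq0.
by rewrite scalemx_sub // row_sub.
Qed.

Lemma saturated_mem d n (B : 'M[int]_(d, n)) (D : 'M[int]_(n, d)) (z : 'rV[int]_n) :
  B *m D = 1%:M -> (z%:RM <= B%:RM)%MS -> exists c : 'rV[int]_d, z = c *m B.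
Proof.
move=> BD /submxP[c zc]; exists (z *m D); apply: (@intr_rV_inj R).
rewrite !map_mxM zc -!mulmxA (mulmxA (B%:RM)) -map_mxM BD map_scalar_mx.
by rewrite mul1mx.
Qed.

Section SaturatedBasis.
Variables (n d : nat) (B : 'M[int]_(d, n)).
Hypothesis freeB : row_free (B%:RM).
Hypothesis satB : forall z : 'rV[int]_n, (z%:RM <= B%:RM)%MS -> exists c : 'rV[int]_d, z = c *m B.

(** The affine map z0 + y B is a bijection between the lattice points in frame
coordinates and those in the ambient space. *)
Lemma zpoints_frame k (c : 'rV[R]_d) (W : 'M[int]_(k, d)) (z0 : 'rV[int]_n) N :
  has_card (zpoints c W) N -> has_card (zpoints (z0%:RM + c *m B%:RM) (W *m B)) N.
Proof.
have injB : injective (fun y : 'rV[int]_d => z0 + y *m B).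
  move=> y y' /addrI yy; apply: (@intr_rV_inj R); apply: (row_free_inj freeB).
  by rewrite -!map_mxM yy.
case=> s [us sN sP]; exists (map (fun y => z0 + y *m B) s); split.
- by rewrite map_inj_uniq.
- by rewrite size_map.
move=> z; split.
  case=> l l01 zE.
  have E : z%:RM - z0%:RM = (c + l *m W%:RM) *m B%:RM.
    by rewrite zE map_mxM mulmxDl mulmxA addrC -addrA addKr.
  have [y yE] : exists y : 'rV[int]_d, z - z0 = y *m B.
    by apply: satB; rewrite map_mxB E submxMl.
  have -> : z = z0 + y *m B by rewrite -yE addrC subrK.
  apply/mapP; exists y => //; apply/sP; exists l => //; apply: (row_free_inj freeB).
  by rewrite -map_mxM -yE map_mxB E.
case/mapP => y /sP[l l01 yE] ->; exists l => //.
by rewrite map_mxD map_mxM yE map_mxM mulmxDl mulmxA addrA.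
Qed.

Lemma zpoints_frame_none k (x : 'rV[R]_n) (A : 'M[int]_(k, n)) :
  (A%:RM <= B%:RM)%MS -> (forall z : 'rV[int]_n, ~ (z%:RM - x <= B%:RM)%MS) ->
  has_card (zpoints x A) 0.
Proof.
move=> AB nz; apply: has_card0 => z [l _ zE]; apply: (nz z).
by rewrite zE addrC addKr; apply: submx_trans AB; apply: submxMl.
Qed.

Lemma frame_coords k (A : 'M[int]_(k, n)) : (A%:RM <= B%:RM)%MS ->
  exists W : 'M[int]_(k, d), A = W *m B.
Proof.
move=> AB; have ex i : exists c : 'rV[int]_d, row i A = c *m B.
  by apply: satB; rewrite map_row; apply: submx_trans AB; apply: row_sub.
have [f fE] := choice ex; exists (\matrix_i f i).
by apply/row_matrixP => i; rewrite row_mul rowK fE.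
Qed.

End SaturatedBasis.
End Frames.

Section Ehrhart.
Local Open Scope classical_set_scope.
Variables (R : realType) (n : nat) (g : 'S_n).
Local Notation "A %:RM" := (map_mx (intr : int -> R) A) (at level 2, format "A %:RM").
Local Notation C := (porbits g).
Local Notation x0 := (zono_base R g).
Local Notation V := (cycle_gens g).

(** The generators span the vectors of coordinate sum 0 that are constant on cycles:
such a vector is a combination of the cycle vectors of all pairs (a, a0), for a
fixed cycle a0. *)
Lemma rank_cycle_gens : (0 < n)%N -> (#|C|).-1 = \rank (V%:RM).
Proof.
move=> n_gt0; rewrite (rank_fixedM R g n_gt0) /=.
have gen_row (p : {set 'I_n} * {set 'I_n}) : ((cycle_gen g p)%:RM <= V%:RM)%MS.
  have -> : (cycle_gen g p)%:RM = row (enum_rank p) (V%:RM).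
    by apply/rowP => i; rewrite !mxE enum_rankK.
  exact: row_sub.
have cycle_vector_row a b : a \in C -> b \in C -> ((cycle_vector a b)%:RM <= V%:RM)%MS.
  move=> aC bC; have [ab|] := boolP (cycle_lt a b).
    by have := gen_row (a, b); rewrite /cycle_gen /= aC bC ab.
  have [->|nab] := eqVneq a b.
    by rewrite /cycle_vector subrr map_mx0 sub0mx.
  rewrite (cycle_lt_total nab) negbK => ba; have := gen_row (b, a).
  rewrite /cycle_gen /= aC bC ba /= => h.
  have -> : (cycle_vector a b)%:RM = -1 *: (cycle_vector b a)%:RM.
    by rewrite scaleN1r -map_mxN /cycle_vector opprB.
  exact: scalemx_sub.
apply: eqmx_rank; apply/andP; split.
  apply/rV_subP => v; rewrite /fixedM sub_capmx MspaceP => /andP[v1 /eigenspaceP]; rewrite scale1r => vg.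
  have {v1} v1 : \sum_i v 0 i = 0.
    by move: v1; rewrite mul_ones => /eqP/matrixP/(_ 0 0); rewrite !mxE mulr1n.
  pose y (a : {set 'I_n}) : R := if [pick i in a] is Some i then v 0 i else 0.
  have yE i : y (porbit g i) = v 0 i.
    rewrite /y; case: pickP => [j jc|/(_ i)]; last by rewrite porbit_id.
    exact: perm_fix_cyc vg jc.
  pose a0 := porbit g (Ordinal n_gt0); have a0C : a0 \in C by apply: cyc_mem.
  have l0 : #|a0|%:R != 0 :> R by rewrite pnatr_eq0 -lt0n (cyc_gt0 a0C).
  have -> : v = \sum_(a in C) (y a / #|a0|%:R) *: (cycle_vector a a0)%:RM.
    apply/rowP => i; rewrite summxE.
    rewrite (eq_bigr (fun a => y a * (a == porbit g i)%:R
       - (i \in a0)%:R / #|a0|%:R * (y a * #|a|%:R))); last first.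
      move=> a aC; rewrite !mxE rmorphB !rmorphM /= (mem_cycle i aC).
      rewrite -[(#|a0|%:Z)%:~R]/(#|a0|%:R) -[(#|a|%:Z)%:~R]/(#|a|%:R).
      by case: (a == _); case: (i \in a0); rewrite /=; field.
    rewrite sumrB -mulr_sumr -sum_cyc_const.
    rewrite [X in _ - _ * X](eq_bigr (v 0)) ?v1 ?mulr0 ?subr0 //.
    rewrite (bigD1 (porbit g i)) ?cyc_mem //= eqxx mulr1 big1 ?addr0 ?yE //.
    by move=> a /andP[_ /negPf ->]; rewrite mulr0.
  by apply: summx_sub => a aC; apply: scalemx_sub; apply: cycle_vector_row.
apply/row_subP => r; rewrite -map_row.
have -> : row r V = cycle_gen g (enum_val r) by apply/rowP => i; rewrite !mxE.
rewrite /cycle_gen; case: ifP => [|_]; last by rewrite map_mx0 sub0mx.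
case/and3P; move: (enum_val r).1 (enum_val r).2 => a b aC bC _.
rewrite sub_capmx MspaceP; apply/andP; split.
  rewrite mul_ones (_ : \sum_i _ = 0) ?raddf0 //.
  have sumind (c : {set 'I_n}) : \sum_i (i \in c)%:R = #|c|%:R :> R.
    by rewrite -sum1_card natr_sum [RHS]big_mkcond; apply: eq_bigr => i _; case: (i \in c).
  rewrite (eq_bigr (fun i => #|b|%:R * (i \in a)%:R - #|a|%:R * (i \in b)%:R)); last first.
    move=> i _; rewrite !mxE rmorphB !rmorphM /=; congr (_ * _ - _ * _).
      by case: (i \in a).
    by case: (i \in b).
  by rewrite sumrB -!mulr_sumr !sumind mulrC subrr.
apply/eigenspaceP; rewrite scale1r; apply/perm_fixP => i; rewrite !mxE.
by rewrite !(mem_cycle _ aC) !(mem_cycle _ bC) cyc_perm.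
Qed.

Definition span_has_integer_point := exists z : 'rV[int]_n, (z%:RM - x0 <= V%:RM)%MS.

Lemma scale_cycle_gens t : (0 < t)%N -> ((t%:Z *: V)%:RM :=: V%:RM)%MS.
Proof.
move=> t0; rewrite (_ : _%:RM = t%:R *: V%:RM); last first.
  by apply/matrixP => i j; rewrite !mxE intrM.
by apply: eqmx_scale; rewrite pnatr_eq0 -lt0n.
Qed.

(** The index is at most 2 because twice the base point is integral. *)
Lemma lattice_indexE : lattice_index (fixed_permutahedron R g) =
  if `[< span_has_integer_point >] then 1%N else 2%N.
Proof.
rewrite fixed_permutahedron_zono.
pose meets k := lattice_points (affine_span (dilate k (zono x0 V))) !=set0.
have mE k : (0 < k)%N -> meets k <-> exists z : 'rV[int]_n, (z%:RM - k%:R *: x0 <= V%:RM)%MS.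
  move=> k0; rewrite /meets dilate_zono; split=> -[z zP]; exists z.
    by move/affine_span_zono: zP; rewrite scale_cycle_gens.
  by apply/affine_span_zono; rewrite scale_cycle_gens.
have m1 : meets 1%N <-> span_has_integer_point by rewrite mE // scale1r.
have m2 : meets 2%N.
  by apply/mE => //; have [z zE] := double_zono_base_integral R g; exists z; rewrite -zE subrr sub0mx.
rewrite /lattice_index -/meets; set S := [set k | _].
have : S (xget 0%N S).
  apply: xgetPex; case: (pselect (meets 1%N)) => h1.
    by exists 1%N; split.
  exists 2%N; split=> // j j0 mj; case: j j0 mj => [|[|j]] //.
case=> k0 mk kmin; case: asboolP => [/m1 h1|h1].
  by apply/eqP; rewrite eqn_leq k0 andbT kmin.
have := kmin 2%N isT m2; case: (xget 0%N S) k0 mk => [|[|[|k]]] // _ /m1 //.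
Qed.

(** Twice the base point x0 is integral, so modulo integral translations the t-th
dilate of the fixed polytope is the zonotope with generators dilated by t and
base point 0 or x0, according to the parity of t. If the affine span of the
polytope has an integer point, then x0 can be moved into the frame, and both counts
have the same top coefficient L, the volume; otherwise there are no points for odd
t. The frame is whichever one defines the normalized volume. *)
Lemma ehrhart_quasi : exists d L (a0 a1 : nat -> nat),
  [/\ d = \rank (V%:RM), normalized_volume (fixed_permutahedron R g) = L%:R%:E,
      a0 d = L /\ a1 d = (if `[< span_has_integer_point >] then L else 0%N),
      is_integral x0 -> a0 = a1 &
      forall t, ehrhart_char R t g = (\sum_(j < d.+1) (if odd t then a1 j else a0 j) * t ^ j)%N].
Proof.
rewrite fixed_permutahedron_zono /normalized_volume; set S := [set v | _].
have : S (xget 0%E S).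
  apply: xgetPex; have [d [B [D [BD VB]]]] := saturated_basis R V.
  exists (lebesgue_rV (zono x0 V \o affine_map x0 (B%:RM))), d, x0, B; split=> //.
  split.
  - by apply/row_freeP; exists (D%:RM); rewrite -map_mxM BD map_scalar_mx.
  - apply/seteqP; split=> y.
      by move/affine_span_zono; rewrite VB => h; apply/affine_mapP.
    by move/affine_mapP; rewrite -VB => h; apply/affine_span_zono.
  - by move=> z; apply: saturated_mem BD.
case=> d [p [B [[freeB spanB satB] volE]]].
have [VB xpB] := frame_direction spanB.
have VsubB : (V%:RM <= B%:RM)%MS by rewrite VB.
have [W WE] := frame_coords satB VsubB.
have [L HL] := poly_growth_exists R W.
have dE : d = \rank (V%:RM) by rewrite VB; apply/esym/eqP.
have fullW : row_full (W%:RM).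
  rewrite /row_full eqn_leq rank_leq_col /= {1}dE WE map_mxM.
  exact: mxrankM_maxl.
have [c0 c0E] : exists c0 : 'rV[R]_d, x0 - p = c0 *m B%:RM.
  by case/submxP: xpB => c0 ->; exists c0.
have volL : xget 0%E S = L%:R%:E.
  rewrite volE -(zono_volume c0 fullW HL); congr (lebesgue_rV _).
  apply/seteqP; split=> c.
    case=> l l01; rewrite /affine_map => cE; exists l => //.
    apply: (row_free_inj freeB); rewrite mulmxDl -c0E -mulmxA -map_mxM -WE.
    by rewrite addrAC -cE addrC addKr.
  case=> l l01 ->; exists l => //; rewrite /affine_map WE map_mxM mulmxA mulmxDl addrA.
  by rewrite -c0E [p + _]addrC subrK.
have [Cb HC] := HL; have [a0 [a0L _ Ha0]] := HC 0.
have [z2 z2E] := double_zono_base_integral R g.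
have tE t : t%:R *: x0 = (z2 *+ t./2)%:RM + (odd t)%:R *: x0.
  rewrite -{1}(odd_double_half t) natrD scalerDl addrC; congr (_ + _).
  rewrite -muln2 natrM -scalerA z2E scaler_nat.
  by apply/rowP => i; rewrite mulmxnE !mxE mulmxnE rmorphMn.
have even_case t : ~~ odd t ->
    has_card (zpoints (t%:R *: x0) (t%:Z *: V)) (\sum_(j < d.+1) a0 j * t ^ j)%N.
  move=> /negPf ot; rewrite tE ot scale0r addr0.
  have := zpoints_frame freeB satB (z2 *+ t./2) (Ha0 t).
  by rewrite mul0mx addr0 -scalemxAl -WE.
have [m1|m1] := pselect span_has_integer_point; last first.
  exists d, L, a0, (fun=> 0%N); split=> //.
  - by rewrite (asboolF m1).
  - by case=> z zE; case: m1; exists z; rewrite -zE subrr sub0mx.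
  move=> t; apply: ehrhart_zpoints; have [ot|ot] := boolP (odd t); last exact: even_case.
  rewrite big1 => [|j _]; last by rewrite mul0n.
  apply: (@zpoints_frame_none _ _ _ B); first by rewrite scale_cycle_gens //; case: t ot.
  move=> z; rewrite tE ot scale1r opprD addrA -map_mxB -VB => h.
  by apply: m1; exists (z - z2 *+ t./2).
(* The choice c1 = 0 for an integral x0 makes the two counting polynomials equal. *)
have [z1 [c1 [c1E c1i]]] : exists z1 c1, x0 = z1%:RM + c1 *m B%:RM /\ (is_integral x0 -> c1 = 0).
  have [[z zE]|nint] := pselect (is_integral x0).
    by exists z, 0; rewrite mul0mx addr0.
  case: m1 => z; rewrite VB => /submxP[c cE]; exists z, (- c); split=> // .
  by rewrite mulNmx -cE opprB addrC subrK.
have [a1 [a1L Ha1] a1i] : exists2 a1 : nat -> nat, a1 d = L /\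
    forall t : nat, has_card (zpoints c1 (t%:Z *: W)) (\sum_(j < d.+1) a1 j * t ^ j)%N &
    (is_integral x0 -> a0 = a1).
  have [i0|ni] := pselect (is_integral x0); first by exists a0 => //; rewrite (c1i i0).
  by have [a [aL _ Ha]] := HC c1; exists a.
exists d, L, a0, a1; split=> //; first by rewrite (asboolT m1).
move=> t; apply: ehrhart_zpoints; have [ot|ot] := boolP (odd t); last exact: even_case.
have := zpoints_frame freeB satB (z2 *+ t./2 + z1) (Ha1 t).
by rewrite tE ot scale1r [in X in _ -> X]c1E addrA -map_mxD -scalemxAl -WE.
Qed.

End Ehrhart.

(** * The value of the equivariant series at 1 *)

Section ValueAtOne.
Variables (R : realType) (n : nat).
Hypothesis n_gt0 : (0 < n)%N.

Lemma HstarE i (g : 'S_n) : Hstar R n i g =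
  convol (Hstar_denom g) (fun t => (ehrhart_char R t g)%:R) i.
Proof. by rewrite cfunElock. Qed.

Lemma Hstar_denomE (g : 'S_n) : Hstar_denom g = \prod_(a in porbits g) (1 - 'X^#|a|).
Proof. exact: det_rho. Qed.

(** A and B are half the sum and half the difference of the counting polynomials for
even and for odd t. The top coefficient of A is L if the index is 1, and L / 2 if
the index is 2 and the odd counts vanish. *)
Lemma ehrhart_altpoly (g : 'S_n) : exists d (A B : {poly algC}) L,
  [/\ #|porbits g| = d.+1, d = \rank (map_mx (intr : int -> R) (cycle_gens g)),
      normalized_volume (fixed_permutahedron R g) = L%:R%:E,
      A`_d = L%:R / (lattice_index (fixed_permutahedron R g))%:R &
      [/\ (size A <= d.+1)%N, (size B <= d.+1)%N, is_integral (zono_base R g) -> B = 0 &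
      forall t, (ehrhart_char R t g)%:R = altpoly A B t]].
Proof.
have [d [L [a0 [a1 [dE volE [a0d a1d] a01 Ea]]]]] := ehrhart_quasi R g.
pose A : {poly algC} := \poly_(j < d.+1) (((a0 j)%:R + (a1 j)%:R) / 2).
pose B : {poly algC} := \poly_(j < d.+1) (((a0 j)%:R - (a1 j)%:R) / 2).
exists d, A, B, L; split=> //.
- rewrite dE -rank_cycle_gens // prednK //.
  by apply/card_gt0P; exists (porbit g (Ordinal n_gt0)); apply: cyc_mem.
- rewrite coef_poly ltnSn a0d a1d lattice_indexE.
  by case: asboolP => _; rewrite ?addr0 ?divr1 //; field.
split; [exact: size_poly|exact: size_poly| |].
  move=> /a01 a01E; apply/polyP => j; rewrite coef_poly coef0; case: ifP => // _.
  by rewrite a01E subrr mul0r.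
move=> t; rewrite Ea /altpoly !horner_poly natr_sum mulr_sumr -big_split.
apply: eq_bigr => j _ /=; rewrite natrM natrX -signr_odd.
by case: (odd t); rewrite ?expr1 ?expr0; field.
Qed.

Lemma Hstar_value (g : 'S_n) d (A B : {poly algC}) : #|porbits g| = d.+1 ->
  (size A <= d.+1)%N -> (size B <= d.+1)%N ->
  (forall t, (ehrhart_char R t g)%:R = altpoly A B t) ->
  exists2 P : {poly algC}, forall i, P`_i = convol ((1 + 'X) ^+ d.+1) (fun i => Hstar R n i g) i &
    P.[1] = 2%:R ^+ d.+1 * ((\prod_(a in porbits g) #|a|)%N%:R * (d`!%:R * A`_d)).
Proof.
move=> mE sA sB EE; have [D DE D1] := cycle_poly_factor algC g.
have [P HP P1] := series_altpoly D sA sB.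
exists P; last by rewrite P1 D1.
move=> i; rewrite HP; apply: eq_convol => j; rewrite HstarE Hstar_denomE DE mE.
by apply: eq_convol => k; rewrite EE.
Qed.

Lemma Hstar_at1_value (g : 'S_n) d (A B : {poly algC}) : #|porbits g| = d.+1 ->
  (size A <= d.+1)%N -> (size B <= d.+1)%N ->
  (forall t, (ehrhart_char R t g)%:R = altpoly A B t) ->
  Hstar_at1 R g ((\prod_(a in porbits g) #|a|)%N%:R * (d`!%:R * A`_d)).
Proof.
move=> mE sA sB EE; have [P HP P1] := Hstar_value mE sA sB EE.
exists P, ((1 + 'X) ^+ d.+1); have h2 : ((1 + 'X : {poly algC}) ^+ d.+1).[1] = 2%:R ^+ d.+1.
  by rewrite horner_exp !hornerE.
have n2 : 2%:R ^+ d.+1 != 0 :> algC by rewrite expf_neq0 // pnatr_eq0.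
rewrite h2; split=> //.
by rewrite P1 mulrAC mulfV // mul1r.
Qed.

(** Both sides are the product of d!, the volume, and the cycle lengths, divided by the
index. If the index is 2 then the base point is not integral, so some cycle has
even length and the division is exact. *)
Lemma Hstar_at1_volume (g : 'S_n) : exists m : nat,
  Hstar_at1 R g m%:R /\
  (((affine_dim (fixed_permutahedron R g))`!%:R)%:E
     * normalized_volume (fixed_permutahedron R g)
     * (det_perp R g)%:E
     * ((lattice_index (fixed_permutahedron R g))%:R^-1)%:E
   = m%:R%:E)%E.
Proof.
have [d [A [B [L [mE dE volE AE [sA sB _ EE]]]]]] := ehrhart_altpoly g.
have := Hstar_at1_value mE sA sB EE; rewrite AE.
have -> : affine_dim (fixed_permutahedron R g) = d.
  by rewrite fixed_permutahedron_zono affine_dim_zono dE.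
rewrite volE det_perpE //; move: (lattice_indexE R g).
set ix := lattice_index _; move=> ixE.
set p := (\prod_(a in porbits g) #|a|)%N.
have ix0 : (0 < ix)%N by rewrite ixE; case: asboolP.
have ixp : (ix %| p)%N.
  rewrite ixE; case: asboolP => // m1; rewrite dvdn2; apply/negP => op; apply: m1.
  have [z zE] : is_integral (zono_base R g).
    apply: zono_base_integral => a aC; move: op; rewrite /p (bigD1 a) //= oddM => /andP[] //.
  by exists z; rewrite -zE subrr sub0mx.
pose m := (d`! * L * (p %/ ix))%N.
have mV (F : numFieldType) : m%:R = d`!%:R * L%:R * p%:R / ix%:R :> F.
  by rewrite /m !natrM -[in RHS](divnK ixp) natrM !mulrA mulfK // pnatr_eq0 -lt0n.
move=> H; exists m; split; last by rewrite -!EFinM mV.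
by rewrite mV; move: H; congr (Hstar_at1 R g); ring.
Qed.

End ValueAtOne.

(** * Failure of polynomiality in degree four and above *)

Section NonPolynomial.
Variables (R : realType) (n : nat).
Local Notation "A %:RM" := (map_mx (intr : int -> R) A) (at level 2, format "A %:RM").

(** The value of the series at the identity times (1 + X)^(d+1) is a polynomial. As
all the coefficients of both factors are nonnegative, nothing cancels: the
degrees of the characters vanish for large i, and with them the
characters. *)
Lemma effective_polynomial : (0 < n)%N -> Hstar_effective R n -> Hstar_polynomial R n.
Proof.
move=> n_gt0 eff; have [d [A [B [L [mE _ _ _ [sA sB _ EE]]]]]] := ehrhart_altpoly R n_gt0 1%g.
have [P HP _] := Hstar_value n_gt0 mE sA sB EE.
exists (size P) => i sP; apply/eqP; rewrite -char1_eq0 ?eff //.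
have q0 j : 0 <= ((1 + 'X : {poly algC}) ^+ d.+1)`_j.
  elim: d.+1 j => [|k IH] j; first by rewrite expr0 coef1 ler0n.
  by rewrite exprS mulrDl mul1r coefD coefXM addr_ge0 //; case: ifP.
have H0 j : 0 <= Hstar R n j 1%g by apply: char1_ge0; apply: eff.
have := HP i; rewrite nth_default // /convol big_ord_recl subn0 => /esym/eqP.
rewrite paddr_eq0; first last.
- by apply: sumr_ge0 => j _; apply: mulr_ge0; [exact: q0|exact: H0].
- by apply: mulr_ge0; [exact: q0|exact: H0].
by case/andP=> + _; rewrite -horner_coef0 horner_exp !hornerE expr1n mul1r.
Qed.

Lemma porbit_fixed (g : 'S_n) i : g i = i -> porbit g i = [set i]%SET.
Proof.
move=> gi; apply/setP => k; rewrite inE; apply/idP/eqP => [/porbitP[m ->]|->].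
  by elim: m => [|m IH]; rewrite ?expg0 ?perm1 // expgSr permM IH.
exact: porbit_id.
Qed.

Lemma porbit_not_fixed (g : 'S_n) i : g i != i -> (1 < #|porbit g i|)%N.
Proof.
move=> gi; apply: (@leq_trans #|[set i; g i]%SET|); first by rewrite cards2 eq_sym gi.
apply: subset_leq_card; apply/fintype.subsetP => k; rewrite !inE => /orP[]/eqP->.
  exact: porbit_id.
by have := mem_porbit g 1 i; rewrite expg1.
Qed.

Lemma tperm_cycles (i0 i1 : 'I_n) : i0 != i1 ->
  porbit (tperm i0 i1) i0 = [set i0; i1]%SET.
Proof.
move=> n01; apply/setP => k; rewrite !inE; apply/idP/orP.
  case/porbitP => m ->; elim: m => [|m]; first by rewrite expg0 perm1 eqxx; left.
  by rewrite expgSr permM => -[]/eqP ->; rewrite ?tpermL ?tpermR eqxx; [right|left].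
case=> /eqP ->; first exact: porbit_id.
by have := mem_porbit (tperm i0 i1) 1 i0; rewrite expg1 tpermL.
Qed.

Lemma tperm_denom (i0 i1 : 'I_n) : i0 != i1 ->
  exists k, Hstar_denom (tperm i0 i1) = (1 - 'X) ^+ k * (1 + 'X).
Proof.
move=> n01; have n0 : (0 < n)%N by apply: leq_ltn_trans (ltn_ord i0).
set g := tperm i0 i1; rewrite Hstar_denomE // (bigD1 (porbit g i0)) ?cyc_mem //=.
rewrite tperm_cycles // cards2 n01.
rewrite (eq_bigr (fun=> 1 - 'X)) => [|a /andP[/imsetP[k _ ->] ak]].
  rewrite prodr_const; move: {+}#|_| => m; exists m.+1.
  have -> : (1 - 'X : {poly algC}) ^+ m.+1 = (1 - 'X) * (1 - 'X) ^+ m by rewrite exprS.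
  move: ((1 - 'X) ^+ m) => Y; rewrite (_ : 'X^_ = 'X * 'X) // .
  ring.
have nk : g k = k.
  apply: tpermD; apply: contraNneq ak => <-; first by apply/eqP/tperm_cycles.
  rewrite -tperm_cycles // eq_porbit_mem tperm_cycles //.
  by rewrite !inE eqxx orbT.
by rewrite porbit_fixed // cards1 expr1.
Qed.

(** At a transposition of two points i0 and i1 the denominator has a simple zero at
X = -1, so a polynomial series would force the difference between the counting
polynomials for even and for odd t to be constant. The base point has half-integral
coordinates at i0 and i1, whereas the generator attached to two further fixed
points i2 and i3 vanishes there; hence the difference grows at least like
t. *)
Lemma not_polynomial : (4 <= n)%N -> ~ Hstar_polynomial R n.
Proof.
move=> n4 [N HN]; have n0 : (0 < n)%N by apply: leq_trans n4.
pose o k (h : (k < 4)%N) : 'I_n := Ordinal (leq_trans h n4).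
pose i0 := @o 0 isT; pose i1 := @o 1%N isT; pose i2 := @o 2%N isT; pose i3 := @o 3%N isT.
have n01 : i0 != i1 by []. have n23 : i2 != i3 by [].
set g := tperm i0 i1.
have c0 : porbit g i0 = [set i0; i1]%SET by apply: tperm_cycles.
have c2 : porbit g i2 = [set i2]%SET by apply: porbit_fixed; rewrite tpermD.
have c3 : porbit g i3 = [set i3]%SET by apply: porbit_fixed; rewrite tpermD.
have [L [C HC]] := poly_growth_exists R (cycle_gens g).
have [a0 [_ _ Ha0]] := HC 0; have [a1 [_ _ Ha1]] := HC (zono_base R g).
pose f (a : nat -> nat) t := (\sum_(j < n.+1) a j * t ^ j)%N.
have [z2 z2E] := double_zono_base_integral R g.
have EE t : ehrhart_char R t g = f (if odd t then a1 else a0) t.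
  apply: ehrhart_zpoints.
  have tE : t%:R *: zono_base R g = (odd t)%:R *: zono_base R g + (z2 *+ t./2)%:RM.
    rewrite -{1}(odd_double_half t) natrD scalerDl; congr (_ + _).
    rewrite -muln2 natrM -scalerA z2E scaler_nat.
    by apply/rowP => i; rewrite mulmxnE !mxE mulmxnE rmorphMn.
  rewrite tE; apply: zpoints_shift; case: (odd t); last by rewrite scale0r; apply: Ha0.
  by rewrite scale1r; apply: Ha1.
(* Which of the two pairs indexes a nonzero generator depends on the order of the cycles. *)
have gap t : (f a1 t + t <= f a0 t)%N.
  have [p [pE pgen]] : exists p, (p = (porbit g i2, porbit g i3) \/ p = (porbit g i3, porbit g i2)) /\
     cycle_gen g p = cycle_vector p.1 p.2.
    have [lt|nlt] := boolP (cycle_lt (porbit g i2) (porbit g i3)).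
      by exists (porbit g i2, porbit g i3); split; [left|rewrite /cycle_gen /= !cyc_mem lt].
    exists (porbit g i3, porbit g i2); split; first by right.
    rewrite /cycle_gen /= !cyc_mem cycle_lt_total ?nlt //.
    by rewrite c2 c3; apply: contraNneq n23 => /setP/(_ i3); rewrite !inE eqxx => /esym/eqP ->.
  pose r := enum_rank p.
  have rE : row r (cycle_gens g) = cycle_vector p.1 p.2.
    by rewrite -pgen; apply/rowP => i; rewrite !mxE enum_rankK.
  apply: (zpoints_linear_gap (r := r) _ _ (Ha1 t) (Ha0 t)).
    rewrite rE; apply/eqP => /rowP/(_ i2); rewrite !mxE.
    by case: pE => -> /=; rewrite c2 c3 !inE !cards1 eqxx (negPf n23).
  move=> z s /rowP/(_ i0); rewrite rE [RHS]mxE [X in _ = X + _]mxE.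
  have -> : (s *: (cycle_vector p.1 p.2)%:RM) 0 i0 = 0.
    rewrite !mxE; have [h2 h3] : (i0 \in porbit g i2) = false /\ (i0 \in porbit g i3) = false.
      by rewrite c2 c3 !inE.
    by case: pE => -> /=; rewrite h2 h3 /= !mulr0 ?subr0 ?oppr0 ?addr0 ?mulr0.
  by rewrite addr0; apply: zono_base_not_int; rewrite c0 cards2 n01.
pose A : {poly algC} := \poly_(j < n.+1) (((a0 j)%:R + (a1 j)%:R) / 2).
pose B : {poly algC} := \poly_(j < n.+1) (((a0 j)%:R - (a1 j)%:R) / 2).
have EP t : (ehrhart_char R t g)%:R = altpoly A B t.
  rewrite EE /altpoly !horner_poly natr_sum mulr_sumr -big_split.
  apply: eq_bigr => j _ /=; rewrite natrM natrX -signr_odd.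
  by case: (odd t); rewrite ?expr1 ?expr0; field.
have [k kE] := tperm_denom n01.
have Bc := @alternating_part_const algC k A B N.
have {}Bc : forall i, B.[i.+1%:R] = B.[i%:R].
  apply: Bc => i Ni; have := HN i Ni => /cfunP/(_ g); rewrite HstarE cfunE kE.
  by rewrite (eq_convol _ EP).
have BE t : B.[t%:R] = ((f a0 t)%:R - (f a1 t)%:R) / 2.
  rewrite horner_poly !natr_sum -sumrB mulr_suml; apply: eq_bigr => j _.
  by rewrite !natrM natrX; ring.
have B0 t : B.[t%:R] = B.[0%:R].
  by elim: t => // t IH; rewrite Bc.
have f0 t : (f a0 t + f a1 0 = f a0 0 + f a1 t)%N.
  have := B0 t; rewrite !BE => /(mulIf _) h.
  have {}h : (f a0 t)%:R - (f a1 t)%:R = (f a0 0)%:R - (f a1 0)%:R :> algC.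
    by apply: h; rewrite invr_neq0 // pnatr_eq0.
  apply/eqP; rewrite -(eqr_nat algC) !natrD; apply/eqP.
  by move/eqP: h; rewrite subr_eq addrAC eq_sym subr_eq => /eqP ->.
(* For t = T the gap exceeds the constant value of the difference, taken at 0. *)
have [T TE] : exists T, T = (f a0 0).+1 by eexists.
move: (f0 T) (gap T) TE; move: (f a0 T) (f a1 T) (f a0 0%N) (f a1 0%N); clear; lia.
Qed.

End NonPolynomial.

(** * The equivariant series in degree at most three *)

Section SmallCounts.
Variables (R : realType) (n : nat).
Local Notation "A %:RM" := (map_mx (intr : int -> R) A) (at level 2, format "A %:RM").

(** The fixed polytope is the point with all coordinates (n + 1) / 2. *)
Lemma one_cycle_ehrhart (g : 'S_n) t : (0 < n)%N -> (forall i j, j \in porbit g i) ->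
  ehrhart_char R t g = ~~ odd (t * n.+1).
Proof.
move=> n0 gc; have cT i : porbit g i = [set: 'I_n]%SET.
  by apply/setP => j; rewrite gc inE.
have CT a : a \in porbits g -> a = [set: 'I_n]%SET by case/imsetP => k _ ->.
have gens0 : cycle_gens g = 0.
  apply/matrixP => r i; rewrite !mxE /cycle_gen; case: ifP => [|_]; last by rewrite mxE.
  by case/and3P => /CT -> /CT ->; rewrite cycle_ltnn.
have base_c i : zono_base R g 0 i = n.+1%:R / 2.
  rewrite zono_baseE cT cardsT card_ord big1 ?addr0 // => b /andP[/CT ->].
  by rewrite cycle_ltnn.
apply: ehrhart_zpoints; rewrite gens0 scaler0.
have zpointsE z : zpoints (t%:R *: zono_base R g) (0 : 'M[int]_(#|{: {set 'I_n} * {set 'I_n}}|, n)) z <->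
    forall i, (2 * z 0 i)%R = (t * n.+1)%N%:Z.
  split=> [[l _ /rowP zE] i|zi].
    have := zE i; rewrite map_mx0 mulmx0 addr0 [LHS]mxE [RHS]mxE base_c => h.
    by apply: (@intr_inj R); rewrite rmorphM /= h -pmulrn natrM; field.
  exists 0; first by move=> j; rewrite mxE lexx ler01.
  rewrite mul0mx addr0; apply/rowP => i; rewrite [LHS]mxE [RHS]mxE base_c.
  have := congr1 (intr : int -> R) (zi i); rewrite rmorphM /= -pmulrn natrM; lra.
have [ev|od] := boolP (odd (t * n.+1)).
  apply: has_card0 => z /zpointsE/(_ (Ordinal n0)); move: (t * n.+1)%N (z 0 _) ev; clear; lia.
apply: (@has_card1 _ _ (const_mx ((t * n.+1)./2)%:Z)) => z; rewrite zpointsE; split.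
  by move=> zi; apply/rowP => i; rewrite mxE; move: (zi i) od; move: (t * n.+1)%N (z 0 i); clear; lia.
by move=> -> i; rewrite mxE; move: (t * n.+1)%N od; clear; lia.
Qed.

(** The fixed polytope is a segment; s is the share of the large cycle in the games
with the fixed point. *)
Lemma fixed_two_cycles (g : 'S_n) i0 (x : 'rV[R]_n) : g i0 = i0 ->
  (forall i j, i != i0 -> j != i0 -> j \in porbit g i) ->
  fixed_permutahedron R g x <-> exists2 s, 0 <= s <= 1 &
    (forall i, i != i0 -> x 0 i = n%:R / 2 + s) /\ x 0 i0 = n%:R - s * n.-1%:R.
Proof.
move=> gi0 gc; have c0 : porbit g i0 = [set i0]%SET by apply: porbit_fixed.
have ci i : i != i0 -> porbit g i = ~: [set i0]%SET.
  move=> ii0; apply/setP => j; rewrite !inE; apply/idP/idP => [|ji]; last exact: gc.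
  by rewrite -eq_porbit_mem; apply: contraTneq => ->; rewrite eq_sym eq_porbit_mem c0 inE.
have n0 : (0 < n)%N by apply: leq_ltn_trans (ltn_ord i0).
have nE : n%:R = n.-1%:R + 1 :> R by rewrite natr1 prednK.
set a := (~: [set i0])%SET in ci; set b := [set i0]%SET in c0.
have nab : a != b.
  by apply/negP => /eqP/setP/(_ i0); rewrite !inE eqxx.
have scoreE (l : {set 'I_n} -> {set 'I_n} -> R) i : fractional l ->
    score (fun i j => l (porbit g i) (porbit g j)) 0 i =
    if i == i0 then n%:R - l a b * n.-1%:R else n%:R / 2 + l a b.
  move=> fl; rewrite mxE (bigD1 i0) //= c0.
  rewrite (eq_bigr (fun=> l (porbit g i) a)) => [|j ji]; last by rewrite (ci j ji).
  rewrite sumr_const cardC1 card_ord -[_ *+ _]mulr_natr.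
  have [_ lab] := fl a b; have [_ laa] := fl a a; have [_ lbb] := fl b b.
  have [->|ii0] := eqVneq i i0; first by rewrite c0 nE; nra.
  by rewrite ci // nE; nra.
rewrite fixed_score; split.
  case=> l fl ->; exists (l a b).
    have [? _] := fl a b; have [? ?] := fl b a; apply/andP; split; lra.
  by split=> [i ii0|]; rewrite scoreE // ?eqxx // (negPf ii0).
case=> s /andP[s0 s1] [xi x0].
pose l (u v : {set 'I_n}) : R := if u == b then (if v == b then 2^-1 else 1 - s)
                      else (if v == b then s else 2^-1).
have fl : fractional l.
  by move=> u v; rewrite /l; case: (u == b); case: (v == b); split; lra.
exists l => //; apply/rowP => i; rewrite scoreE // /l (negPf nab) eqxx.
by case: eqVneq => [->|/xi].
Qed.

Lemma two_cycles_ehrhart (g : 'S_n) i0 t : (1 < n)%N -> g i0 = i0 ->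
  (forall i j, i != i0 -> j != i0 -> j \in porbit g i) ->
  ehrhart_char R t g = (t + ~~ odd (t * n))%N.
Proof.
move=> n1 gi0 gc; apply: ehrhart_zpoints.
pose k0 := uphalf (t * n); pose T := (t * n * n.+1)./2.
have TE : (2 * T = t * n * n.+1)%N.
  rewrite /T mul2n halfK oddM -mulnA oddM /=; case: (odd n); case: (odd t) => //=; lia.
pose f (j : nat) : 'rV[int]_n := \row_i
   (if i == i0 then T%:Z - n.-1%:Z * (k0 + j)%N%:Z else (k0 + j)%N%:Z).
have [i1 i10] : exists i1, i1 != i0.
  have : (0 < #|~: [set i0]%SET|)%N by rewrite cardsC1 card_ord; lia.
  by case/card_gt0P => i1; rewrite !inE; exists i1.
have nE : n%:R = n.-1%:R + 1 :> R by rewrite natr1 prednK // ltnW.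
have TR : 2 * T%:R = t%:R * n%:R * (n%:R + 1) :> R.
  by rewrite natr1 -!natrM -TE natrM.
have zpointsE z : zpoints (t%:R *: zono_base R g) (t%:Z *: cycle_gens g) z <->
    exists2 j, (j < t + ~~ odd (t * n))%N & z = f j.
  rewrite /zpoints /lattice_points /= -dilate_zono -fixed_permutahedron_zono; split.
    case=> x /(fixed_two_cycles _ gi0 gc)[s /andP[s0 s1] [xi x0]] /rowP xz.
    have zi i : i != i0 -> (z 0 i)%:~R = t%:R * (n%:R / 2 + s) :> R.
      by move=> ii0; have := xz i; rewrite !mxE xi.
    have z0 : (z 0 i0)%:~R = t%:R * (n%:R - s * n.-1%:R) :> R.
      by have := xz i0; rewrite !mxE x0.
    have lo : (t * n)%N%:Z <= 2 * z 0 i1.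
      rewrite -(ler_int R) intrM (zi _ i10) -pmulrn natrM.
      have ? : 0 <= t%:R :> R by [].
      nra.
    have hi : 2 * z 0 i1 <= (t * n + 2 * t)%N%:Z.
      rewrite -(ler_int R) intrM (zi _ i10) -pmulrn natrD !natrM.
      have ? : 0 <= t%:R :> R by [].
      nra.
    have le0 : k0%:Z <= z 0 i1 by rewrite /k0; lia.
    have [zk zkE] : exists zk : int, zk = z 0 i1 by eexists.
    rewrite -zkE in lo hi le0.
    exists `|zk - k0|%N; first by rewrite /k0 in le0 *; move: (t * n)%N lo hi le0; clear; lia.
    apply/rowP => i; rewrite mxE.
    have -> : (k0 + `|zk - k0|)%N%:Z = z 0 i1 by rewrite -zkE; move: le0; clear; lia.
    apply: (@intr_inj R); have [->|ii0] := eqVneq i i0; last by rewrite !zi.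
    rewrite rmorphB rmorphM /= (zi _ i10) z0 -!pmulrn; move: TR; rewrite nE; nra.
  case=> j jlt ->; set k := (k0 + j)%N.
  have [klo khi] : (t * n <= 2 * k)%N /\ (2 * k <= t * n + 2 * t)%N.
    by rewrite /k /k0; move: jlt; case: (odd (t * n)) (odd_double_half (t * n)) (uphalf_half (t * n)) => /=; lia.
  have kloR : t%:R * n%:R <= 2 * k%:R :> R by rewrite -!natrM ler_nat.
  have khiR : 2 * k%:R <= t%:R * n%:R + 2 * t%:R :> R by rewrite -!natrM -natrD ler_nat.
  have [t0|t0] := posnP t.
    exists (\row_i (if i == i0 then n%:R else n%:R / 2)).
      apply/(fixed_two_cycles _ gi0 gc); exists 0; first by rewrite lexx ler01.
      by split=> [i ii0|]; rewrite mxE ?eqxx ?(negPf ii0) ?addr0 ?mul0r ?subr0.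
    have k00 : k = 0%N by move: khi; rewrite t0; lia.
    have T0 : T = 0%N by move: TE; rewrite t0; lia.
    rewrite t0 scale0r; apply/rowP => i; rewrite !mxE -/k k00 T0.
    by case: ifP; rewrite ?mulr0 ?subr0.
  have t0R : 0 < t%:R :> R by rewrite ltr0n.
  pose s : R := (k%:R - t%:R * n%:R / 2) / t%:R.
  have sE : t%:R * s = k%:R - t%:R * n%:R / 2 by rewrite /s mulrC divfK // gt_eqF.
  exists (\row_i (if i == i0 then n%:R - s * n.-1%:R else n%:R / 2 + s)).
    apply/(fixed_two_cycles _ gi0 gc); exists s.
      by apply/andP; split; rewrite -(ler_pM2l t0R) sE; lra.
    by split=> [i ii0|]; rewrite mxE ?eqxx ?(negPf ii0).
  apply/rowP => i; rewrite !mxE -/k; case: ifP => _.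
    rewrite rmorphB rmorphM /= -!pmulrn mulrBr mulrA sE.
    by move: TR; rewrite nE; nra.
  by rewrite mulrDr sE -pmulrn; lra.
exists (map f (iota 0 (t + ~~ odd (t * n)))); split.
- rewrite map_inj_uniq ?iota_uniq // => j j' /rowP/(_ i1).
  by rewrite !mxE (negPf i10); lia.
- by rewrite size_map size_iota.
move=> z; rewrite zpointsE; split.
  by case=> j jlt ->; apply: map_f; rewrite mem_iota.
by case/mapP => j; rewrite mem_iota => jlt ->; exists j.
Qed.

End SmallCounts.

Section Hexagon.
Variable R : realType.
Local Notation "A %:RM" := (map_mx (intr : int -> R) A) (at level 2, format "A %:RM").

Local Notation o0 := (@Ordinal 3 0 isT).
Local Notation o1 := (@Ordinal 3 1 isT).
Local Notation o2 := (@Ordinal 3 2 isT).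

Lemma ord3 (i : 'I_3) : [\/ i = o0, i = o1 | i = o2].
Proof.
case: i => -[|[|[|]]] // h; [apply: Or31|apply: Or32|apply: Or33]; exact: val_inj.
Qed.

Lemma sum3 (F : 'I_3 -> R) : \sum_i F i = F o0 + F o1 + F o2.
Proof.
rewrite !big_ord_recl big_ord0 addr0 addrA; congr (_ + _ + _); congr F; exact: val_inj.
Qed.

(** A point that satisfies the inequalities is the score vector of a tournament whose
result a between the first two players solves three interval conditions. *)
Lemma permutahedron3 (x : 'rV[R]_3) : permutahedron R 3 x <->
  x 0 o0 + x 0 o1 + x 0 o2 = 6 /\ forall i, 1 <= x 0 i <= 3.
Proof.
split.
  case/permutahedron_score => p fp ->.
  have [? ?] := fp o0 o1; have [? ?] := fp o0 o2; have [? ?] := fp o1 o2.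
  have [? ?] := fp o1 o0; have [? ?] := fp o2 o0; have [? ?] := fp o2 o1.
  have [? ?] := fp o0 o0; have [? ?] := fp o1 o1; have [? ?] := fp o2 o2.
  split; first by rewrite !mxE !sum3; lra.
  by move=> i; rewrite mxE sum3; case: (ord3 i) => ->; apply/andP; split; lra.
case=> xs x13; have /andP[? ?] := x13 o0; have /andP[? ?] := x13 o1; have /andP[? ?] := x13 o2.
have [a [a0 a1 [a2 a3 [a4 a5]]]] : exists a : R, [/\ 0 <= a, a <= 1 &
    [/\ 0 <= x 0 o0 - 1 - a, x 0 o0 - 1 - a <= 1 &
    0 <= x 0 o1 - 2 + a /\ x 0 o1 - 2 + a <= 1]].
  have [h1|h1] := leP 0 (x 0 o0 - 2); have [h2|h2] := leP (2 - x 0 o1) (x 0 o0 - 2).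
  - by exists (x 0 o0 - 2); split; [| |split; [| |split]]; lra.
  - by exists (2 - x 0 o1); split; [| |split; [| |split]]; lra.
  - by exists 0; split; [| |split; [| |split]]; lra.
  - have [h3|h3] := leP 0 (2 - x 0 o1).
      by exists (2 - x 0 o1); split; [| |split; [| |split]]; lra.
    by exists 0; split; [| |split; [| |split]]; lra.
pose q (i j : nat) : R := match i, j with
  | 0%N, 1%N => a | 0%N, 2%N => x 0 o0 - 1 - a | 1%N, 2%N => x 0 o1 - 2 + a
  | 1%N, 0%N => 1 - a | 2%N, 0%N => 2 - x 0 o0 + a | 2%N, 1%N => 3 - x 0 o1 - a
  | _, _ => 2^-1 end.
have fq : fractional (fun i j : 'I_3 => q i j).
  by move=> i j; case: (ord3 i) => ->; case: (ord3 j) => -> /=; split; lra.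
rewrite (_ : x = score (fun i j : 'I_3 => q i j)); first exact: score_permutahedron.
by apply/rowP => i; rewrite mxE sum3; case: (ord3 i) => -> /=; lra.
Qed.

(** The first two coordinates of the lattice points of the t-th dilate; the third one is
6 t minus their sum. *)
Definition hexagon_pairs (t : nat) : seq (nat * nat) :=
  [seq p <- [seq (i, j) | i <- iota t (2 * t).+1, j <- iota t (2 * t).+1] |
     (t <= 6 * t - p.1 - p.2 <= 3 * t)%N].

Lemma hexagon_ehrhart t : ehrhart_char R t (1 : 'S_3)%g = size (hexagon_pairs t).
Proof.
apply: ehrhart_zpoints.
pose f (p : nat * nat) : 'rV[int]_3 :=
  \row_i (nth 0 [:: p.1%:Z; p.2%:Z; 6 * t%:Z - p.1%:Z - p.2%:Z] i).
have zpointsE z : zpoints (t%:R *: zono_base R 1%g) (t%:Z *: cycle_gens 1%g) z <->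
    z 0 o0 + z 0 o1 + z 0 o2 = 6 * t%:Z /\ forall i, t%:Z <= z 0 i <= 3 * t%:Z.
  rewrite /zpoints /lattice_points /= -dilate_zono -fixed_permutahedron_zono; split.
    case=> x [/permutahedron3[xs x13] _] /rowP xz.
    have zx i : (z 0 i)%:~R = t%:R * x 0 i by have := xz i; rewrite !mxE.
    split.
      apply: (@intr_inj R); rewrite !intrD intrM !zx -!mulrDr xs -pmulrn.
      by rewrite mulrC.
    move=> i; have /andP[x1 x3] := x13 i.
    rewrite -!(ler_int R) intrM zx -pmulrn [3 * _]mulrC.
    by rewrite -{1}[t%:R]mulr1 !ler_wpM2l.
  case=> zs zi; have [t0|t0] := posnP t.
    have z0 : z = 0.
      by apply/rowP => i; have := zi i; rewrite t0 mulr0 mxE => /le_anti <-.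
    rewrite z0 t0; exists (const_mx 2); last by rewrite scale0r map_mx0.
    split; last by rewrite perm_mx1 mulmx1.
    by apply/permutahedron3; split=> [|i]; rewrite !mxE; [lra|apply/andP; split; lra].
  have t0R : 0 < t%:R :> R by rewrite ltr0n.
  exists (t%:R^-1 *: z%:RM); last by rewrite scalerA mulfV ?scale1r // gt_eqF.
  split; last by rewrite perm_mx1 mulmx1.
  apply/permutahedron3; split=> [|i]; rewrite !mxE.
    rewrite -!mulrDr -!intrD zs intrM -pmulrn mulrCA mulVf ?mulr1 // gt_eqF //.
  have /andP[] := zi i; rewrite -!(ler_int R) intrM -pmulrn => h1 h2.
  by rewrite mulrC ler_pdivlMr // ler_pdivrMr // mul1r h1.
have finj : injective f.
  move=> [i j] [i' j'] /rowP h; have := h o0; have := h o1; rewrite !mxE /=.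
  by move=> [->] [->].
exists (map f (hexagon_pairs t)); split.
- rewrite map_inj_uniq // filter_uniq // allpairs_uniq ?iota_uniq //.
  by move=> [i j] [i' j'].
- by rewrite size_map.
move=> z; rewrite zpointsE; split.
  case=> zs zi; have := zi o0; have := zi o1; have := zi o2.
  have zE : z = f (`|z 0%R o0|%N, `|z 0%R o1|%N).
    apply/rowP => i; rewrite mxE; have := zi o0; have := zi o1; move: zs.
    by case: (ord3 i) => -> /=; lia.
  move=> h2 h1 h0; rewrite zE; apply: map_f; rewrite mem_filter; apply/andP; split.
    by rewrite /=; move: h0 h1 h2 zs; lia.
  by apply: (allpairs_f pair); rewrite mem_iota; move: h0 h1; clear; move: (z _ o0) (z _ o1); lia.
case/mapP => -[i j]; rewrite mem_filter => /andP[/= h hin] ->.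
have [[i' j'] /= [h1 h2 [ii jj]]] := elimT (@allpairsP nat nat (nat * nat)%type pair
  (iota t (2 * t).+1) (iota t (2 * t).+1) (i, j)) hin.
have {}h1 : i \in iota t (2 * t).+1 by rewrite ii.
have {}h2 : j \in iota t (2 * t).+1 by rewrite jj.
move: h1 h2.
rewrite !mem_iota => h1 h2; rewrite !mxE /=; split; first by lia.
by move=> k; rewrite mxE; case: (ord3 k) => -> /=; lia.
Qed.

End Hexagon.

Section SmallSeries.

Lemma convol_1subXn (F : numFieldType) k (u : nat -> F) i :
  convol (1 - 'X^k) u i = u i - (if (i < k)%N then 0 else u (i - k)%N).
Proof.
rewrite (@convol_coef _ i.+1) // mulrBl mul1r coefB coefXnM coef_poly ltnSn.
by rewrite coef_poly ltnS leq_subr.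
Qed.

Variant small_perm_spec n (g : 'S_n) : Prop :=
| SmallId of g = 1%g
| SmallCycle of (forall i j, j \in porbit g i)
| SmallTransposition i0 of n = 3 & g i0 = i0 & (forall i, i != i0 -> g i != i) &
    (forall i j, i != i0 -> j != i0 -> j \in porbit g i).

(** Two cycles without fixed points would need four points, and a fixed point next to
a moved one leaves exactly one transposition. *)
Lemma small_permP n (g : 'S_n) : (n <= 3)%N -> small_perm_spec g.
Proof.
move=> n3; have [->|g1] := eqVneq g 1%g; first exact: SmallId.
have [[i0 gi0]|nofix] := pselect (exists i, g i = i); last first.
  have gi i : g i != i by apply/eqP => h; apply: nofix; exists i.
  apply: SmallCycle => i j; apply: contraT => nji.
  have : (#|porbit g i :|: porbit g j|%SET <= n)%N.
    by rewrite -[X in (_ <= X)%N]card_ord max_card.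
  rewrite cardsU (_ : porbit g i :&: porbit g j = finset.set0)%SET; last first.
    apply/setP => k; rewrite !inE; apply/negP => /andP[].
    by rewrite -!eq_porbit_mem => /eqP -> /eqP h; rewrite -eq_porbit_mem h eqxx in nji.
  rewrite cards0; have := porbit_not_fixed (gi i); have := porbit_not_fixed (gi j); lia.
have [k gk] : exists k, g k != k.
  apply: contrapT => h; case/eqP: g1; apply/permP => k; rewrite perm1.
  by apply/eqP; apply: contraT => gk; case: h; exists k.
have ki0 : k != i0 by apply: contraNneq gk => ->; rewrite gi0.
have gki0 : g k != i0 by rewrite -gi0 (inj_eq perm_inj).
have c3 : #|[set i0; k; g k]%SET| = 3%N.
  by rewrite -finset.setUA cardsU1 cards2 !inE negb_or ![i0 == _]eq_sym ki0 gki0 eq_sym gk.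
have n3E : n = 3%N.
  by apply/eqP; rewrite eqn_leq n3 -c3 -[X in (_ <= X)%N](card_ord n) max_card.
have all3 i : i != i0 -> i = k \/ i = g k.
  move=> ii0; have : [set i0; k; g k]%SET = [set: 'I_n]%SET.
    by apply/eqP; rewrite eqEcard finset.subsetT cardsT card_ord c3 n3E.
  by move/setP/(_ i); rewrite !inE (negPf ii0) /= => /orP[]/eqP; [left|right].
have kgk : g k \in porbit g k by have := mem_porbit g 1 k; rewrite expg1.
apply: (SmallTransposition (i0 := i0)) => //.
  move=> i /all3[->//|->]; by rewrite (inj_eq perm_inj).
move=> i j /all3[] -> /all3[] ->; rewrite ?porbit_id // porbit_sym //.
Qed.

Variable R : realType.

Lemma Hstar_one_cycle n (g : 'S_n) : (0 < n <= 3)%N -> (forall i j, j \in porbit g i) ->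
  forall i, Hstar R n i g = (nth 0 (if n == 3 then [:: 1; 1; 1] else [:: 1; 0; 0])%N i)%:R.
Proof.
move=> /andP[n0 n3] gc i; rewrite HstarE Hstar_denomE //.
have CE : porbits g = [set [set: 'I_n]]%SET.
  apply/setP => a; rewrite inE; apply/imsetP/eqP => [[k _ ->]|->].
    by apply/setP => j; rewrite gc inE.
  by exists (Ordinal n0) => //; apply/setP => j; rewrite gc inE.
rewrite CE big_set1 cardsT card_ord convol_1subXn !one_cycle_ehrhart //.
have : n \in [:: 1; 2; 3]%N by move: n0 n3; case: (n) => [|[|[|[|]]]].
rewrite !inE => /or3P[]/eqP ->.
- by case: i => [|[|[|i]]]; rewrite ?subr0 ?subn1 //= ?oddM /= ?andbF ?subrr ?nth_nil.
- by case: i => [|[|[|i]]]; rewrite ?subr0 ?subn2 //= ?oddM /= ?andbT ?negbK ?subrr ?nth_nil.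
- by case: i => [|[|[|i]]]; rewrite ?subr0 ?subn3 //= ?oddM /= ?andbF ?subrr ?nth_nil.
Qed.

Lemma Hstar_id2 i : Hstar R 2 i 1%g = (nth 0 [:: 1; 0; 0]%N i)%:R.
Proof.
have single n (k : 'I_n) : porbit (1 : 'S_n)%g k = [set k]%SET.
  by apply: porbit_fixed; rewrite perm1.
rewrite HstarE Hstar_denomE //.
rewrite (eq_bigr (fun=> 1 - 'X)) => [|a /imsetP[k _ ->]]; last by rewrite single cards1 expr1.
rewrite prodr_const; have -> : #|porbits (1 : 'S_2)%g| = 2%N.
  rewrite (_ : porbits _ = [set [set k] | k in 'I_2]%SET) ?card_imset ?card_ord //.
    exact: finset.set1_inj.
  by apply: eq_imset => k; rewrite single.
have EE : (fun t => (ehrhart_char R t (1 : 'S_2)%g)%:R) =1 (fun t => t.+1%:R : algC).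
  move=> t; rewrite (@two_cycles_ehrhart R 2 1%g ord0) ?perm1 //.
    by rewrite oddM andbF addn1.
  move=> a b a0 b0; rewrite single inE; apply/eqP/val_inj.
  by move: a b a0 b0 => [[|[|]]] // ha [[|[|]]] // hb _ _.
rewrite (eq_convol _ EE) expr2 convolM.
case: i => [|[|[|i]]]; rewrite !convol_1subX /= ?nth_nil; [ring|ring|ring|].
by rewrite -!natr1; ring.
Qed.

(** The base point is integral, so the series has degree at most 2 and is determined by
the first three counts 1, 7 and 19. *)
Lemma Hstar_id3 i : Hstar R 3 i 1%g = (nth 0 [:: 1; 4; 1]%N i)%:R.
Proof.
have single n (k : 'I_n) : porbit (1 : 'S_n)%g k = [set k]%SET.
  by apply: porbit_fixed; rewrite perm1.
have [d [A [B [L [mE _ _ _ [sA sB B0 EE]]]]]] := @ehrhart_altpoly R 3 isT 1%g.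
have CE : #|porbits (1 : 'S_3)%g| = 3%N.
  rewrite (_ : porbits _ = [set [set k] | k in 'I_3]%SET) ?card_imset ?card_ord //.
    exact: finset.set1_inj.
  by apply: eq_imset => k; rewrite single.
have d2 : d = 2%N by move: mE; rewrite CE => -[].
have {}B0 : B = 0.
  by apply: B0; apply: zono_base_integral => a /imsetP[k _ ->]; rewrite single cards1.
have [N [sN _ HN]] := series_poly sA.
have HE j : Hstar R 3 j 1%g = convol ((1 - 'X) ^+ 3) (fun t => (ehrhart_char R t (1 : 'S_3)%g)%:R) j.
  rewrite HstarE Hstar_denomE //.
  rewrite (eq_bigr (fun=> 1 - 'X)) => [|a /imsetP[k _ ->]]; last by rewrite single cards1 expr1.
  by rewrite prodr_const CE.
have [i3|i3] := ltnP i 3; last first.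
  rewrite HE (eq_convol _ (v := fun t => A.[t%:R])) => [|t].
    by rewrite -d2 HN nth_default ?nth_default // -?d2 (leq_trans sN) // d2.
  by rewrite EE /altpoly B0 horner0 mulr0 addr0.
rewrite HE !exprS expr0 mulr1 !convolM !convol_1subX.
have E0 : ehrhart_char R 0 (1 : 'S_3)%g = 1%N by rewrite hexagon_ehrhart.
have E1 : ehrhart_char R 1 (1 : 'S_3)%g = 7%N by rewrite hexagon_ehrhart.
have E2 : ehrhart_char R 2 (1 : 'S_3)%g = 19%N by rewrite hexagon_ehrhart.
case: i i3 => [|[|[|]]] // _; rewrite /= !convolM; do !rewrite convol_1subX /=;
by rewrite ?E2 ?E1 ?E0; ring.
Qed.

Lemma Hstar_transposition3 (g : 'S_3) i0 : g i0 = i0 -> (forall i, i != i0 -> g i != i) ->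
  (forall i j, i != i0 -> j != i0 -> j \in porbit g i) ->
  #|porbits g| = 2%N /\ forall i, Hstar R 3 i g = (nth 0 [:: 1; 0; 1]%N i)%:R.
Proof.
move=> gi0 gi gc.
have c0 : porbit g i0 = [set i0]%SET by apply: porbit_fixed.
have ci i : i != i0 -> porbit g i = ~: [set i0]%SET.
  move=> ii0; apply/setP => j; rewrite !inE; apply/idP/idP => [|ji]; last exact: gc.
  by rewrite -eq_porbit_mem; apply: contraTneq => ->; rewrite eq_sym eq_porbit_mem c0 inE.
have nab : [set i0]%SET != (~: [set i0])%SET.
  by apply/negP => /eqP/setP/(_ i0); rewrite !inE eqxx.
have [i1 i10] : exists i1, i1 != i0.
  have : (0 < #|~: [set i0]%SET|)%N by rewrite cardsC1 card_ord.
  by case/card_gt0P => i1; rewrite !inE; exists i1.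
have CE : porbits g = [set [set i0]; ~: [set i0]]%SET.
  apply/setP => a; rewrite !inE; apply/imsetP/orP => [[k _ ->]|].
    by have [->|k0] := eqVneq k i0; [left; rewrite c0|right; rewrite ci].
  by case=> /eqP ->; [exists i0|exists i1] => //; rewrite ?c0 ?ci.
split; first by rewrite CE cards2 nab.
move=> i; rewrite HstarE Hstar_denomE // CE big_setU1 ?inE //= big_set1 cards1 cardsC1 card_ord /=.
rewrite (_ : 1 - 'X^2 = (1 - 'X) * (1 + 'X)); last by ring.
rewrite expr1 convolM (eq_convol _ (convolM (1 - 'X) (1 + 'X) _)).
have EE t : ehrhart_char R t g = (t + ~~ odd t)%N.
  by rewrite (two_cycles_ehrhart R t _ gi0 gc) // oddM andbT.
have step1 : convol (1 + 'X) (fun t => (ehrhart_char R t g)%:R) =1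
    fun j => (2 * j + (j == 0))%N%:R :> algC.
  move=> j; rewrite convol_1addX EE; case: j => [|j]; first by rewrite addr0.
  by rewrite EE -natrD; congr (_%:R); rewrite /=; case: (odd j) => /=; lia.
rewrite (eq_convol _ (v := convol (1 - 'X) (fun j => (2 * j + (j == 0))%N%:R))); last first.
  exact: eq_convol.
case: i => [|[|[|i]]]; rewrite !convol_1subX /= ?nth_nil.
- by ring.
- by ring.
- by ring.
by rewrite !natrD !natrM -!natr1; ring.
Qed.

End SmallSeries.

(** * Effectiveness and the trivial constituent *)

Section SmallDegrees.

(** The disjoint union of three points, of the two signs, and of one point. Its
permutation character takes the values 6, 2 and 3 at the identity, at
transpositions and at 3-cycles. *)
Definition S3_act (x : 'I_3 + (bool + unit)) (g : 'S_3) : 'I_3 + (bool + unit) :=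
  match x with
  | inl i => inl (g i)
  | inr (inl b) => inr (inl (b (+) odd_perm g))
  | inr (inr u) => inr (inr u)
  end.

Lemma S3_act1 : S3_act^~ 1%g =1 id.
Proof. by case=> [i|[b|[]]] //=; rewrite ?perm1 // odd_perm1 addbF. Qed.

Lemma S3_actM x : act_morph S3_act x.
Proof. by case: x => [i|[b|[]]] g h //=; rewrite ?permM // odd_permM addbA. Qed.

Definition S3_action : {action 'S_3 &-> ('I_3 + (bool + unit))%type} :=
  TotalAction S3_act1 S3_actM.

Lemma card_S3_fix (g : 'S_3) : #|('Fix_S3_action[g])%g| =
  (#|[set i | g i == i]%SET| + (if odd_perm g then 0 else 2) + 1)%N.
Proof.
rewrite -sum1_card big_mkcond big_sumType /= big_sumType /=.
rewrite addnA; congr (_ + _ + _)%N.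
- rewrite -sum1_card [RHS]big_mkcond; apply: eq_bigr => i _.
  by rewrite inE; congr (if _ then _ else _); apply/afix1P/eqP => /= [[]|->].
- rewrite big_bool /=; have E b : (inr (inl b) \in 'Fix_S3_action[g])%g = ~~ odd_perm g.
    by apply/afix1P/idP => /=; case: (odd_perm g); case: b.
  by rewrite !E; case: (odd_perm g).
rewrite (bigD1 tt) //= big1 ?addn0; last by case.
by rewrite ifT //; apply/afix1P.
Qed.

Variable R : realType.

(** The series at the identity, at transpositions and at 3-cycles is 1 + 4X + X^2,
1 + X^2 and 1 + X + X^2 for n = 3, and it is constant equal to 1 for smaller n. *)
Lemma small_Hstar n (g : 'S_n) : (0 < n <= 3)%N -> exists s : seq nat,
  [/\ size s = 3%N, forall i, Hstar R n i g = (nth 0%N s i)%:R &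
  sumn s = if n == 3%N then (#|[set i | g i == i]%SET| + (if odd_perm g then 0 else 2) + 1)%N
           else 1%N].
Proof.
move=> n03; have /andP[n0 n3] := n03.
have oneC : (forall i j, j \in porbit g i) -> exists s : seq nat,
  [/\ size s = 3%N, forall i, Hstar R n i g = (nth 0%N s i)%:R &
  sumn s = if n == 3%N then (#|[set i | g i == i]%SET| + (if odd_perm g then 0 else 2) + 1)%N
           else 1%N].
  move=> gc; exists (if n == 3%N then [:: 1; 1; 1]%N else [:: 1; 0; 0]%N).
  split; [by case: eqP|exact: Hstar_one_cycle|case: eqP => // n3E].
  rewrite (_ : [set i | g i == i]%SET = finset.set0); last first.
    apply/setP => i; rewrite !inE; apply/negP => /eqP gi.
    have [j ji] : exists j : 'I_n, j != i.
      have : (0 < #|~: [set i]%SET|)%N by rewrite cardsC1 card_ord n3E.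
      by case/card_gt0P => j; rewrite !inE; exists j.
    by have := gc i j; rewrite porbit_fixed // inE (negPf ji).
  have -> : odd_perm g = false.
    rewrite /odd_perm card_ord (_ : porbits g = [set [set: 'I_n]]%SET) ?cards1 ?n3E //.
    apply/setP => a; rewrite inE; apply/imsetP/eqP => [[k _ ->]|->].
      by apply/setP => j; rewrite gc inE.
    by exists (Ordinal n0) => //; apply/setP => j; rewrite gc inE.
  by rewrite cards0.
have [g1|//|i0 n3E gi0 gi gc] := small_permP g n3; last first.
  move: g {oneC n0 n3 n03} i0 gi0 gi gc; rewrite n3E => g i0 gi0 gi gc.
  have [C2 H] := Hstar_transposition3 R gi0 gi gc.
  exists [:: 1; 0; 1]%N; split=> //=.
  rewrite (_ : [set i | g i == i]%SET = [set i0]%SET); last first.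
    apply/setP => i; rewrite !inE; have [->|/gi/negPf //] := eqVneq i i0.
    by rewrite gi0 eqxx.
  by rewrite /odd_perm card_ord C2 cards1.
have : n \in [:: 1; 2; 3]%N by move: n0 n3; case: (n) => [|[|[|[|]]]].
rewrite !inE => /or3P[]/eqP nE.
- apply: oneC => i j; suff -> : j = i by apply: porbit_id.
  by apply: val_inj => /=; have := ltn_ord i; have := ltn_ord j; lia.
- move: g g1 {oneC n0 n3 n03}; rewrite nE => g ->.
  by exists [:: 1; 0; 0]%N; split=> // i; apply: Hstar_id2.
move: g g1 {oneC n0 n3 n03}; rewrite nE => g ->.
exists [:: 1; 4; 1]%N; split=> // [i|]; first exact: Hstar_id3.
rewrite (_ : [set i | (1 : 'S_3)%g i == i]%SET = [set: 'I_3]%SET).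
  by rewrite cardsT card_ord odd_perm1.
by apply/setP => i; rewrite !inE perm1 eqxx.
Qed.

Lemma polynomial_small n : Hstar_polynomial R n -> (n <= 3)%N.
Proof. by move=> H; rewrite leqNgt; apply/negP => /(@not_polynomial R); apply. Qed.

(** Effectiveness forces n <= 3, where the sum of the coefficients is the permutation
character of an explicit set. *)
Lemma effective_perm_character n : (0 < n)%N -> Hstar_effective R n ->
  exists phi : 'CF([set: 'S_n]%G),
    (forall g : 'S_n, Hstar_at1 R g (phi g)) /\ is_perm_character phi.
Proof.
move=> n0 eff; have n3 := polynomial_small (effective_polynomial n0 eff).
have sm g := @small_Hstar n g (introT andP (conj n0 n3)).
exists (\sum_(i < 3) Hstar R n i).
have phiE g s : size s = 3%N -> (forall i, Hstar R n i g = (nth 0%N s i)%:R) ->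
    (\sum_(i < 3) Hstar R n i) g = (sumn s)%:R.
  move=> s3 sH; rewrite sum_cfunE sumnE (big_nth 0%N) s3 big_mkord natr_sum.
  by apply: eq_bigr => i _; rewrite sH.
split=> [g|].
  have [s [s3 sH _]] := sm g; rewrite (phiE g s s3 sH).
  exists (\poly_(i < 3) (nth 0%N s i)%:R), 1; split.
  - by rewrite hornerE oner_neq0.
  - move=> i; rewrite -[RHS]/(convol 1 (fun i => Hstar R n i g) i) convol1 sH coef_poly.
    by case: ltnP => // le3; rewrite nth_default ?s3.
  rewrite hornerE divr1 horner_poly sumnE (big_nth 0%N) s3 big_mkord natr_sum.
  by apply: eq_bigr => i _; rewrite expr1n mulr1.
have [n3E|n3N] := eqVneq n 3%N.
  move: sm phiE {n0 eff n3}; rewrite n3E => sm phiE.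
  exists ('I_3 + (bool + unit))%type, S3_action => g.
  by have [s [s3 sH sS]] := sm g; rewrite (phiE g s s3 sH) sS card_S3_fix eqxx.
pose triv (x : unit) (g : 'S_n) := x.
have triv1 : triv^~ 1%g =1 id by [].
have trivM x : act_morph triv x by [].
pose to : {action 'S_n &-> unit} := TotalAction triv1 trivM.
exists unit, to => g.
have [s [s3 sH sS]] := sm g; rewrite (phiE g s s3 sH) sS (negPf n3N).
rewrite (_ : ('Fix_to[g])%g = [set: unit]%SET) ?cardsT ?card_unit //.
by apply/setP => x; rewrite finset.in_setT; apply/afix1P.
Qed.

(** Polynomiality forces n <= 3, where the values of all coefficients are nonnegative.
The multiplicity of the trivial character is the mean of these values, and the
one at the identity is positive. *)
Lemma trivial_constituent n i : (0 < n)%N -> Hstar_polynomial R n -> 0 < hstar R n i ->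
  0 \in irr_constt (Hstar R n i).
Proof.
move=> n0 /polynomial_small n3 hpos.
have nn g : 0 <= Hstar R n i g.
  by have [s [_ -> _]] := @small_Hstar n g (introT andP (conj n0 n3)); rewrite ler0n.
rewrite irr_consttE irr0 cfdotE mulf_neq0 ?invr_eq0 ?neq0CG //.
rewrite (eq_bigr (Hstar R n i)) => [|g gG]; last by rewrite cfun1E gG conjC1 mulr1.
rewrite (bigD1 1%g) ?group1 //=; apply: lt0r_neq0; apply: ltr_wpDr => //.
by apply: sumr_ge0.
Qed.

End SmallDegrees.

Theorem proposition5p9 (R : realType) (n : nat) (n_gt0 : (1 <= n)%N) :
  [/\ Hstar_effective R n ->
        exists phi : 'CF([set: 'S_n]%G),
          (forall g : 'S_n, Hstar_at1 R g (phi g)) /\ is_perm_character phi,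
      forall sigma : 'S_n, exists m : nat,
        Hstar_at1 R sigma m%:R /\
        (((affine_dim (fixed_permutahedron R sigma))`!%:R)%:E
           * normalized_volume (fixed_permutahedron R sigma)
           * (det_perp R sigma)%:E
           * ((lattice_index (fixed_permutahedron R sigma))%:R^-1)%:E
         = m%:R%:E)%E
    & forall i : nat, Hstar_polynomial R n -> 0 < hstar R n i ->
        0 \in irr_constt (Hstar R n i)].
Proof.
split; [exact: effective_perm_character|exact: Hstar_at1_volume|].
by move=> i; apply: trivial_constituent.
Qed.
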